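(* Let $d\ge1$ be an integer, $a_0>0$, and let $(N_n)$ be a sequence of integers $N_n\ge2$ with $\lim_{n\to\infty}N_n=\infty$ and $\limsup_{n\to\infty}N_n/(\log n)^\nu<\infty$ for some $\nu>0$. Let $\mathcal{K}_{\mathcal{B}}$ be the family of Pinsker kernels described in the context, with $\mathrm{Card}(\mathcal{K}_{\mathcal{B}})=N_n$. Then for any $\beta>d/2$ and $Q>0$ the averaged (linear or convex) kernel aggregate $\tilde p_n^{\mathbb{S},\mathcal{K}_{\mathcal{B}}}$ satisfies $$\sup_{p\in\Theta(\beta,Q)}R_n(\tilde p_n^{\mathbb{S},\mathcal{K}_{\mathcal{B}}},p)\le C^*n^{-\frac{2\beta}{2\beta+d}}(1+o(1)),\qquad n\to\infty,$$ where $$C^*=\frac{[Q(2\beta+d)]^{\frac{d}{2\beta+d}}}{d(2\pi)^d}\Big(\frac{\beta S_d}{\beta+d}\Big)^{\frac{2\beta}{2\beta+d}},\qquad S_d=\frac{2\pi^{d/2}}{\Gamma(d/2)}.$$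
   Context: $X_1,\dots,X_n$ are i.i.d. random vectors in $\mathbb{R}^d$ with density $p$; $\|\cdot\|$ is the $L_2(\mathbb{R}^d)$ norm, $\|\cdot\|_d$ the Euclidean norm on $\mathbb{R}^d$, and $R_n(\hat p,p)=E_p^n\|\hat p-p\|^2$ for an estimator $\hat p$. The Fourier transform on $L_2(\mathbb{R}^d)$ is normalized so that $\mathcal{F}[f](t)=\int e^{ix^Tt}f(x)\,dx$ for $f\in L_1\cap L_2$. The Sobolev class $\Theta(\beta,Q)$ is the set of probability densities $p$ on $\mathbb{R}^d$ whose characteristic function $\varphi=\mathcal{F}[p]$ satisfies $\int_{\mathbb{R}^d}\|t\|_d^{2\beta}|\varphi(t)|^2dt\le Q$. Pinsker kernel: for $b>0$, $K_b\in L_2(\mathbb{R}^d)$ is the kernel with $\mathcal{F}[K_b](t)=(1-\|t\|_d^b)_+$. With $N=N_n$, $\mathcal{B}=\{\beta_1,\dots,\beta_N\}$, $\beta_1=d/2$, $\beta_j=\beta_{j-1}+N^{-1/2}$ for $j=2,\dots,N$, and $\mathcal{K}_{\mathcal{B}}=\{K_b:b\in\mathcal{B}\}$. Kernel estimators: for a subsample of size $m$ of $X_1,\dots,X_n$, bandwidth $h>0$ and kernel $K$, $\hat p_{m,h,K}(x)=\frac{1}{mh^d}\sum K\big(\frac{X_i-x}{h}\big)$, the sum being over the $X_i$ in the subsample. Grid: $h_0=(n\log n)^{-1/d}$, $a_n=a_0/\log n$, $M$ is defined by $M-2=\max\{j\in\{0,1,2,\dots\}:h_0(1+a_n)^j<1\}$,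 $h_j=(1+a_n)^jh_0$ for $j=1,\dots,M-2$, $h_{M-1}=1$, and $\mathcal{H}=\{h_0,\dots,h_{M-1}\}$. Splits: $m=\lfloor n(1-(\log n)^{-1})\rfloor$, $\ell=n-m$. A split $\mathcal{S}$ divides the sample into a training subsample of size $m$ and a validation subsample of size $\ell$ (the complementary observations). $\mathbb{S}$ is an arbitrary (nonempty, fixed for each $n$) set of such splits. Aggregates: given functions $q_1,\dots,q_D\in L_2(\mathbb{R}^d)$ and validation data $Y_1,\dots,Y_\ell$, the linear aggregate is $\sum_{j=1}^{D'}\big(\frac1\ell\sum_{i=1}^\ell\phi_j(Y_i)\big)\phi_j$, where $\phi_1,\dots,\phi_{D'}$ is an orthonormal basis in $L_2(\mathbb{R}^d)$ of the linear span of $q_1,\dots,q_D$; the convex aggregate is $\sum_{j=1}^D\hat\lambda_jq_j$ with $\hat\lambda\in\operatorname{argmin}_{\lambda\in\Lambda^D}\{\|\sum_j\lambda_jq_j\|^2-\frac2\ell\sum_{i=1}^\ell\sum_j\lambda_jq_j(Y_i)\}$, $\Lambda^D=\{\lambda\in\mathbb{R}^D:\lambda_j\ge0,\sum_j\lambda_j\le1\}$. For $\mathcal{S}\in\mathbb{S}$, $\tilde p_n^{\mathcal{S}}$ is the linear (respectively convex) aggregate of the $D=NM$ estimators $\{\hat p_{m,h,K}:K\in\mathcal{K}_{\mathcal{B}},h\in\mathcal{H}\}$ computed from the training subsample of $\mathcal{S}$, using the validation subsample of $\mathcal{S}$. Finally $\tilde p_n^{\mathbb{S},\mathcal{K}_{\mathcal{B}}}=\frac1{\mathrm{card}(\mathbb{S})}\sum_{\mathcal{S}\in\mathbb{S}}\tilde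 p_n^{\mathcal{S}}$. The statement holds for both the linear and the convex version. *)

(* Defs.v *)
From HB Require Import structures.
From mathcomp Require Import all_boot all_order all_algebra.
From mathcomp Require Import complex measurable_realfun.
From mathcomp Require Import all_classical all_reals all_analysis.

Set Implicit Arguments.
Unset Strict Implicit.
Unset Printing Implicit Defensive.
Import Order.TTheory GRing.Theory Num.Theory.
Import numFieldNormedType.Exports.

Local Open Scope classical_set_scope.
Local Open Scope ring_scope.

Section cons_measure.
Context d (T : measurableType d) (R : realType).
Context (mu : {sigma_finite_measure set T -> \bar R}) (n : nat).
Context (nu : {sigma_finite_measure set (n.-tuple T) -> \bar R}).

Definition cons_pair (z : T * n.-tuple T) : n.+1.-tuple T :=
  [the n.+1.-tuple T of z.1 :: z.2].

Lemma measurable_cons_pair : measurable_fun setT cons_pair.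
Proof. by apply: measurable_cons; [exact: measurable_fst|exact: measurable_snd]. Qed.

Lemma measurable_uncons :
  measurable_fun setT (fun t : n.+1.-tuple T => (thead t, [tuple of behead t])).
Proof.
apply: measurable_fun_pair; first exact: measurable_tnth.
exact: measurable_behead.
Qed.

Definition cons_measure : set (n.+1.-tuple T) -> \bar R :=
  pushforward (mu \x nu)%E cons_pair.

Let cons_measure0 : cons_measure set0 = 0%E.
Proof. by rewrite /cons_measure /pushforward preimage_set0 measure0. Qed.

Let cons_measure_ge0 A : (0 <= cons_measure A)%E.
Proof. by rewrite /cons_measure /pushforward; exact: measure_ge0. Qed.

Let cons_measure_sigma_additive : semi_sigma_additive cons_measure.
Proof.
move=> F mF tF mUF; rewrite /cons_measure /pushforward preimage_bigcup.
apply: measure_semi_sigma_additive.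
- by move=> k; rewrite -[X in measurable X]setTI; exact: measurable_cons_pair.
- move/trivIsetP: tF => tF; apply/trivIsetP => i j _ _ ij.
  by rewrite -preimage_setI tF // preimage_set0.
- by rewrite -preimage_bigcup -[X in measurable X]setTI; exact: measurable_cons_pair.
Qed.

HB.instance Definition _ := isMeasure.Build _ _ _ cons_measure
  cons_measure0 cons_measure_ge0 cons_measure_sigma_additive.

Let cons_measure_sigma_finite : sigma_finite setT cons_measure.
Proof.
have /sigma_finiteP[F [FT ndF Foo]] := sigma_finiteT mu.
have /sigma_finiteP[G [GT ndG Goo]] := sigma_finiteT nu.
pose u (t : n.+1.-tuple T) := (thead t, [tuple of behead t]).
exists (fun k => u @^-1` (F k `*` G k)).
  apply/esym; rewrite -subTset => t _.
  have [k _ Fk] : (\bigcup_k F k) (u t).1 by rewrite -FT.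
  have [l _ Gl] : (\bigcup_k G k) (u t).2 by rewrite -GT.
  exists (maxn k l) => //; split.
  - by move: Fk; exact/subsetPset/ndF/leq_maxl.
  - by move: Gl; exact/subsetPset/ndG/leq_maxr.
move=> k; have [mF Fk] := Foo k; have [mG Gk] := Goo k; split.
  by rewrite -[X in measurable X]setTI; apply: measurable_uncons => //;
    exact: measurableX.
rewrite /cons_measure /pushforward -comp_preimage.
rewrite (_ : u \o cons_pair = id); last first.
  by rewrite funeqE => -[x t]; congr pair; apply: val_inj.
by rewrite preimage_id product_measure1E// lte_mul_pinfty// ge0_fin_numE.
Qed.

HB.instance Definition _ :=
  Measure_isSigmaFinite.Build _ _ _ cons_measure cons_measure_sigma_finite.

End cons_measure.

(* n-fold product measure *)
Fixpoint mpow d (T : measurableType d) (R : realType)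
    (mu : {sigma_finite_measure set T -> \bar R}) (n : nat) :
    {sigma_finite_measure set (n.-tuple T) -> \bar R} :=
  if n is n'.+1 then cons_measure mu (mpow mu n')
  else dirac ([tuple] : 0.-tuple T).

Notation Rvec R d := (d.-tuple (measurableTypeR R)).

Definition leb (R : realType) (d : nat) :
    {sigma_finite_measure set (Rvec R d) -> \bar R} :=
  mpow (@lebesgue_measure R) d.

Section vectors.
Context {R : realType} {d : nat}.
Implicit Types x t : Rvec R d.

Definition dot x t : R := \sum_(i < d) (tnth x i : R) * (tnth t i : R).

Definition enorm t : R := Num.sqrt (\sum_(i < d) (tnth t i : R) ^+ 2).

Definition rescale x t (h : R) : Rvec R d :=
  [tuple ((tnth x i : R) - (tnth t i : R)) / h | i < d].

Definition L2norm (f : Rvec R d -> R) : \bar R :=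
  ('N[leb R d]_2%:E [EFin \o f])%E.

End vectors.

Section fourier.
Context {R : realType} {d : nat}.
Implicit Types f g : Rvec R d -> R[i].

Definition cLfun (r : R) f : Prop :=
  (fun x => @complex.Re R (f x)) \in Lfun (leb R d) r%:E /\
  (fun x => @complex.Im R (f x)) \in Lfun (leb R d) r%:E.

Definition cdist f g : \bar R := L2norm (fun x => Normc.normc (f x - g x)).

Definition cintegral f : R[i] :=
  Complex (\int[leb R d]_x @complex.Re R (f x))
          (\int[leb R d]_x @complex.Im R (f x)).

Definition cis (u : R) : R[i] := Complex (cos u) (sin u).

Definition fourier f (t : Rvec R d) : R[i] :=
  cintegral (fun x => cis (dot x t) * f x).

(* g is the transform of f on L2, the continuous extension of [fourier] from
   L1 `&` L2 *)
Definition is_L2fourier f g : Prop :=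
  [/\ cLfun 2 f, cLfun 2 g &
    exists u : nat -> Rvec R d -> R[i],
      [/\ forall k, cLfun 1 (u k) /\ cLfun 2 (u k),
          cdist (u k) f @[k --> \oo] --> 0%E &
          cdist (fourier (u k)) g @[k --> \oo] --> 0%E]].

Definition is_pinsker_kernel (b : R) (K : Rvec R d -> R) : Prop :=
  is_L2fourier (fun x => (K x)%:C%C)
    (fun t => (Num.max (1 - enorm t `^ b) 0)%:C%C).

End fourier.

Record density (R : realType) (d : nat) := Density {
  pdf :> Rvec R d -> R;
  measurable_pdf : measurable_fun setT pdf;
  pdf_ge0 : forall x, 0 <= pdf x;
  integral_pdf : (\int[leb R d]_x (pdf x)%:E = 1)%E }.

Section density_law.
Context {R : realType} {d : nat} (p : density R d).

Definition density_law (A : set (Rvec R d)) : \bar R :=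
  (\int[leb R d]_(x in A) (p x)%:E)%E.

Let density_law0 : density_law set0 = 0%E.
Proof. by rewrite /density_law integral_set0. Qed.

Let density_law_ge0 A : (0 <= density_law A)%E.
Proof. by apply: integral_ge0 => x _; rewrite lee_fin pdf_ge0. Qed.

Let density_law_sigma_additive : semi_sigma_additive density_law.
Proof.
apply: semi_sigma_additive_nng_induced => [|x]; last by rewrite lee_fin pdf_ge0.
by apply/measurable_EFinP; exact: measurable_pdf.
Qed.

HB.instance Definition _ := isMeasure.Build _ _ _ density_law
  density_law0 density_law_ge0 density_law_sigma_additive.

Let density_law_setT : density_law setT = 1%E.
Proof. exact: integral_pdf. Qed.

HB.instance Definition _ :=
  Measure_isProbability.Build _ _ R density_law density_law_setT.

End density_law.

(* joint law of n i.i.d. observations with density p *)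
Definition iid_law (R : realType) (d : nat) (p : density R d) (n : nat) :
    {sigma_finite_measure set (n.-tuple (Rvec R d)) -> \bar R} :=
  mpow (density_law p) n.

Definition charfun (R : realType) (d : nat) (p : density R d) :
    Rvec R d -> R[i] := fourier (fun x => (p x)%:C%C).

Definition Sobolev_class (R : realType) (d : nat) (beta Q : R) :
    set (density R d) :=
  [set p | (\int[leb R d]_t
     (enorm t `^ (2 * beta) * Normc.normc (charfun p t) ^+ 2)%:E <= Q%:E)%E].

Definition risk (R : realType) (d n : nat)
    (phat : n.-tuple (Rvec R d) -> Rvec R d -> R) (p : density R d) : \bar R :=
  (\int[iid_law p n]_X (L2norm (fun x => phat X x - p x)%R ^+ 2))%E.

Section aggregates.
Context {R : realType} {d : nat}.

Definition lincomb (I : finType) (c : I -> R) (q : I -> Rvec R d -> R)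
  (x : Rvec R d) : R := \sum_i c i * q i x.

(* mean of f over the observations X_i with i in A *)
Definition sample_mean n (X : n.-tuple (Rvec R d)) (A : {set 'I_n})
    (f : Rvec R d -> R) : R :=
  #|A|%:R^-1 * \sum_(i in A) f (tnth X i).

(* phi is an L2-orthonormal basis of the span of q.  The phi_j are required to
   be combinations of the q_i as functions, so that their values at the
   validation points are tied to those of the q_i; conversely the q_i are
   recovered from phi as elements of L2. *)
Definition orthonormal_basis (I : finType) (q : I -> Rvec R d -> R)
    (D : nat) (phi : 'I_D -> Rvec R d -> R) : Prop :=
  [/\ forall j, phi j \in Lfun (leb R d) 2%:E,
      forall j k, \int[leb R d]_x (phi j x * phi k x) = (j == k)%:R,
      forall j, exists c, phi j = lincomb c q &
      forall i, exists c, {ae leb R d, forall x, q i x = lincomb c phi x}].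

Definition is_linear_aggregate n (X : n.-tuple (Rvec R d)) (V : {set 'I_n})
    (I : finType) (q : I -> Rvec R d -> R) (f : Rvec R d -> R) : Prop :=
  exists (D : nat) (phi : 'I_D -> Rvec R d -> R),
    orthonormal_basis q phi /\
    f = lincomb (fun j => sample_mean X V (phi j)) phi.

Definition convex_weights (I : finType) (lambda : I -> R) : Prop :=
  (forall i, 0 <= lambda i) /\ \sum_i lambda i <= 1.

Definition convex_criterion n (X : n.-tuple (Rvec R d)) (V : {set 'I_n})
    (I : finType) (q : I -> Rvec R d -> R) (lambda : I -> R) : \bar R :=
  (L2norm (lincomb lambda q) ^+ 2
   - (2 * sample_mean X V (lincomb lambda q))%:E)%E.

Definition is_convex_aggregate n (X : n.-tuple (Rvec R d)) (V : {set 'I_n})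
    (I : finType) (q : I -> Rvec R d -> R) (f : Rvec R d -> R) : Prop :=
  exists lambda : I -> R,
    [/\ convex_weights lambda,
        forall lambda', convex_weights lambda' ->
          (convex_criterion X V q lambda <= convex_criterion X V q lambda')%E &
        f = lincomb lambda q].

Variant aggregation := Linear | Convex.

Definition is_aggregate (agg : aggregation) :=
  match agg with
  | Linear => @is_linear_aggregate
  | Convex => @is_convex_aggregate
  end.

(* kernel estimator on the subsample indexed by A, with m = #|A| *)
Definition kernel_estimator n (X : n.-tuple (Rvec R d)) (A : {set 'I_n})
    (h : R) (K : Rvec R d -> R) (x : Rvec R d) : R :=
  (#|A|%:R * h ^+ d)^-1 * \sum_(i in A) K (rescale (tnth X i) x h).

End aggregates.

Section grids.
Context {R : realType}.
Implicit Types d n : nat.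

(* the exponent beta_(j+1), for j = 0, ..., N - 1 *)
Definition pinsker_exponent d (N : nat) (j : nat) : R :=
  iter j (fun b => b + (Num.sqrt N%:R)^-1) (d%:R / 2).

Definition h_min d n : R := (n%:R * ln n%:R) `^ (- d%:R^-1).

Definition h_geom d n (a0 : R) (j : nat) : R :=
  (1 + a0 / ln n%:R) ^+ j * h_min d n.

(* M - 2, the largest j such that h_geom d n a0 j < 1; it exists when n >= 2
   and a0 > 0, and the default value 0 is used otherwise *)
Definition grid_last d n (a0 : R) : nat :=
  xget 0%N [set j | h_geom d n a0 j < 1 /\
                    forall k, h_geom d n a0 k < 1 -> (k <= j)%N].

Definition grid_size d n (a0 : R) : nat := (grid_last d n a0).+2.

Definition bandwidth d n (a0 : R) (j : nat) : R :=
  if (j <= grid_last d n a0)%N then h_geom d n a0 j else 1.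

(* [Num.truncn] is the floor on nonnegative reals and 0 on negative ones; the
   argument is negative only for n = 2 *)
Definition train_size n : nat := Num.truncn (n%:R * (1 - (ln n%:R : R)^-1)).

End grids.

Section estimators.
Context {R : realType} {d : nat}.

(* A split is given by the index set S of its training subsample; its validation
   subsample is indexed by the complement of S. *)
Definition kernel_family n (X : n.-tuple (Rvec R d)) (a0 : R) (N : nat)
    (K : R -> Rvec R d -> R) (S : {set 'I_n})
    (jk : 'I_N * 'I_(grid_size d n a0)) : Rvec R d -> R :=
  kernel_estimator X S (bandwidth d n a0 jk.2) (K (pinsker_exponent d N jk.1)).

Definition averaged_aggregate n (SS : {set {set 'I_n}})
    (f : {set 'I_n} -> n.-tuple (Rvec R d) -> Rvec R d -> R)
    (X : n.-tuple (Rvec R d)) (x : Rvec R d) : R :=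
  #|SS|%:R^-1 * \sum_(S in SS) f S X x.

End estimators.

Section constants.
Context {R : realType}.

Definition Gamma (a : R) : R :=
  \int[lebesgue_measure]_(t in `]0, +oo[) (t `^ (a - 1) * expR (- t)).

Definition sphere_area (d : nat) : R :=
  2 * pi `^ (d%:R / 2) / Gamma (d%:R / 2).

Definition pinsker_constant (d : nat) (beta Q : R) : R :=
  (Q * (2 * beta + d%:R)) `^ (d%:R / (2 * beta + d%:R))
  / (d%:R * (2 * pi) ^+ d)
  * (beta * sphere_area d / (beta + d%:R)) `^ (2 * beta / (2 * beta + d%:R)).

End constants.

(* Main.v *)
(** The Pinsker kernel [K_b] with bandwidth [h] gives an estimator whose
    integrated squared bias is at most [(2 pi)^-d h^(2 beta) Q] as soon as
    [b >= beta], because [1 - (1 - u^b)_+ <= u^beta], and whose integrated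
    variance is at most the squared norm of [K_b] divided by [n h^d].  The sum is
    minimal, with value [C* n^(-2 beta / (2 beta + d))], for [b = beta] and an
    explicit [h]; the first exponent of the family above [beta] and the largest
    grid bandwidth below this [h] lose only a factor [1 + o(1)].

    Both aggregates make the empirical criterion [|f|^2 - 2 mean_V f] no larger
    than it is at any given estimator [q_j] of the family.  Hence
    [|f - p|^2 <= (1 + eps) |q_j - p|^2 + C(eps) W], where [W] is the supremum
    over the span of the family of [2 v(g) - |g|^2], [v] being the centred mean
    over the validation sample.  Given the training sample, [E W] is at most
    (dimension of the span) (sup p) / l, which is polylogarithmic over [n]; the
    densities of the Sobolev class are uniformly bounded since [beta > d/2].

    Fourier analysis is done with the Hartley transform, whose kernel is
    [cas = cos + sin], so that all integrals are real; its inversion and its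
    continuity in L2 follow from damping by [exp (- e (|t_1| + ... + |t_d|))],
    whose transform is the product of Poisson kernels. *)
From HB Require Import structures.
Require Import Defs.
From mathcomp Require Import all_boot all_order all_algebra.
From mathcomp Require Import complex measurable_realfun ring lra.
From mathcomp Require Import all_classical all_reals all_analysis.

Import Order.TTheory GRing.Theory Num.Theory.
Import numFieldNormedType.Exports.

Set Implicit Arguments.
Unset Strict Implicit.
Unset Printing Implicit Defensive.

Local Open Scope classical_set_scope.
Local Open Scope ring_scope.

(** * Iterated integrals on products and tuples *)

(** Three obstacles shape the proof. A Pinsker kernel is given only as an element of L2, so its
    inversion formula is obtained by duality, against functions that are themselves Hartley
    transforms. It is thus known only up to null sets, whereas the aggregates evaluate it at the
    validation points: combinations are therefore kept as functions, and wherever [W] is finite a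
    combination of null norm also has null empirical mean. Finally, the aggregates are not assumed
    to depend measurably on the sample: they are bounded sample by sample by measurable quantities,
    and only these are integrated.

    The oracle inequality comes from the excess at [(f - q_j) / s], with [s = ln n + 2]. The leading
    factor [(s + 2) / (s - 2) = 1 + 4 / ln n] tends to 1, while the factor [s^2 / (s - 2)] in front
    of [W] is of order [ln n], which the polylogarithm over [n] absorbs. Averaging over splits costs
    nothing, by convexity of the squared norm. *)

Section tonelli_cons.
Context d (T : measurableType d) (R : realType).
Context (mu : {sigma_finite_measure set T -> \bar R}) (n : nat).
Context (nu : {sigma_finite_measure set (n.-tuple T) -> \bar R}).

Lemma ge0_integral_cons (F : n.+1.-tuple T -> \bar R) :
  measurable_fun setT F -> (forall t, 0 <= F t)%E ->
  (\int[cons_measure mu nu]_t F t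
   = \int[mu]_x \int[nu]_t F (cons_pair (x, t)))%E.
Proof.
move=> mF F0.
have mc : measurable_fun setT (@cons_pair _ T n) by exact: measurable_cons_pair.
rewrite [LHS](ge0_integral_pushforward mc)//.
rewrite preimage_setT fubini_tonelli1//; last by move=> x; exact: F0.
exact: measurableT_comp.
Qed.

End tonelli_cons.

Section tuple_misc.
Context d (T : measurableType d) (n : nat).

Lemma tnth_cons_pair0 (x : T) (t : n.-tuple T) :
  tnth (cons_pair (x, t)) ord0 = x.
Proof. by rewrite /cons_pair/= tnth0. Qed.

Lemma tnth_cons_pairS (x : T) (t : n.-tuple T) i :
  tnth (cons_pair (x, t)) (lift ord0 i) = tnth t i.
Proof. by rewrite /cons_pair/= tnthS. Qed.

End tuple_misc.

Section mpow_integral.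
Context d (T : measurableType d) (R : realType).
Context (mu : {sigma_finite_measure set T -> \bar R}).

Lemma integral_mpow0 (F : 0.-tuple T -> \bar R) :
  (\int[mpow mu 0]_t F t = F [tuple])%E.
Proof.
have mF : measurable_fun setT F.
  have -> : F = cst (F [tuple]) by apply/funext => t; rewrite (tuple0 t).
  exact: measurable_cst.
by rewrite /= integral_dirac// diracT mul1e.
Qed.

Lemma ge0_integral_mpowS n (F : n.+1.-tuple T -> \bar R) :
  measurable_fun setT F -> (forall t, 0 <= F t)%E ->
  (\int[mpow mu n.+1]_t F t
   = \int[mu]_x \int[mpow mu n]_t F (cons_pair (x, t)))%E.
Proof. exact: ge0_integral_cons. Qed.

End mpow_integral.

Section fubini_real.
Context d1 d2 (T1 : measurableType d1) (T2 : measurableType d2) (R : realType).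
Context (m1 : {sigma_finite_measure set T1 -> \bar R}).
Context (m2 : {sigma_finite_measure set T2 -> \bar R}).

Lemma RFubini_int (f : T1 * T2 -> R) :
  (m1 \x m2)%E.-integrable setT (EFin \o f) ->
  m1.-integrable setT (EFin \o (fun x => \int[m2]_y f (x, y))).
Proof.
move=> fi; have iF := integrable_fubini_F fi.
have mF := measurable_int _ iF.
have E : EFin \o (fun x => \int[m2]_y f (x, y)) =
         (fun x => (fine (\int[m2]_y (EFin \o f) (x, y)))%:E)%E by [].
apply/integrableP; split.
  by apply/measurable_EFinP; exact: measurableT_comp mF.
case/integrableP : iF => _; apply: le_lt_trans.
apply: ge0_le_integral => //.
- by apply/measurable_EFinP/measurableT_comp => //; exact: measurableT_comp mF.
- exact: measurableT_comp.
- move=> x _ /=; rewrite /fubini_F/= /Rintegral.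
  by case: (\int[m2]_y _)%E => [r| |] //=; rewrite normr0 leey.
Qed.

(** [Rintegral] is [fine] of the extended integral, so it alters the inner function where the inner
    integral is infinite; integrability makes this a null set. *)
Lemma RFubini1E (f : T1 * T2 -> R) :
  (m1 \x m2)%E.-integrable setT (EFin \o f) ->
  \int[m1]_x \int[m2]_y f (x, y) = \int[(m1 \x m2)%E]_z f z.
Proof.
move=> fi; rewrite /Rintegral -integral12_prod_meas1//; congr fine.
have iF := integrable_fubini_F fi.
apply: ae_eq_integral => //.
- by apply/measurable_EFinP; exact: (measurableT_comp _ (measurable_int _ iF)).
- exact: (measurable_int _ iF).
have := integrable_ae measurableT iF.
apply: filterS => x /(_ I) h _ /=.
by rewrite fineK//.
Qed.

Lemma RFubini2E (f : T1 * T2 -> R) :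
  (m1 \x m2)%E.-integrable setT (EFin \o f) ->
  \int[m2]_y \int[m1]_x f (x, y) = \int[(m1 \x m2)%E]_z f z.
Proof.
move=> fi; rewrite /Rintegral -integral21_prod_meas1//; congr fine.
have fi' : (m2 \x m1)%E.-integrable setT (EFin \o (fun z => f (z.2, z.1))).
  case/integrableP : (fi) => mf _; have mf' : measurable_fun setT (EFin \o (fun z : T2 * T1 => f (z.2, z.1))).
    apply: (@measurableT_comp _ _ _ _ _ _ (EFin \o f) _ (fun z : T2 * T1 => (z.2, z.1))) => //.
    exact: measurable_fun_pair.
  apply: (proj2 (integrable12ltyP m2 m1 mf')).
  exact: (proj1 (integrable21ltyP m1 m2 mf) fi).
have iF := integrable_fubini_F fi'.
apply: ae_eq_integral => //.
- by apply/measurable_EFinP; exact: (measurableT_comp _ (measurable_int _ iF)).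
- exact: (measurable_int _ iF).
have := integrable_ae measurableT iF.
apply: filterS => x /(_ I) h _ /=.
by rewrite fineK//.
Qed.

Lemma RFubini (f : T1 * T2 -> R) :
  (m1 \x m2)%E.-integrable setT (EFin \o f) ->
  \int[m1]_x \int[m2]_y f (x, y) = \int[m2]_y \int[m1]_x f (x, y).
Proof. by move=> fi; rewrite RFubini1E// RFubini2E. Qed.

Lemma integrable_prod_le (f : T1 * T2 -> R) (g1 : T1 -> R) (g2 : T2 -> R) :
  measurable_fun setT f ->
  m1.-integrable setT (EFin \o g1) -> m2.-integrable setT (EFin \o g2) ->
  (forall x y, `|f (x, y)| <= `|g1 x| * `|g2 y|) ->
  (m1 \x m2)%E.-integrable setT (EFin \o f).
Proof.
move=> mf i1 i2 fg; apply/integrable12ltyP; first exact/measurable_EFinP.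
case/integrableP : i1 => mg1 i1; case/integrableP : i2 => mg2 i2.
apply: (@le_lt_trans _ _ (\int[m1]_x \int[m2]_y (`|g1 x| * `|g2 y|)%:E)%E).
  apply: ge0_le_integral => //.
  - by move=> x _; exact: integral_ge0.
  - apply: (measurable_fun_fubini_tonelli_F (fun z => `|(EFin \o f) z|%E)) => //.
    by apply: measurableT_comp => //; exact/measurable_EFinP.
  - apply: (@measurable_fun_fubini_tonelli_F _ _ _ _ _ m2 (fun z => (`|g1 z.1| * `|g2 z.2|)%:E)%E) => //.
      apply/measurable_EFinP; apply: measurable_funM; apply: measurableT_comp => //.
        by apply: measurableT_comp => //; exact/measurable_EFinP.
      by apply: measurableT_comp => //; exact/measurable_EFinP.
  - move=> x _; apply: ge0_le_integral => //.
    + do 2 (apply: measurableT_comp => //).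
      by apply: measurableT_comp => //; exact: measurable_pair1.
    + apply/measurable_EFinP; apply: measurable_funM => //.
      by apply: measurableT_comp => //; exact/measurable_EFinP.
    + by move=> y _; rewrite lee_fin.
have mg2' : measurable_fun setT (fun y => `|g2 y|%:E).
  by apply/measurable_EFinP; apply: measurableT_comp => //; exact/measurable_EFinP.
have mg1' : measurable_fun setT (fun y => `|g1 y|%:E).
  by apply/measurable_EFinP; apply: measurableT_comp => //; exact/measurable_EFinP.
rewrite (eq_integral (fun x => `|g1 x|%:E * \int[m2]_y `|g2 y|%:E)%E); last first.
  by move=> x _; under eq_integral do rewrite EFinM; rewrite ge0_integralZl//.
rewrite ge0_integralZr//; last exact: integral_ge0.
apply: lte_mul_pinfty; [exact: integral_ge0| |exact: i2].
by rewrite ge0_fin_numE//; exact: integral_ge0.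
Qed.

End fubini_real.

Section vector_measurability.
Context {R : realType} {d : nat}.
Implicit Types x y t : Rvec R d.

Lemma measurable_coord d' (T : measurableType d') (f : T -> Rvec R d) i :
  measurable_fun setT f -> measurable_fun setT (fun z => tnth (f z) i : R).
Proof.
by move=> mf; apply: (measurableT_comp (measurable_tnth i) mf).
Qed.

Lemma measurable_mktuple d' (T : measurableType d') (f : 'I_d -> T -> R) :
  (forall i, measurable_fun setT (f i)) ->
  measurable_fun setT (fun z => [tuple f i z | i < d] : Rvec R d).
Proof.
move=> mf; apply/measurable_fun_tnthP => i.
rewrite (_ : _ \o _ = f i); first exact: mf.
by apply/funext => z /=; rewrite tnth_mktuple.
Qed.

Lemma measurable_dot d' (T : measurableType d') (f g : T -> Rvec R d) :
  measurable_fun setT f -> measurable_fun setT g ->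
  measurable_fun setT (fun z => dot (f z) (g z)).
Proof.
move=> mf mg; apply: measurable_sum => i.
by apply: measurable_funM; exact: measurable_coord.
Qed.

Lemma measurable_enorm : measurable_fun setT (@enorm R d).
Proof.
apply: (@measurableT_comp _ _ _ _ _ _ (@Num.sqrt R)).
  apply: continuous_measurable_fun; exact: sqrt_continuous.
apply: measurable_sum => i; apply: measurable_funX.
exact: (measurable_tnth i).
Qed.

Lemma measurable_rescale d' (T : measurableType d') (f g : T -> Rvec R d) h :
  measurable_fun setT f -> measurable_fun setT g ->
  measurable_fun setT (fun z => rescale (f z) (g z) h).
Proof.
move=> mf mg; apply: (@measurable_mktuple _ _ (fun i z => _)) => i.
apply: measurable_funM => //.
by apply: measurable_funB; exact: measurable_coord.
Qed.

Lemma enorm_ge0 t : 0 <= enorm t.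
Proof. exact: sqrtr_ge0. Qed.

Lemma sqr_enorm t : enorm t ^+ 2 = \sum_(i < d) (tnth t i : R) ^+ 2.
Proof. by rewrite sqr_sqrtr// sumr_ge0// => i _; exact: sqr_ge0. Qed.

Lemma tnth_rescale x y h i :
  tnth (rescale x y h) i = ((tnth x i : R) - (tnth y i : R)) / h.
Proof. by rewrite tnth_mktuple. Qed.

Lemma dotC x y : dot x y = dot y x.
Proof. by apply: eq_bigr => i _; rewrite mulrC. Qed.

Lemma dot_rescale x y z h : dot (rescale x y h) z = (dot x z - dot y z) / h.
Proof.
rewrite /dot -sumrB mulr_suml; apply: eq_bigr => i _.
by rewrite tnth_rescale mulrAC mulrBl.
Qed.

End vector_measurability.

(** * Affine changes of variables *)

Section affine1.
Context {R : realType}.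
Notation mu := (@lebesgue_measure R).

(** The image of Lebesgue measure under [x |-> (y - x) / h], multiplied by [h^-1], gives each []a,
    b]] its length, hence is Lebesgue measure. The form [(y - x) / h] is that of the argument of a
    kernel. *)
Lemma ge0_integral_affine1 (f : R -> \bar R) (y h : R) : 0 < h ->
  measurable_fun setT f -> (forall x, 0 <= f x)%E ->
  (\int[mu]_x f ((y - x) / h)%R = h%:E * \int[mu]_x f x)%E.
Proof.
move=> h0 mf f0.
pose phi : measurableTypeR R -> measurableTypeR R := fun x => (y - x) / h.
have mphi : measurable_fun setT phi.
  by apply: measurable_funM => //; apply: measurable_funB.
have hV0 : 0 <= h^-1 by rewrite invr_ge0 ltW.
pose nu' := mscale (NngNum hV0) (pushforward mu phi).
pose nu := nu' mphi.
have nuE A : measurable A -> mu A = nu A.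
  move=> mA; apply: (@lebesgue_measure_unique R nu) => // _ [[a b] _ <-] /=.
  rewrite /nu /nu' /mscale/= /pushforward.
  have -> : phi @^-1` `]a, b] = `[(y - h * b)%R, (y - h * a)%R[%classic.
    apply/seteqP; split => x /=; rewrite !in_itv/= /phi ltr_pdivlMr// ler_pdivrMr//.
      by move=> /andP[? ?]; apply/andP; split; lra.
    by move=> /andP[? ?]; apply/andP; split; lra.
  rewrite !lebesgue_measure_itv/= !lte_fin.
  have -> : (y - h * b < y - h * a) = (a < b).
    by rewrite ltrD2l ltrN2 ltr_pM2l.
  case: ifPn => ab; last by rewrite mule0.
  rewrite -!EFinB -EFinM; congr EFin; field; exact: lt0r_neq0.
transitivity (\int[pushforward mu phi]_x f x)%E.
  by rewrite ge0_integral_pushforward.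
have -> : (\int[mu]_x f x = \int[nu]_x f x)%E by apply: eq_measure_integral => A mA _; exact: nuE.
rewrite ge0_integral_mscale//= muleA -EFinM divff ?mul1e//.
exact: lt0r_neq0.
Qed.

End affine1.

Section affine.
Context {R : realType}.

Lemma ge0_integral_rescale d (f : Rvec R d -> \bar R) (y : Rvec R d) (h : R) :
  0 < h -> measurable_fun setT f -> (forall x, 0 <= f x)%E ->
  (\int[leb R d]_x f (rescale y x h) = (h ^+ d)%:E * \int[leb R d]_x f x)%E.
Proof.
move=> h0; elim: d => [|d IH] in f y *; move=> mf f0.
  rewrite !integral_mpow0 expr0 mul1e; congr f.
  by apply: eq_from_tnth => -[].
have mr : measurable_fun setT (fun x : Rvec R d.+1 => rescale y x h).
  by apply: measurable_rescale => //; exact: measurable_cst.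
rewrite !ge0_integral_mpowS//; last exact: measurableT_comp mf mr.
pose y' : Rvec R d := [tuple tnth y (lift ord0 i) | i < d].
have E (a : R) (t : Rvec R d) : rescale y (cons_pair (a, t)) h =
    cons_pair (((tnth y ord0 : R) - a) / h, rescale y' t h).
  apply: eq_from_tnth => i; rewrite tnth_rescale.
  case: (unliftP ord0 i) => [j ->|->].
    by rewrite !tnth_cons_pairS tnth_rescale tnth_mktuple.
  by rewrite !tnth_cons_pair0.
under eq_integral => a _.
  under eq_integral do rewrite E.
  rewrite (IH (fun t => f (cons_pair (((tnth y ord0 : R) - a) / h, t))))//; last first.
    apply: measurableT_comp => //; apply: (measurableT_comp (@measurable_cons_pair _ _ d)).
    exact: measurable_pair1.
  over.
have mg : measurable_fun setT (fun a => \int[leb R d]_t f (cons_pair (a, t)))%E.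
  apply: (@measurable_fun_fubini_tonelli_F _ _ _ _ _ (leb R d) (fun z => f (cons_pair z))) => //.
  exact: (measurableT_comp mf (@measurable_cons_pair _ _ d)).
have g0 a : (0 <= \int[leb R d]_t f (cons_pair (a, t)))%E by exact: integral_ge0.
have mh : measurable_fun setT (fun a : R => ((tnth y ord0 : R) - a) / h).
  by apply: measurable_funM => //; exact: measurable_funB.
have hd0 : (0 <= (h ^+ d)%:E)%E by rewrite lee_fin exprn_ge0// ltW.
transitivity ((h ^+ d)%:E * \int[lebesgue_measure]_a
    (fun a => \int[leb R d]_t f (cons_pair (a, t)))%E (((tnth y ord0 : R) - a) / h)%R)%E.
  apply: ge0_integralZl => //; first exact: (measurableT_comp mg mh).
  by move=> a _; exact: g0.
rewrite (ge0_integral_affine1 _ h0 mg g0).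
by rewrite muleA -EFinM -exprSr.
Qed.

Definition vneg d (t : Rvec R d) : Rvec R d := [tuple - (tnth t i : R) | i < d].

(** [rescale] already reverses its second argument, so the changes of variables for reflections are
    inherited from it. *)
Lemma vnegE d (t : Rvec R d) : vneg t = rescale [tuple (0 : R) | i < d] t 1.
Proof.
by apply: eq_from_tnth => i; rewrite tnth_rescale !tnth_mktuple divr1 sub0r.
Qed.

Lemma vnegK d : involutive (@vneg d).
Proof. by move=> t; apply: eq_from_tnth => i; rewrite !tnth_mktuple opprK. Qed.

Lemma measurable_vneg d : measurable_fun setT (@vneg d).
Proof.
rewrite (_ : @vneg d = fun t => rescale [tuple (0 : R) | i < d] t 1).
  by apply: measurable_rescale => //; exact: measurable_cst.
by apply/funext => t; exact: vnegE.
Qed.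

Lemma dot_vneg d (x t : Rvec R d) : dot (vneg x) t = - dot x t.
Proof.
rewrite vnegE dot_rescale divr1 [X in X - _]big1 ?sub0r// => i _.
by rewrite tnth_mktuple mul0r.
Qed.

Lemma enorm_vneg d (t : Rvec R d) : enorm (vneg t) = enorm t.
Proof. by congr Num.sqrt; apply: eq_bigr => i _; rewrite tnth_mktuple sqrrN. Qed.

Lemma ge0_integral_vneg d (f : Rvec R d -> \bar R) :
  measurable_fun setT f -> (forall x, 0 <= f x)%E ->
  (\int[leb R d]_x f (vneg x) = \int[leb R d]_x f x)%E.
Proof.
move=> mf f0; under eq_integral do rewrite vnegE.
by rewrite ge0_integral_rescale// expr1n mul1e.
Qed.

(** Integrability is not assumed: the positive and negative parts are rescaled separately, and
    multiplication by [h ^+ d > 0] respects the value given to infinity minus infinity. *)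
Lemma integral_rescale d (f : Rvec R d -> R) (y : Rvec R d) (h : R) :
  0 < h -> measurable_fun setT f ->
  (\int[leb R d]_x (f (rescale y x h))%:E = (h ^+ d)%:E * \int[leb R d]_x (f x)%:E)%E.
Proof.
move=> h0 mf; have mf' : measurable_fun setT (EFin \o f) by exact/measurable_EFinP.
have -> : (\int[leb R d]_x (f (rescale y x h))%:E =
    \int[leb R d]_x ((EFin \o f)^\+ (rescale y x h))
    - \int[leb R d]_x ((EFin \o f)^\- (rescale y x h)))%E.
  by rewrite integralE; congr (_ - _)%E; apply: eq_integral => x _; rewrite ?funeposE ?funenegE.
have -> : (\int[leb R d]_x (f x)%:E =
    \int[leb R d]_x ((EFin \o f)^\+ x) - \int[leb R d]_x ((EFin \o f)^\- x))%E.
  by rewrite integralE.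
rewrite (@ge0_integral_rescale _ (EFin \o f)^\+%E y h)//; last exact: measurable_funepos.
rewrite (@ge0_integral_rescale _ (EFin \o f)^\-%E y h)//; last exact: measurable_funeneg.
set A := (\int[_]_x (_^\+)%E x)%E; set B := (\int[_]_x (_^\-)%E x)%E.
have A0 : (0 <= A)%E by exact: integral_ge0.
have B0 : (0 <= B)%E by exact: integral_ge0.
have hd : (0 < (h ^+ d)%:E)%E by rewrite lte_fin exprn_gt0.
case: A A0 => [a| |]//; case: B B0 => [b| |]//= _ _.
- by rewrite -EFinM -EFinB -EFinM mulrBr.
- by rewrite gt0_muley//= gt0_muleNy.
- by rewrite gt0_muley//= addye// gt0_muley.
- by rewrite gt0_muley//= gt0_muleNy.
Qed.

Lemma Rintegral_rescale d (f : Rvec R d -> R) (y : Rvec R d) (h : R) :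
  0 < h -> measurable_fun setT f ->
  \int[leb R d]_x f (rescale y x h) = h ^+ d * \int[leb R d]_x f x.
Proof.
move=> h0 mf; rewrite /Rintegral integral_rescale//.
have hd : 0 < h ^+ d by rewrite exprn_gt0.
case: (\int[leb R d]_x _)%E => [r| |] //=.
- by rewrite gt0_muley ?lte_fin//= mulr0.
- by rewrite gt0_muleNy ?lte_fin//= mulr0.
Qed.

Lemma Rintegral_vneg d (f : Rvec R d -> R) :
  measurable_fun setT f ->
  \int[leb R d]_x f (vneg x) = \int[leb R d]_x f x.
Proof.
move=> mf; under eq_Rintegral do rewrite vnegE.
by rewrite Rintegral_rescale// expr1n mul1r.
Qed.

End affine.

(** * Measures and functions determined by boxes *)

Section boxes.
Context {R : realType} {d : nat}.

Definition box (a b : 'I_d -> R) : set (Rvec R d) :=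
  [set t | forall i, a i < (tnth t i : R) <= b i].

Lemma boxE a b : box a b =
  \bigcap_(i in [set: 'I_d]) ((fun t : Rvec R d => tnth t i) @^-1` `]a i, b i]).
Proof.
apply/seteqP; split => t /= h i; first by move=> _ /=; rewrite in_itv/=; exact: h.
by have := h i I; rewrite /= in_itv.
Qed.

Lemma measurable_box a b : measurable (box a b).
Proof.
rewrite boxE; apply: fin_bigcap_measurable => // i _.
rewrite -[X in measurable X]setTI; exact: (@measurable_tnth _ _ _ i).
Qed.

Lemma box_setI a b a' b' : box a b `&` box a' b' =
  box (fun i => Num.max (a i) (a' i)) (fun i => Num.min (b i) (b' i)).
Proof.
apply/seteqP; split => t /=.
  by move=> [h h'] i; have := h i; have := h' i; rewrite gt_max le_min => /andP[-> ->] /andP[-> ->].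
move=> h; split => i; have := h i; rewrite gt_max le_min;
  by move=> /andP[/andP[? ?] /andP[? ?]]; apply/andP.
Qed.

Definition boxes : set (set (Rvec R d)) := [set A | exists a b, A = box a b].

Definition cube (k : nat) : set (Rvec R d) := box (fun=> - k%:R) (fun=> k%:R).

Lemma bigcup_cube : \bigcup_k cube k = setT.
Proof.
rewrite -subTset => t _.
pose s := \sum_(i < d) `|(tnth t i : R)|.
have s0 : 0 <= s by apply: sumr_ge0 => i _; exact: normr_ge0.
exists (Num.truncn s).+1 => // i.
have : `|(tnth t i : R)| < (Num.truncn s).+1%:R.
  apply: le_lt_trans (truncnS_gt _).
  by rewrite /s (bigD1 i)//= lerDl sumr_ge0.
by rewrite ltr_norml => /andP[-> /ltW ->].
Qed.

Lemma sub_boxes_measurable : boxes `<=` measurable.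
Proof. by move=> _ [a [b ->]]; exact: measurable_box. Qed.

Lemma measurable_sub_boxes :
  @measurable _ (d.-tuple (measurableTypeR R)) `<=` <<s boxes >>.
Proof.
have sb := @sigma_algebra_bigcup _ setT boxes.
apply: smallest_sub; first exact: smallest_sigma_algebra.
move=> A; rewrite /= -bigcup_seq/= => -[i _ [B mB <-]]; rewrite setTI.
pose f := fun t : Rvec R d => tnth t i.
suff : <<s (@ocitv R) >> `<=` [set C | <<s boxes >> (f @^-1` C)].
  by apply; exact: mB.
apply: smallest_sub.
  split => /=.
  - by rewrite preimage_set0; exact: sigma_algebra0.
  - move=> C hC; rewrite setTD preimage_setC -setTD.
    exact: sigma_algebraCD.
  - by move=> F hF; rewrite preimage_bigcup; exact: sb.
move=> _ [[a b] _ <-] /=.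
(* A slab in coordinate [i] is a countable union of boxes whose other sides []-k, k]] grow. *)
have -> : f @^-1` `]a, b] = \bigcup_k
    box (fun j => if j == i then a else - k%:R)
        (fun j => if j == i then b else k%:R).
  apply/seteqP; split => t /=.
    rewrite in_itv/= => h.
    have : (\bigcup_k cube k) t by rewrite bigcup_cube.
    case=> k _ hk; exists k => // j; case: eqP => [->//|_]; exact: hk.
  by move=> [k _ /(_ i)]; rewrite eqxx in_itv.
apply: sb => k; apply: sub_sigma_algebra.
by eexists; eexists; reflexivity.
Qed.

(** Boxes are stable under intersection and generate the sigma-algebra, and the cubes exhaust the
    space. *)
Lemma box_measure_unique (m1 m2 : {measure set (d.-tuple (measurableTypeR R)) -> \bar R}) :
  (forall a b, m1 (box a b) = m2 (box a b)) ->
  (forall a b, (m1 (box a b) < +oo)%E) ->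
  forall A, measurable A -> m1 A = m2 A.
Proof.
move=> m12 foo A mA.
apply: (@g_sigma_algebra_measure_unique _ _ _ boxes sub_boxes_measurable cube) => //.
- by move=> k; eexists; eexists; reflexivity.
- exact: bigcup_cube.
- by move=> _ _ [a [b ->]] [a' [b' ->]]; rewrite box_setI; eexists; eexists; reflexivity.
- by move=> _ [a [b ->]].
- by move=> k; exact: foo.
- exact: measurable_sub_boxes.
Qed.

End boxes.

Section density_measure.
Context d (T : measurableType d) (R : realType).
Context (mu : {measure set T -> \bar R}) (f : T -> \bar R).
Context (mf : measurable_fun setT f) (f0 : forall x, (0 <= f x)%E).

Definition dens_measure (A : set T) : \bar R := (\int[mu]_(x in A) f x)%E.

Let dens0 : dens_measure set0 = 0%E.
Proof. by rewrite /dens_measure integral_set0. Qed.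

Let dens_ge0 A : (0 <= dens_measure A)%E.
Proof. exact: integral_ge0. Qed.

Let dens_sigma_additive : semi_sigma_additive dens_measure.
Proof. exact: semi_sigma_additive_nng_induced. Qed.

HB.instance Definition _ := isMeasure.Build _ _ _ dens_measure
  dens0 dens_ge0 dens_sigma_additive.

Definition density_measure : {measure set T -> \bar R} := dens_measure.

Import HBNNSimple.

Lemma integral_dens_nnsfun (m : {measure set T -> \bar R}) (h : {nnsfun T >-> R}) :
  (forall A, measurable A -> m A = dens_measure A) ->
  (\int[m]_x (h x)%:E = \int[mu]_x ((h x)%:E * f x))%E.
Proof.
move=> mE; transitivity (\sum_(k \in range h) (k%:E * m (h @^-1` [set k])))%E.
  by rewrite integralT_nnsfun sintegralE.
transitivity (\int[mu]_x (\sum_(k \in range h) ((k * \1_(h @^-1` [set k]) x)%:E * f x)))%E; last first.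
  apply: eq_integral => x _; rewrite {1}(fimfunE h) -fsumEFin//.
  by rewrite ge0_mule_fsuml// => k; rewrite nnfun_muleindic_ge0.
rewrite ge0_integral_fsum//; last 2 first.
- by move=> k; apply: emeasurable_funM => //; exact/measurable_EFinP/measurable_funM.
- by move=> k x _; rewrite mule_ge0// nnfun_muleindic_ge0.
apply: eq_fsbigr => k _.
have mk : measurable (h @^-1` [set k]) by [].
have [k0|k0] := leP 0 k; last first.
  rewrite preimage_nnfun0// measure0 mule0.
  by rewrite integral0_eq// => x _; rewrite indic0 mulr0 mul0e.
rewrite mE// /dens_measure integral_mkcond -ge0_integralZl//; last 2 first.
- exact: (measurable_restrictT _ mk).1 (measurable_funTS mf).
- by move=> x _; apply: erestrict_ge0.
apply: eq_integral => x _; rewrite patchE indicE; case: ifPn => _ /=.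
  by rewrite mulr1.
by rewrite mulr0 mule0 mul0e.
Qed.

(** Simple functions first, then monotone convergence. [m] need only agree with [dens_measure] on
    measurable sets, so that the lemma applies to [density_law]. *)
Lemma ge0_integral_dens (m : {measure set T -> \bar R}) (F : T -> \bar R) :
  (forall A, measurable A -> m A = dens_measure A) ->
  (forall x, f x \is a fin_num) ->
  measurable_fun setT F -> (forall x, 0 <= F x)%E ->
  (\int[m]_x F x = \int[mu]_x (F x * f x))%E.
Proof.
move=> mE ff mF F0; pose h := nnsfun_approx measurableT mF.
have hF x : (h n x)%:E @[n --> \oo] --> F x by exact: cvg_nnsfun_approx.
transitivity (limn (fun n => \int[m]_x (h n x)%:E)%E).
  rewrite -monotone_convergence//.
  - by apply: eq_integral => x _; apply/esym/cvg_lim => //; exact: hF.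
  - by move=> n; exact/measurable_EFinP.
  - by move=> n x _; rewrite lee_fin.
  - by move=> x _ a b ab; rewrite lee_fin; exact/lefP/nd_nnsfun_approx.
rewrite (_ : (fun n => _) = (fun n => \int[mu]_x ((h n x)%:E * f x))%E); last first.
  by apply/funext => n; rewrite (integral_dens_nnsfun _ mE).
rewrite -monotone_convergence//.
- apply: eq_integral => x _; apply/cvg_lim => //.
  exact: cvgeZr.
- by move=> n; apply: emeasurable_funM => //; exact/measurable_EFinP.
- by move=> n x _; rewrite mule_ge0// lee_fin.
- move=> x _ a b ab; apply: lee_wpmul2r => //.
  by rewrite lee_fin; exact/lefP/nd_nnsfun_approx.
Qed.

End density_measure.

Section box_unique.
Context {R : realType} {d : nat}.
Notation mu := (leb R d).

(** Without subtraction, equality of the integrals of [f] and [g] says that the nonnegative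
    densities [f^+ + g^-] and [g^+ + f^-] define measures that agree on boxes, hence on all
    measurable sets; the almost everywhere equality follows cube by cube. *)
Lemma box_integral_unique (f g : Rvec R d -> R) :
  (forall a b, mu.-integrable (box a b) (EFin \o f)) ->
  (forall a b, mu.-integrable (box a b) (EFin \o g)) ->
  (forall a b, \int[mu]_(x in box a b) (f x)%:E = \int[mu]_(x in box a b) (g x)%:E)%E ->
  {ae mu, forall x, f x = g x}.
Proof.
move=> fi gi fg.
have mT (u : Rvec R d -> R) : (forall a b, mu.-integrable (box a b) (EFin \o u)) ->
    measurable_fun setT (EFin \o u).
  move=> ui; rewrite -bigcup_cube; apply/measurable_fun_bigcup.
    by move=> k; exact: measurable_box.
  by move=> k; exact: measurable_int (ui _ _).
have mf := mT _ fi; have mg := mT _ gi.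
pose p (u v : Rvec R d -> R) x := ((EFin \o u)^\+ x + (EFin \o v)^\- x)%E.
have mp u v : measurable_fun setT (EFin \o u) -> measurable_fun setT (EFin \o v) ->
    measurable_fun setT (p u v).
  by move=> mu' mv; apply: emeasurable_funD; [exact: measurable_funepos|exact: measurable_funeneg].
have p0 u v x : (0 <= p u v x)%E by rewrite adde_ge0.
have pE u v A : measurable A -> measurable_fun setT (EFin \o u) -> measurable_fun setT (EFin \o v) ->
    (\int[mu]_(x in A) p u v x = \int[mu]_(x in A) (EFin \o u)^\+ x + \int[mu]_(x in A) (EFin \o v)^\- x)%E.
  move=> mA mu' mv; apply: ge0_integralD => //.
    exact/measurable_funTS/measurable_funepos.
  exact/measurable_funTS/measurable_funeneg.
pose m1 := density_measure mu (mp _ _ mf mg) (p0 f g).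
pose m2 := density_measure mu (mp _ _ mg mf) (p0 g f).
have key A (fA : mu.-integrable A (EFin \o f)) (gA : mu.-integrable A (EFin \o g)) :
    measurable A ->
    ((\int[mu]_(x in A) (f x)%:E = \int[mu]_(x in A) (g x)%:E)%E <-> m1 A = m2 A)
     /\ (m1 A < +oo)%E.
  move=> mA.
  have [fp fn] := (integrable_pos_fin_num mA fA, integrable_neg_fin_num mA fA).
  have [gp gn] := (integrable_pos_fin_num mA gA, integrable_neg_fin_num mA gA).
  rewrite /m1 /m2 /density_measure /= /dens_measure !pE// integralE [X in _ = X <-> _]integralE.
  move: fp fn gp gn.
  rewrite -!/(_ \o _).
  move=> /fineK <- /fineK <- /fineK <- /fineK <-.
  rewrite -!EFinB -!EFinD ltry; split=> //.
  by split => -[h]; congr EFin; lra.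
have m12 A : measurable A -> m1 A = m2 A.
  apply: box_measure_unique => a b.
    by have [h _] := key _ (fi a b) (gi a b) (measurable_box a b); apply/h/fg.
  by have [_] := key _ (fi a b) (gi a b) (measurable_box a b).
have aek k : ae_eq mu (cube k) (EFin \o f) (EFin \o g).
  apply: integral_ae_eq => //.
  - exact: measurable_box.
  - exact: fi.
  - exact: measurable_funTS.
  - move=> E Ek mE.
    have fE : mu.-integrable E (EFin \o f) by exact: integrableS (measurable_box _ _) mE Ek (fi _ _).
    have gE : mu.-integrable E (EFin \o g) by exact: integrableS (measurable_box _ _) mE Ek (gi _ _).
    by have [h _] := key _ fE gE mE; apply/h/m12.
have : {ae mu, forall x k, cube k x -> (f x)%:E = (g x)%:E} by apply/ae_foralln.
apply: filterS => x h.
have : (\bigcup_k cube k) x by rewrite bigcup_cube.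
by case=> k _ /h [].
Qed.

End box_unique.

Section faces.
Context {R : realType}.

(** Applied to the faces of boxes, where smoothed indicators do not converge to the indicator, and
    to balls of radius 0. *)
Lemma leb_face0 d (i : 'I_d) (c : R) :
  leb R d [set t : Rvec R d | (tnth t i : R) = c] = 0%E.
Proof.
have mS (n : nat) (j : 'I_n) : measurable [set t : Rvec R n | (tnth t j : R) = c].
  rewrite (_ : [set t | _] = (fun t : Rvec R n => tnth t j) @^-1` [set c])//.
  by rewrite -[X in measurable X]setTI; apply: (@measurable_tnth _ _ _ j) => //; exact: measurable_set1.
have iE n (j : 'I_n) : (leb R n [set t : Rvec R n | (tnth t j : R) = c] =
   \int[leb R n]_t (\1_[set t : Rvec R n | (tnth t j : R) = c] t)%:E)%E.
  by rewrite integral_indic ?setIT//; exact: mS.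
elim: d => [[]//|d IH] in i *.
have mi n (j : 'I_n) : measurable_fun setT (fun t => (\1_[set t : Rvec R n | (tnth t j : R) = c] t : R)%:E).
  apply/measurable_EFinP; exact: measurable_indic (mS _ _).
rewrite iE ge0_integral_mpowS//.
case: (unliftP ord0 i) => [j ->|->].
  rewrite integral0_eq// => x _.
  rewrite -(IH j) iE; apply: eq_integral => t _.
  congr (_%:E); rewrite !indicE; congr (nat_of_bool _)%:R.
  by apply/idP/idP => /[!inE]/=; rewrite tnth_cons_pairS.
rewrite (_ : (fun x => _) = (fun x => (\1_[set c] x : R)%:E * leb R d setT))%E; last first.
  apply/funext => x; rewrite -integral_cst//; apply: eq_integral => t _ /=.
rewrite ge0_integralZr//; last first.
  by apply/measurable_EFinP; exact: measurable_indic (measurable_set1 c).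
have -> : (\int[lebesgue_measure]_x (\1_[set c] x : R)%:E = 0)%E.
  by rewrite integral_indic// setIT; exact: lebesgue_measure_set1.
by rewrite mul0e.
Qed.

End faces.

(** * Laplace and Cauchy integrals on the line *)

Section calculus.
Context {R : realType}.
Notation mu := (@lebesgue_measure R).
Implicit Types f F : R -> R.

Lemma is_derive_continuous F (f : R -> R) :
  (forall x : R, is_derive x (1 : R) F (f x)) -> continuous F.
Proof.
move=> dF x; apply/differentiable_continuous/derivable1_diffP.
by have := dF x => ?; exact: ex_derive.
Qed.

Lemma ge0_FTCy f F (a l : R) : (forall x : R, is_derive x (1 : R) F (f x)) ->
  continuous f -> (forall x, a <= x -> 0 <= f x) ->
  F x @[x --> +oo] --> l ->
  (\int[mu]_(x in `[a, +oo[) (f x)%:E = (l - F a)%:E)%E.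
Proof.
move=> dF cf f0 Fl; rewrite (@ge0_continuous_FTC2y _ f F a l)//.
- exact: continuous_subspaceT.
- by apply/cvg_at_right_filter; exact: (is_derive_continuous dF).
- by move=> x _; rewrite derive1E; have := dF x => ?; rewrite derive_val.
Qed.

Lemma FTC_itv f F (a b : R) : (forall x : R, is_derive x (1 : R) F (f x)) ->
  continuous f -> a <= b ->
  (\int[mu]_(x in `]a, b]) (f x)%:E = (F b - F a)%:E)%E.
Proof.
move=> dF cf; rewrite le_eqVlt => /predU1P[->|ab].
  by rewrite subrr set_itvoc0 integral_set0.
have mf : measurable_fun setT (EFin \o f).
  by apply/measurable_EFinP; exact: continuous_measurable_fun.
rewrite integral_itv_obnd_cbnd; last exact: measurable_funTS.
rewrite (@continuous_FTC2 _ f F a b)//.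
- exact: continuous_subspaceT.
- split.
  + by move=> x _; have := dF x => ?; exact: ex_derive.
  + by apply/cvg_at_right_filter; exact: (is_derive_continuous dF).
  + by apply/cvg_at_left_filter; exact: (is_derive_continuous dF).
- by move=> x _; rewrite derive1E; have := dF x => ?; rewrite derive_val.
Qed.

Lemma ge0_even_FTCy f F (l : R) : (forall x : R, is_derive x (1 : R) F (f `|x|)) ->
  continuous f -> (forall x, 0 <= f x) ->
  F x @[x --> +oo] --> l ->
  (\int[mu]_x (f `|x|)%:E = (2 * (l - F 0))%:E)%E.
Proof.
move=> dF cf f0 Fl.
have cn : continuous (fun x : R => f `|x|).
  by move=> x; apply: continuous_comp; [exact: norm_continuous|exact: cf].
rewrite (@ge0_symfun_integralT _ (fun x => f `|x|))//; last first.
  by move=> x /=; rewrite normrN.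
by rewrite -set_itvcy (ge0_FTCy dF cn (fun x _ => f0 _) Fl) -EFinM.
Qed.

Lemma cauchy_den_gt0 (e u : R) : 0 < e -> 0 < e ^+ 2 + u ^+ 2.
Proof. by move=> e0; rewrite ltr_pwDl ?sqr_ge0// exprn_gt0. Qed.

(** The Fourier transform of [expR (- (e * |x|))]: a Poisson kernel of total mass [2 * pi]. *)
Definition cauchy (e u : R) : R := 2 * e / (e ^+ 2 + u ^+ 2).

Lemma cauchy_ge0 (e u : R) : 0 < e -> 0 <= cauchy e u.
Proof.
by move=> e0; rewrite divr_ge0 ?mulr_ge0// ?ltW// cauchy_den_gt0.
Qed.

Lemma is_derive_cauchy (e u x : R) : 0 < e ->
  is_derive x (1 : R) (fun x => 2 * atan ((x - u) / e)) (cauchy e (x - u)).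
Proof.
move=> e0; apply: is_derive_eq.
rewrite /cauchy /GRing.scale/= !(mulr1, mulr0, addr0, subr0, add0r).
field; rewrite ?lt0r_neq0//.
have := cauchy_den_gt0 (x - u) e0; rewrite -?exprMn; nra.
Qed.

Lemma continuous_cauchy (e u : R) : 0 < e -> continuous (fun x => cauchy e (x - u)).
Proof.
move=> e0 x; apply: cvgM; first exact: cvg_cst.
apply: cvgV; first by rewrite lt0r_neq0// cauchy_den_gt0.
apply: cvgD; first exact: cvg_cst.
rewrite expr2; under eq_fun do rewrite expr2.
by apply: cvgM; apply: cvgB => //; exact: cvg_cst.
Qed.

Lemma cauchyN e u : cauchy e (- u) = cauchy e u.
Proof. by rewrite /cauchy sqrrN. Qed.

Lemma measurable_cauchy (e : R) : 0 < e -> measurable_fun setT (cauchy e).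
Proof.
move=> e0; apply: continuous_measurable_fun => x.
by have := @continuous_cauchy e 0 e0 x; rewrite /continuous_at subr0; under eq_fun do rewrite subr0.
Qed.

Lemma cvgy_atanZ (e : R) : 0 < e -> atan (x / e) @[x --> +oo] --> pi / 2.
Proof.
move=> e0; apply: (@cvg_comp _ _ _ (fun x : R => x / e) atan _ (pinfty_nbhs R)).
  by apply: gt0_cvgMly => //; rewrite invr_gt0.
exact: cvgy_atan.
Qed.

Lemma integral_cauchy (e : R) : 0 < e -> (\int[mu]_x (cauchy e x)%:E = (2 * pi)%:E)%E.
Proof.
move=> e0.
have E x : cauchy e `|x| = cauchy e x by rewrite /cauchy real_normK ?num_real.
under eq_integral do rewrite -E.
have dF (x : R) : is_derive x (1 : R) (fun x => 2 * atan (x / e)) (cauchy e `|x|).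
  by have := @is_derive_cauchy e 0 x e0; rewrite E subr0; under eq_fun do rewrite subr0.
have cc : continuous (cauchy e).
  move=> x; have := @continuous_cauchy e 0 e0 x; rewrite /continuous_at subr0.
  by under eq_fun do rewrite subr0.
have Fl : 2 * atan (x / e) @[x --> +oo] --> pi.
  rewrite [X in _ --> X](_ : _ = 2 * (pi / 2)); last by field.
  by apply: cvgMr; exact: cvgy_atanZ.
rewrite (ge0_even_FTCy dF cc (fun x => cauchy_ge0 x e0) Fl).
by rewrite mul0r atan0 mulr0 subr0.
Qed.

Lemma integral_cauchy_itv (e a b x : R) : 0 < e -> a <= b ->
  (\int[mu]_(y in `]a, b]) (cauchy e (y - x))%:E
   = (2 * atan ((b - x) / e) - 2 * atan ((a - x) / e))%:E)%E.
Proof.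
move=> e0 ab; apply: (@FTC_itv _ (fun y => 2 * atan ((y - x) / e))) => //.
  by move=> y; exact: is_derive_cauchy.
exact: continuous_cauchy.
Qed.

(** With [z = y - x], the difference [2 y^2 + 2 z^2 - x^2] is the square of [2 y - x], and
    [cauchy e z * z^2 <= 2 e]. The bound is uniform in [e <= 1], which makes the later domination
    uniform as the damping is removed. *)
Lemma cauchy_decay e (x y : R) : 0 < e -> e <= 1 ->
  cauchy e (y - x) * (1 + x ^+ 2) <= (1 + 2 * y ^+ 2) * cauchy e (y - x) + 4.
Proof.
move=> e0 e1; set z := y - x.
have h1 : 1 + x ^+ 2 <= (1 + 2 * y ^+ 2) + 2 * z ^+ 2.
  rewrite /z -subr_ge0.
  have := sqr_ge0 (2 * y - x); rewrite !expr2; nra.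
have h2 : cauchy e z * (2 * z ^+ 2) <= 4.
  rewrite /cauchy mulrAC ler_pdivrMr ?cauchy_den_gt0//.
  have := sqr_ge0 z; have := sqr_ge0 e; nra.
apply: (le_trans (ler_wpM2l (cauchy_ge0 z e0) h1)).
by rewrite mulrDr [X in X + _]mulrC lerD2l.
Qed.

End calculus.

Lemma add_sub_eq0 (R : realFieldType) (a b c : R) : a = b + c -> a = b - c -> c = 0.
Proof. by move=> -> ?; lra. Qed.

Section laplace.
Context {R : realType}.
Notation mu := (@lebesgue_measure R).

Lemma cvg_expRNM (e : R) : 0 < e -> expR (- (e * x)) @[x --> +oo] --> 0.
Proof.
move=> e0.
apply: (@cvg_comp _ _ _ (fun x : R => e * x) (fun z => expR (- z)) _ (pinfty_nbhs R)); last exact: cvgr_expR.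
exact: gt0_cvgMry.
Qed.

(** Adding 1 to the cosine makes the integrand nonnegative, as the fundamental theorem on a
    half-line requires. The antiderivative [F] is normalised to vanish at infinity. *)
Lemma laplace_cos1 (e u : R) : 0 < e ->
  (\int[mu]_x (expR (- (e * `|x|)) * (1 + cos (u * `|x|)))%:E
   = (2 * (e^-1 + e / (e ^+ 2 + u ^+ 2)))%:E)%E.
Proof.
move=> e0; have D0 := cauchy_den_gt0 u e0.
pose f x : R := expR (- (e * x)) * (1 + cos (u * x)).
pose F x : R := expR (- (e * x)) * ((u * sin (u * x) - e * cos (u * x)) / (e ^+ 2 + u ^+ 2) - e^-1).
have dF (x : R) : is_derive x (1 : R) F (f x).
  apply: is_derive_eq.
  rewrite /f /GRing.scale/= !(mulr1, mulr0, addr0, subr0, add0r, mul0r).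
  field.
  by rewrite !lt0r_neq0.
have cf : continuous f.
  have df (x : R) : is_derive x (1 : R) f (expR (- (e * x)) * (- u * sin (u * x)) - e * f x).
    apply: is_derive_eq.
    rewrite /f /GRing.scale/= !(mulr1, mulr0, addr0, subr0, add0r, mul0r).
    ring.
  exact: is_derive_continuous df.
have Fl : F x @[x --> +oo] --> 0.
  apply/cvgr0Pnorm_lt => r r0.
  pose C := (`|u| + e) / (e ^+ 2 + u ^+ 2) + e^-1.
  have C0 : 0 < C.
    apply: ltr_pwDr; first by rewrite invr_gt0.
    by apply: divr_ge0; [apply: addr_ge0 => //; exact: ltW | exact: ltW].
  have /cvgr0Pnorm_lt/(_ (r / C)) := cvg_expRNM e0.
  rewrite divr_gt0// => /(_ isT); apply: filterS => x.
  rewrite ger0_norm ?expR_ge0// ltr_pdivlMr// => h; apply: le_lt_trans h.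
  rewrite normrM (ger0_norm (expR_ge0 _)) ler_wpM2l ?expR_ge0//.
  apply: le_trans (ler_normB _ _) _; rewrite /C lerD//; last by rewrite gtr0_norm ?invr_gt0.
  rewrite normrM normfV (gtr0_norm D0) ler_wpM2r ?invr_ge0 ?(ltW D0)//.
  apply: le_trans (ler_normB _ _) _; rewrite lerD// normrM.
    by rewrite ler_piMr// ler_norml sin_geN1 sin_le1.
  rewrite (gtr0_norm e0) ler_piMr//; first exact: ltW.
  by rewrite ler_norml cos_geN1 cos_le1.
have mf : measurable_fun setT (fun x : R => f `|x|).
  apply: measurableT_comp => //; exact: continuous_measurable_fun.
have f0 x : 0 <= f x.
  by rewrite mulr_ge0 ?expR_ge0//; have := cos_geN1 (u * x); lra.
have cn : continuous (fun x : R => f `|x|).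
  by move=> x; apply: continuous_comp; [exact: norm_continuous|exact: cf].
rewrite (@ge0_symfun_integralT _ (fun x => f `|x|))//; last first.
  by move=> x /=; rewrite normrN.
have -> : (\int[mu]_(x in [set x | (0 <= x)%R]) (f `|x|)%:E =
    \int[mu]_(x in `[0%R, +oo[) (f x)%:E)%E.
  rewrite -set_itvcy; apply: eq_integral => x /[!inE] /=.
  by rewrite in_itv/= andbT => x0; rewrite ger0_norm.
rewrite (ge0_FTCy dF cf (fun x _ => f0 x) Fl) -EFinM; congr (_%:E); congr (2 * _).
rewrite /F !mulr0 oppr0 expR0 sin0 cos0 mulr0 mulr1 mul1r; field.
by rewrite !lt0r_neq0.
Qed.

Lemma measurable_laplace e : measurable_fun setT (fun x : R => expR (- (e * `|x|))).
Proof.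
apply: measurableT_comp => //; apply: measurableT_comp => //.
by apply: measurable_funM => //; exact: measurableT_comp.
Qed.

Lemma integral_laplace (e : R) : 0 < e ->
  (\int[mu]_x (expR (- (e * `|x|)))%:E = (2 / e)%:E)%E.
Proof.
move=> e0; have := @laplace_cos1 e 0 e0.
have -> : (\int[mu]_x (expR (- (e * `|x|)) * (1 + cos (0 * `|x|)))%:E =
    \int[mu]_x (2%:E * (expR (- (e * `|x|)))%:E))%E.
  by apply: eq_integral => x _; rewrite mul0r cos0 -EFinM; congr (_%:E); ring.
rewrite ge0_integralZl//; last by apply/measurable_EFinP; exact: measurable_laplace.
set I := (\int[mu]_x _)%E => h.
have : I \is a fin_num.
  have I0 : (0 <= I)%E by apply: integral_ge0 => x _; rewrite lee_fin expR_ge0.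
  by move: h I0; case: I => //; rewrite gt0_muley.
move=> /fineK Ifin; move: h; rewrite -Ifin -EFinM => -[h].
congr (_%:E); have -> : fine I = 2^-1 * (2 * fine I) by field.
rewrite h; field; exact: lt0r_neq0.
Qed.

Lemma integrable_laplace (e : R) : 0 < e ->
  mu.-integrable setT (EFin \o (fun x : R => expR (- (e * `|x|)))).
Proof.
move=> e0; apply/integrableP; split; first by apply/measurable_EFinP; exact: measurable_laplace.
under eq_integral do rewrite /= ger0_norm ?expR_ge0//.
by rewrite integral_laplace// ltry.
Qed.

Lemma integrable_laplaceM (e : R) (g : R -> R) : 0 < e -> measurable_fun setT g ->
  (forall x, `|g x| <= 1) ->
  mu.-integrable setT (EFin \o (fun x : R => expR (- (e * `|x|)) * g x)).
Proof.
move=> e0 mg g1; apply: le_integrable (integrable_laplace e0) => //.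
  by apply/measurable_EFinP/measurable_funM => //; exact: measurable_laplace.
move=> x _ /=; rewrite lee_fin normrM ler_piMr//.
Qed.

Lemma laplace_cos (e u : R) : 0 < e ->
  \int[mu]_x (expR (- (e * `|x|)) * cos (u * x)) = cauchy e u.
Proof.
move=> e0.
have mc : measurable_fun setT (fun x : R => cos (u * x)).
  by apply: measurableT_comp; [exact: continuous_measurable_fun (@continuous_cos R)|exact: measurable_funM].
have c1 (x : R) : `|cos (u * x)| <= 1 by rewrite ler_norml cos_geN1 cos_le1.
have E1 : \int[mu]_x (expR (- (e * `|x|)) * (1 + cos (u * `|x|))) =
    2 * (e^-1 + e / (e ^+ 2 + u ^+ 2)).
  by rewrite /Rintegral laplace_cos1.
have E2 : \int[mu]_x (expR (- (e * `|x|))) = 2 / e by rewrite /Rintegral integral_laplace.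
have := E1.
have -> : \int[mu]_x (expR (- (e * `|x|)) * (1 + cos (u * `|x|))) =
    \int[mu]_x (expR (- (e * `|x|)) + expR (- (e * `|x|)) * cos (u * x)).
  apply: eq_Rintegral => x _; rewrite mulrDr mulr1; congr (_ + _ * _).
  by case: (leP 0 x) => x0; [rewrite ger0_norm|rewrite ltr0_norm// mulrN cosN].
rewrite RintegralD//; last 2 first.
- exact: integrable_laplace.
- exact: integrable_laplaceM.
rewrite E2 => h; have -> : \int[mu]_x (expR (- (e * `|x|)) * cos (u * x)) =
  (2 / e + \int[mu]_x (expR (- (e * `|x|)) * cos (u * x))) - 2 / e by ring.
by rewrite h /cauchy; ring.
Qed.

(** Reflection changes the sign of the sine; adding 1 to it again gives a nonnegative integrand, to
    which the change of variables applies. *)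
Lemma laplace_sin (e u : R) : 0 < e ->
  \int[mu]_x (expR (- (e * `|x|)) * sin (u * x)) = 0.
Proof.
move=> e0.
have ms : measurable_fun setT (fun x : R => sin (u * x)).
  by apply: measurableT_comp; [exact: continuous_measurable_fun (@continuous_sin R)|exact: measurable_funM].
have s1 (x : R) : `|sin (u * x)| <= 1 by rewrite ler_norml sin_geN1 sin_le1.
pose g (x : R) := expR (- (e * `|x|)) * (1 + sin (u * x)).
have g0 x : (0 <= (g x)%:E)%E.
  by rewrite lee_fin mulr_ge0 ?expR_ge0//; have := sin_geN1 (u * x); lra.
have mg : measurable_fun setT (EFin \o g).
  by apply/measurable_EFinP/measurable_funM; [exact: measurable_laplace|exact: measurable_funD].
have := @ge0_integral_affine1 R (EFin \o g) 0 1 ltr01 mg g0.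
rewrite mul1e => h.
have il := integrable_laplace e0.
have is_ := integrable_laplaceM e0 ms s1.
have h1 : \int[mu]_x g x = \int[mu]_x expR (- (e * `|x|)) + \int[mu]_x (expR (- (e * `|x|)) * sin (u * x)).
  by rewrite -RintegralD//; apply: eq_Rintegral => x _; rewrite /g mulrDr mulr1.
have h2 : \int[mu]_x g x = \int[mu]_x expR (- (e * `|x|)) - \int[mu]_x (expR (- (e * `|x|)) * sin (u * x)).
  rewrite -RintegralB//; rewrite {1}/Rintegral -h; congr fine.
  apply: eq_integral => x _; congr (_%:E).
  by rewrite /g sub0r divr1 normrN mulrN sinN mulrDr mulr1 mulrN.
exact: add_sub_eq0 h1 h2.
Qed.

End laplace.

(** * Square-integrable functions *)

Section integrable_real.
Context d (T : measurableType d) (R : realType) (mu : {measure set T -> \bar R}).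
Implicit Types f g : T -> R.

Lemma integrableDr f g : mu.-integrable setT (EFin \o f) ->
  mu.-integrable setT (EFin \o g) ->
  mu.-integrable setT (EFin \o (fun x => f x + g x)).
Proof. by move=> fi gi; have := integrableD measurableT fi gi. Qed.

Lemma integrableBr f g : mu.-integrable setT (EFin \o f) ->
  mu.-integrable setT (EFin \o g) ->
  mu.-integrable setT (EFin \o (fun x => f x - g x)).
Proof. by move=> fi gi; have := integrableB measurableT fi gi. Qed.

Lemma integrableMl_cst k f : mu.-integrable setT (EFin \o f) ->
  mu.-integrable setT (EFin \o (fun x => k * f x)).
Proof. by move=> fi; have := integrableZl measurableT k fi. Qed.

Lemma integrable_mulb (C : R) f g : measurable_fun setT f -> (forall x, `|f x| <= C) ->
  mu.-integrable setT (EFin \o g) -> mu.-integrable setT (EFin \o (fun x => f x * g x)).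
Proof.
move=> mf fC gi; have C0 (x : T) : 0 <= C by exact: le_trans (normr_ge0 _) (fC x).
apply: le_integrable (integrableMl_cst C gi) => //.
  apply/measurable_EFinP/measurable_funM => //.
  by case/integrableP : gi => /measurable_EFinP.
move=> x _; rewrite lee_fin !normrM ler_wpM2r//.
by rewrite (ger0_norm (C0 x)).
Qed.

Lemma sqr_poweR (x : \bar R) : (0 <= x -> x `^ 2%R = x ^+ 2)%E.
Proof.
case: x => [r| |]//.
- by move=> r0; rewrite poweR_EFin powR_mulrn// expe2 -EFinM expr2.
- by move=> _; rewrite poweRyr ?pnatr_eq0// expe2 mulyy.
Qed.

End integrable_real.

Section square_integrable.
Context d (T : measurableType d) (R : realType) (mu : {measure set T -> \bar R}).
Implicit Types f g : T -> R.

Definition isL2 f :=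
  measurable_fun setT f /\ mu.-integrable setT (EFin \o (fun x => f x ^+ 2)).

Definition sqnorm f : R := \int[mu]_x (f x ^+ 2).

Lemma isL2P f : isL2 f <->
  measurable_fun setT f /\ (\int[mu]_x (f x ^+ 2)%:E < +oo)%E.
Proof.
have E : (\int[mu]_x `|(f x ^+ 2)%:E| = \int[mu]_x (f x ^+ 2)%:E)%E.
  by apply: eq_integral => x _; rewrite /= ger0_norm ?sqr_ge0.
split=> -[mf].
  by case/integrableP => _; rewrite E.
move=> h; split=> //; apply/integrableP; split; last by rewrite E.
by apply/measurable_EFinP/measurable_funX.
Qed.

Lemma sqnormE f : isL2 f -> (\int[mu]_x (f x ^+ 2)%:E = (sqnorm f)%:E)%E.
Proof. by move=> [mf /(integrable_fin_num measurableT)/fineK]. Qed.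

Lemma sqnorm_ge0 f : 0 <= sqnorm f.
Proof. by apply: Rintegral_ge0 => x _; exact: sqr_ge0. Qed.

Lemma isL2_le f g : measurable_fun setT f -> isL2 g ->
  (forall x, `|f x| <= `|g x|) -> isL2 f.
Proof.
move=> mf [mg ig] fg; split=> //; apply: le_integrable ig => //.
  by apply/measurable_EFinP/measurable_funX.
by move=> x _; rewrite lee_fin !normrX lerXn2r// ?nnegrE.
Qed.

Lemma isL2Z f k : isL2 f -> isL2 (fun x => k * f x).
Proof.
move=> [mf fi]; split; first exact: measurable_funM.
have := integrableZl measurableT (k ^+ 2) fi.
by apply: eq_integrable => // x _ /=; rewrite exprMn EFinM.
Qed.

Lemma isL2D f g : isL2 f -> isL2 g -> isL2 (fun x => f x + g x).
Proof.
move=> [mf fi] [mg gi]; split; first exact: measurable_funD.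
have := integrableZl measurableT 2 (integrableD measurableT fi gi).
apply: le_integrable => //.
  by apply/measurable_EFinP/measurable_funX/measurable_funD.
move=> x _ /=; rewrite lee_fin.
rewrite !ger0_norm ?sqr_ge0 ?mulr_ge0 ?addr_ge0 ?sqr_ge0//.
by have := sqr_ge0 (f x - g x); rewrite !expr2; nra.
Qed.

Lemma isL2N f : isL2 f -> isL2 (fun x => - f x).
Proof. by move=> /(@isL2Z _ (-1)); under eq_fun do rewrite mulN1r. Qed.

Lemma isL2B f g : isL2 f -> isL2 g -> isL2 (fun x => f x - g x).
Proof. by move=> hf /isL2N hg; exact: isL2D. Qed.

Lemma isL20 : isL2 (fun=> 0).
Proof.
split; first exact: measurable_cst.
rewrite (_ : _ \o _ = cst 0%E); first exact: integrable0.
by apply/funext => x /=; rewrite expr0n.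
Qed.

Lemma isL2_sum (I : Type) (r : seq I) (P : pred I) (f : I -> T -> R) :
  (forall i, P i -> isL2 (f i)) -> isL2 (fun x => \sum_(i <- r | P i) f i x).
Proof.
move=> h; elim: r => [|i r IH].
  by under eq_fun do rewrite big_nil; exact: isL20.
under eq_fun do rewrite big_cons.
case: (boolP (P i)) => // Pi; apply: isL2D => //; exact: h.
Qed.

Lemma isL2M f g : isL2 f -> isL2 g ->
  mu.-integrable setT (EFin \o (fun x => f x * g x)).
Proof.
move=> [mf fi] [mg gi].
apply: le_integrable (integrableD measurableT fi gi) => //.
  by apply/measurable_EFinP/measurable_funM.
move=> x _ /=; rewrite lee_fin normrM (ger0_norm (addr_ge0 _ _)) ?sqr_ge0//.
have := sqr_ge0 (`|f x| - `|g x|); rewrite -(real_normK (num_real (f x))) -(real_normK (num_real (g x))).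
by have := normr_ge0 (f x); have := normr_ge0 (g x); rewrite !expr2; nra.
Qed.

Lemma sqnormZ f k : isL2 f -> sqnorm (fun x => k * f x) = k ^+ 2 * sqnorm f.
Proof.
move=> [mf fi]; rewrite /sqnorm -RintegralZl//.
by apply: eq_Rintegral => x _; rewrite exprMn.
Qed.

Lemma sqnormD f g : isL2 f -> isL2 g ->
  sqnorm (fun x => f x + g x) = sqnorm f + 2 * \int[mu]_x (f x * g x) + sqnorm g.
Proof.
move=> hf hg; have fg := isL2M hf hg; case: hf hg => mf fi [mg gi].
rewrite /sqnorm -RintegralZl// -!RintegralD//.
- by apply: eq_Rintegral => x _; ring.
- by apply: integrableDr => //; exact: integrableMl_cst.
- exact: integrableMl_cst.
Qed.

(** The sign of [c] is part of the conclusion of the case analysis; in particular [c = 0] forces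
    [b = 0], so that Cauchy-Schwarz also covers functions of null norm. *)
Lemma quad_discr (a b c : R) : (forall l : R, 0 <= a + 2 * l * b + l ^+ 2 * c) ->
  b ^+ 2 <= a * c.
Proof.
move=> h; have a0 : 0 <= a by have := h 0; rewrite expr0n/=; lra.
have [c0|c0] := eqVneq c 0.
  have [->|b0] := eqVneq b 0; first by rewrite expr0n/= c0 mulr0.
  (* At this [l] the affine function takes the value [-1]. *)
  have := h (- (a + 1) / (2 * b)).
  rewrite c0 mulr0 addr0; have -> : 2 * (- (a + 1) / (2 * b)) * b = - (a + 1) by field.
  lra.
have cp : 0 < c.
  rewrite lt_neqAle eq_sym c0/= leNgt; apply/negP => cn.
  have := h ((a + 1 + `|2 * b|) / - c + 1).
  set l := _ / - c + 1.
  have l1 : 1 <= l by rewrite /l lerDr divr_ge0 ?addr_ge0// oppr_ge0 ltW.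
  have hl : l * c = - (a + 1 + `|2 * b|) + c by rewrite /l; field.
  have -> : a + 2 * l * b + l ^+ 2 * c = a + l * (2 * b + (l * c)) by ring.
  rewrite hl; have : 2 * b <= `|2 * b| by exact: ler_norm.
  nra.
have := h (- b / c).
have -> : a + 2 * (- b / c) * b + (- b / c) ^+ 2 * c = (a * c - b ^+ 2) / c by field.
by rewrite pmulr_lge0 ?invr_gt0// subr_ge0.
Qed.

Lemma cauchy_schwarz f g : isL2 f -> isL2 g ->
  (\int[mu]_x (f x * g x)) ^+ 2 <= sqnorm f * sqnorm g.
Proof.
move=> hf hg; apply: quad_discr => l.
have := sqnormD hf (isL2Z l hg); rewrite (sqnormZ l hg).
have -> : \int[mu]_x (f x * (l * g x)) = l * \int[mu]_x (f x * g x).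
  rewrite -RintegralZl//; last exact: isL2M.
  by apply: eq_Rintegral => x _; ring.
by move=> E; have := sqnorm_ge0 (fun x => f x + l * g x); rewrite E; lra.
Qed.

Lemma Lfun2_isL2 f : f \in Lfun mu 2%:E -> isL2 f.
Proof.
move=> fL; split; last exact: Lfun2_integrable_sqr.
by have := sub_Lfun_mfun fL; rewrite inE.
Qed.

Lemma Lnorm2_sqr f : isL2 f -> (('N[mu]_2%:E [EFin \o f]) ^+ 2 = (sqnorm f)%:E)%E.
Proof.
move=> hf; rewrite -(sqnormE hf).
have h := @poweR_Lnorm _ _ _ mu (EFin \o f) 2 (ltac:(by rewrite pnatr_eq0)).
rewrite -sqr_poweR; last exact: Lnorm_ge0.
rewrite h; apply: eq_integral => x _ /=.
by rewrite powR_mulrn// real_normK ?num_real.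
Qed.

Lemma Lnorm2_sqr_integral f : measurable_fun setT f ->
  (('N[mu]_2%:E [EFin \o f]) ^+ 2 = \int[mu]_x (f x ^+ 2)%:E)%E.
Proof.
move=> mf.
have h := @poweR_Lnorm _ _ _ mu (EFin \o f) 2 (ltac:(by rewrite pnatr_eq0)).
rewrite -sqr_poweR; last exact: Lnorm_ge0.
rewrite h; apply: eq_integral => x _ /=.
by rewrite powR_mulrn// real_normK ?num_real.
Qed.

Lemma Lfun1_int f : f \in Lfun mu 1%:E -> mu.-integrable setT (EFin \o f).
Proof. by move=> /Lfun1_integrable. Qed.

End square_integrable.

(** * The Hartley transform *)

Section product_integrals.
Context {R : realType}.

Lemma measurable_prod_coord d (f : 'I_d -> R -> R) :
  (forall i, measurable_fun setT (f i)) ->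
  measurable_fun setT (fun t : Rvec R d => \prod_(i < d) f i (tnth t i)).
Proof.
move=> mf; apply: measurable_prod => i _.
exact: (measurableT_comp (mf i) (measurable_tnth i)).
Qed.

Lemma prod_cons_pair d (f : 'I_d.+1 -> R -> R) x (t : Rvec R d) :
  \prod_(i < d.+1) f i (tnth (cons_pair (x, t)) i) =
  f ord0 x * \prod_(i < d) f (lift ord0 i) (tnth t i).
Proof.
rewrite big_ord_recl tnth_cons_pair0; congr (_ * _).
by apply: eq_bigr => i _; rewrite tnth_cons_pairS.
Qed.

Lemma ge0_integral_prod d (f : 'I_d -> R -> R) :
  (forall i, measurable_fun setT (f i)) -> (forall i x, 0 <= f i x) ->
  (\int[leb R d]_t (\prod_(i < d) f i (tnth t i))%:E =
   \prod_(i < d) \int[@lebesgue_measure R]_x (f i x)%:E)%E.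
Proof.
elim: d => [|d IH] in f *; move=> mf f0.
  by rewrite integral_mpow0 !big_ord0.
rewrite ge0_integral_mpowS; last 2 first.
- by apply/measurable_EFinP; exact: measurable_prod_coord.
- by move=> t; rewrite lee_fin prodr_ge0.
rewrite big_ord_recl.
have p0 (t : Rvec R d) : (0 <= (\prod_(i < d) f (lift ord0 i) (tnth t i))%:E)%E.
  by rewrite lee_fin prodr_ge0.
have mp : measurable_fun setT (fun t : Rvec R d => (\prod_(i < d) f (lift ord0 i) (tnth t i))%:E).
  by apply/measurable_EFinP; exact: (measurable_prod_coord (f := fun i => f (lift ord0 i))).
rewrite -(IH (fun i => f (lift ord0 i)))//; set J := (\int[leb R d]_t _)%E.
have E x : (\int[leb R d]_t (\prod_(i < d.+1) f i (tnth (cons_pair (x, t)) i))%:E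
    = (f ord0 x)%:E * J)%E.
  under eq_integral do rewrite prod_cons_pair EFinM.
  by rewrite ge0_integralZl// lee_fin.
transitivity (\int[@lebesgue_measure R]_x ((f ord0 x)%:E * J))%E.
  by apply: eq_integral => x _; exact: E.
rewrite ge0_integralZr//.
- by apply/measurable_EFinP; exact: mf.
- by move=> x _; rewrite lee_fin.
- exact: integral_ge0.
Qed.

End product_integrals.

Section Rintegral_cons.
Context d (T : measurableType d) (R : realType).
Context (mu : {sigma_finite_measure set T -> \bar R}) (n : nat).
Context (nu : {sigma_finite_measure set (n.-tuple T) -> \bar R}).

Lemma Rintegral_cons (F : n.+1.-tuple T -> R) :
  (cons_measure mu nu).-integrable setT (EFin \o F) ->
  \int[cons_measure mu nu]_t F t = \int[mu]_x \int[nu]_t F (cons_pair (x, t)).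
Proof.
move=> /integrableP[mF Fi].
have mc : measurable_fun setT (@cons_pair _ T n) by exact: measurable_cons_pair.
have mFc := measurableT_comp mF mc.
have Fi' : (mu \x nu)%E.-integrable setT (EFin \o (F \o @cons_pair _ T n)).
  apply/(integrable12ltyP mu nu mFc).
  rewrite ge0_integral_cons// in Fi.
  exact: measurableT_comp.
rewrite (RFubini1E Fi') /Rintegral; congr fine.
rewrite [LHS](@integral_pushforward _ _ _ _ _ _ mc)//.
Qed.

End Rintegral_cons.

Section poisson.
Context {R : realType}.
Implicit Types e : R.

Definition laplace d e (t : Rvec R d) : R :=
  \prod_(i < d) expR (- (e * `|(tnth t i : R)|)).

Definition poisson d e (u : Rvec R d) : R := \prod_(i < d) cauchy e (tnth u i).

Lemma laplace_gt0 d e (t : Rvec R d) : 0 < laplace e t.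
Proof. by apply: prodr_gt0 => i _; exact: expR_gt0. Qed.

Lemma laplace_le1 d e (t : Rvec R d) : 0 <= e -> laplace e t <= 1.
Proof.
move=> e0; apply: prodr_ile1 => i _; rewrite expR_ge0/=.
by rewrite -expR0 ler_expR oppr_le0 mulr_ge0.
Qed.

Lemma measurable_laplaceV d e : measurable_fun setT (@laplace d e).
Proof.
apply: (@measurable_prod_coord _ _ (fun i x => expR (- (e * `|x|)))) => i.
exact: measurable_laplace.
Qed.

Lemma integral_laplaceV d e : 0 < e ->
  (\int[leb R d]_t (laplace e t)%:E = ((2 / e) ^+ d)%:E)%E.
Proof.
move=> e0; rewrite (@ge0_integral_prod _ _ (fun i x => expR (- (e * `|x|)))).
- under eq_bigr do rewrite integral_laplace//.
  by rewrite prodEFin prodr_const card_ord.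
- by move=> i; exact: measurable_laplace.
- by move=> i x; exact: expR_ge0.
Qed.

Lemma integrable_laplaceV d e : 0 < e ->
  (leb R d).-integrable setT (EFin \o @laplace d e).
Proof.
move=> e0; apply/integrableP; split.
  by apply/measurable_EFinP; exact: measurable_laplaceV.
rewrite (eq_integral (fun t => (laplace e t)%:E)); last first.
  by move=> t _ /=; rewrite gtr0_norm ?laplace_gt0.
by rewrite integral_laplaceV// ltry.
Qed.

Lemma integrable_laplaceVM d e (g : Rvec R d -> R) : 0 < e ->
  measurable_fun setT g -> (forall t, `|g t| <= 1) ->
  (leb R d).-integrable setT (EFin \o (fun t => laplace e t * g t)).
Proof.
move=> e0 mg g1; under eq_fun do rewrite mulrC.
by apply: integrable_mulb g1 _ => //; exact: integrable_laplaceV.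
Qed.

Lemma poisson_ge0 d e (u : Rvec R d) : 0 < e -> 0 <= poisson e u.
Proof. by move=> e0; apply: prodr_ge0 => i _; exact: cauchy_ge0. Qed.

Lemma measurable_poisson d e : 0 < e -> measurable_fun setT (@poisson d e).
Proof.
move=> e0; apply: (@measurable_prod_coord _ _ (fun i x => cauchy e x)) => i.
exact: measurable_cauchy.
Qed.

Lemma integral_poisson d e : 0 < e ->
  (\int[leb R d]_u (poisson e u)%:E = ((2 * pi) ^+ d)%:E)%E.
Proof.
move=> e0; rewrite (@ge0_integral_prod _ _ (fun i x => cauchy e x)).
- under eq_bigr do rewrite integral_cauchy//.
  by rewrite prodEFin prodr_const card_ord.
- by move=> i; exact: measurable_cauchy.
- by move=> i x; exact: cauchy_ge0.
Qed.

Lemma dot_cons_pair d (u : Rvec R d.+1) x (t : Rvec R d) :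
  dot u (cons_pair (x, t)) =
  (tnth u ord0 : R) * x + dot [tuple tnth u (lift ord0 i) | i < d] t.
Proof.
rewrite /dot big_ord_recl tnth_cons_pair0; congr (_ + _).
by apply: eq_bigr => i _; rewrite tnth_cons_pairS tnth_mktuple.
Qed.

Lemma sincos_bounded (x : R) : `|cos x| <= 1 /\ `|sin x| <= 1.
Proof. by rewrite !ler_norml cos_geN1 cos_le1 sin_geN1 sin_le1. Qed.

Lemma measurable_cos_dot d d' (T : measurableType d') (f g : T -> Rvec R d) :
  measurable_fun setT f -> measurable_fun setT g ->
  measurable_fun setT (fun z => cos (dot (f z) (g z))).
Proof.
move=> mf mg; apply: (measurableT_comp (continuous_measurable_fun (@continuous_cos R))).
exact: measurable_dot.
Qed.

Lemma measurable_sin_dot d d' (T : measurableType d') (f g : T -> Rvec R d) :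
  measurable_fun setT f -> measurable_fun setT g ->
  measurable_fun setT (fun z => sin (dot (f z) (g z))).
Proof.
move=> mf mg; apply: (measurableT_comp (continuous_measurable_fun (@continuous_sin R))).
exact: measurable_dot.
Qed.

(** The addition formulas mix cosine and sine, so the induction on the dimension carries both
    integrals; the one with the sine vanishes at every stage. *)
Lemma laplace_cos_sin d e (u : Rvec R d) : 0 < e ->
  \int[leb R d]_t (laplace e t * cos (dot u t)) = poisson e u /\
  \int[leb R d]_t (laplace e t * sin (dot u t)) = 0.
Proof.
move=> e0; elim: d => [|d IH] in u *.
  rewrite /Rintegral !integral_mpow0 /= /laplace /poisson /dot !big_ord0.
  by rewrite cos0 sin0 mulr1 mulr0.
pose u' : Rvec R d := [tuple tnth u (lift ord0 i) | i < d].
have [Ic Is] := IH u'.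
have mc n (v : Rvec R n) : measurable_fun setT (fun t => cos (dot v t)).
  by apply: measurable_cos_dot => //; exact: measurable_cst.
have ms n (v : Rvec R n) : measurable_fun setT (fun t => sin (dot v t)).
  by apply: measurable_sin_dot => //; exact: measurable_cst.
have ic n (v : Rvec R n) := integrable_laplaceVM e0 (mc n v) (fun t => (sincos_bounded (dot v t)).1).
have is_ n (v : Rvec R n) := integrable_laplaceVM e0 (ms n v) (fun t => (sincos_bounded (dot v t)).2).
have lc x (t : Rvec R d) : laplace e (cons_pair (x, t)) = expR (- (e * `|x|)) * laplace e t.
  exact: (prod_cons_pair (fun i x => expR (- (e * `|x|)))).
have pu : poisson e u = cauchy e (tnth u ord0) * poisson e u'.
  rewrite /poisson big_ord_recl; congr (_ * _).
  by apply: eq_bigr => i _; rewrite tnth_mktuple.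
set u0 : R := tnth u ord0 in pu *.
have lin (a b : R) : \int[leb R d]_t (a * (laplace e t * cos (dot u' t)) + b * (laplace e t * sin (dot u' t))) = a * poisson e u'.
  rewrite RintegralD//; [|exact: integrableMl_cst|exact: integrableMl_cst].
  by rewrite !RintegralZl// Ic Is mulr0 addr0.
split.
  rewrite [LHS]Rintegral_cons; last exact: ic.
  transitivity (\int[lebesgue_measure]_x (poisson e u' * (expR (- (e * `|x|)) * cos (u0 * x)))).
    apply: eq_Rintegral => x _; rewrite mulrC -(lin _ (- (expR (- (e * `|x|)) * sin (u0 * x)))).
    apply: eq_Rintegral => t _; rewrite lc dot_cons_pair cosD.
    by rewrite -/u0 -/u'; ring.
  rewrite RintegralZl//; last first.
    apply: integrable_laplaceM => //; last by move=> x; exact: (sincos_bounded _).1.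
    by apply: measurableT_comp; [exact: continuous_measurable_fun (@continuous_cos R)|exact: measurable_funM].
  by rewrite laplace_cos// pu mulrC.
rewrite [LHS]Rintegral_cons; last exact: is_.
transitivity (\int[lebesgue_measure]_x (poisson e u' * (expR (- (e * `|x|)) * sin (u0 * x)))).
  apply: eq_Rintegral => x _; rewrite mulrC -(lin _ (expR (- (e * `|x|)) * cos (u0 * x))).
  apply: eq_Rintegral => t _; rewrite lc dot_cons_pair sinD.
  by rewrite -/u0 -/u'; ring.
rewrite RintegralZl//; last first.
  apply: integrable_laplaceM => //; last by move=> x; exact: (sincos_bounded _).2.
  by apply: measurableT_comp; [exact: continuous_measurable_fun (@continuous_sin R)|exact: measurable_funM].
by rewrite laplace_sin// mulr0.
Qed.

Definition vsub d (x y : Rvec R d) : Rvec R d :=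
  [tuple (tnth x i : R) - (tnth y i : R) | i < d].

Lemma vsubE d (x y : Rvec R d) : vsub x y = rescale x y 1.
Proof. by apply: eq_from_tnth => i; rewrite !tnth_mktuple divr1. Qed.

Lemma tnth_vsub d (x y : Rvec R d) i : tnth (vsub x y) i = (tnth x i : R) - (tnth y i : R) :> R.
Proof. by rewrite tnth_mktuple. Qed.

Lemma measurable_vsub d d' (T : measurableType d') (f g : T -> Rvec R d) :
  measurable_fun setT f -> measurable_fun setT g ->
  measurable_fun setT (fun z => vsub (f z) (g z)).
Proof.
by move=> mf mg; under eq_fun do rewrite vsubE; exact: measurable_rescale.
Qed.

Lemma poisson_vsubC d e (x y : Rvec R d) : poisson e (vsub x y) = poisson e (vsub y x).
Proof. by apply: eq_bigr => i _; rewrite !tnth_vsub -cauchyN opprB. Qed.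

Lemma integral_poisson_vsub d e (x : Rvec R d) : 0 < e ->
  (\int[leb R d]_y (poisson e (vsub x y))%:E = ((2 * pi) ^+ d)%:E)%E.
Proof.
move=> e0; under eq_integral do rewrite vsubE.
rewrite (@ge0_integral_rescale _ _ (EFin \o poisson e))//.
- by rewrite expr1n mul1e integral_poisson.
- by apply/measurable_EFinP; exact: measurable_poisson.
- by move=> t; rewrite lee_fin poisson_ge0.
Qed.

End poisson.

Section norm_Rintegral.
Context d (T : measurableType d) (R : realType) (mu : {measure set T -> \bar R}).

Lemma norm_Rintegral_le (f : T -> R) : measurable_fun setT f ->
  ((`|\int[mu]_x f x|)%:E <= \int[mu]_x (`|f x|)%:E)%E.
Proof.
move=> mf; have h := @le_abse_integral _ _ _ mu setT (EFin \o f) measurableT (ltac:(exact/measurable_EFinP)).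
apply: le_trans h; rewrite /Rintegral.
by case: (\int[mu]_x _)%E => [r| |] //=; rewrite ?normr0 ?leey.
Qed.

Lemma Rintegral_EFin (f : T -> R) : mu.-integrable setT (EFin \o f) ->
  ((\int[mu]_x f x)%:E = \int[mu]_x (f x)%:E)%E.
Proof. by move=> fi; rewrite /Rintegral fineK//; exact: (integrable_fin_num measurableT fi). Qed.

Lemma integrable_lt (f : T -> R) : mu.-integrable setT (EFin \o f) ->
  (\int[mu]_x (`|f x|)%:E < +oo)%E.
Proof. by case/integrableP. Qed.

Lemma integrable_measurable (f : T -> R) : mu.-integrable setT (EFin \o f) ->
  measurable_fun setT f.
Proof. by move=> /measurable_int/measurable_EFinP. Qed.

Lemma integrable_normr (f : T -> R) : mu.-integrable setT (EFin \o f) ->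
  mu.-integrable setT (EFin \o (fun x => `|f x|)).
Proof. exact: integrable_norm. Qed.

Lemma norm_Rintegral_leR (f : T -> R) : mu.-integrable setT (EFin \o f) ->
  `|\int[mu]_x f x| <= \int[mu]_x `|f x|.
Proof. exact: le_normr_Rintegral. Qed.

(** The integral of a nonnegative function is a supremum over the simple functions below it, so
    monotonicity holds without measurability. This is what allows the loss of an aggregate to be
    bounded inside the risk. *)
Lemma ge0_le_integralT (f g : T -> \bar R) :
  (forall x, 0 <= f x)%E -> (forall x, f x <= g x)%E ->
  (\int[mu]_x f x <= \int[mu]_x g x)%E.
Proof.
move=> f0 fg; rewrite !ge0_integralTE//; last first.
  by move=> x; exact: le_trans (fg x).
apply: ereal_sup_le => _ [h hf <-].
by exists h => // x; exact: le_trans (fg x).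
Qed.

End norm_Rintegral.

Lemma laplaceE (R : realType) d e (t : Rvec R d) :
  laplace e t = expR (- (e * \sum_(i < d) `|(tnth t i : R)|)).
Proof. by rewrite mulr_sumr -sumrN expR_sum. Qed.

Section hartley.
Context {R : realType} {d : nat}.
Notation mu := (leb R d).
Implicit Types (f g : Rvec R d -> R) (x y t : Rvec R d).

Definition cas (u : R) : R := cos u + sin u.

Lemma norm_cas u : `|cas u| <= 2.
Proof.
have [h1 h2] := sincos_bounded u.
by rewrite (le_trans (ler_normD _ _))// -[leRHS]/(1 + 1) lerD.
Qed.

(** With [a = dot y t] and [b = dot x t], the sine is odd in [t] and integrates to 0 against even
    weights, which leaves the kernel of a convolution. *)
Lemma cas_mul a b : cas a * cas b = cos (a - b) + sin (a + b).
Proof. by rewrite /cas cosB sinD; ring. Qed.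

Lemma measurable_cas_dot d' (T : measurableType d') (f g : T -> Rvec R d) :
  measurable_fun setT f -> measurable_fun setT g ->
  measurable_fun setT (fun z => cas (dot (f z) (g z))).
Proof.
by move=> mf mg; apply: measurable_funD; [exact: measurable_cos_dot|exact: measurable_sin_dot].
Qed.

(* On an even function this is the Fourier transform; up to the factor (2 pi)^d
   it is an involution. *)
Definition hartley f t : R := \int[mu]_x (cas (dot x t) * f x).

Lemma integrable_hartley f t : mu.-integrable setT (EFin \o f) ->
  mu.-integrable setT (EFin \o (fun x => cas (dot x t) * f x)).
Proof.
move=> fi; apply: (@integrable_mulb _ _ _ _ 2) => //.
- by apply: measurable_cas_dot => //; exact: measurable_cst.
- by move=> x; exact: norm_cas.
Qed.

Lemma hartley_bounded f t : mu.-integrable setT (EFin \o f) ->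
  `|hartley f t| <= 2 * \int[mu]_x `|f x|.
Proof.
move=> fi; apply: le_trans (norm_Rintegral_leR (integrable_hartley t fi)) _.
rewrite -RintegralZl//; last exact: integrable_normr.
apply: le_Rintegral => //.
- exact: integrable_normr (integrable_hartley t fi).
- exact: integrableMl_cst (integrable_normr fi).
- by move=> x _; rewrite normrM ler_wpM2r// norm_cas.
Qed.

Lemma laplace_cas_prod_integrable e f (v : Rvec R d -> R) (C : R) : 0 < e ->
  mu.-integrable setT (EFin \o f) -> measurable_fun setT v -> (forall t, `|v t| <= C) ->
  (mu \x mu)%E.-integrable setT (EFin \o (fun z : Rvec R d * Rvec R d =>
     laplace e z.1 * v z.1 * (cas (dot z.2 z.1) * f z.2))).
Proof.
move=> e0 fi mv vC.
have C0 (t : Rvec R d) : 0 <= C by exact: le_trans (normr_ge0 _) (vC t).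
apply: (@integrable_prod_le _ _ _ _ _ _ _ _ (fun t => (2 * C) * laplace e t) f) => //.
- apply: measurable_funM; apply: measurable_funM.
  + by apply: (measurableT_comp (measurable_laplaceV _)).
  + exact: measurableT_comp.
  + exact: measurable_cas_dot.
  + by apply: measurableT_comp => //; exact: integrable_measurable fi.
- by apply: integrableMl_cst; exact: integrable_laplaceV.
- move=> x y /=; rewrite !normrM (gtr0_norm (laplace_gt0 _ _)) mulrA ler_wpM2r//.
  rewrite (ger0_norm (C0 x)) (ger0_norm (_ : 0 <= 2))//.
  have l0 := laplace_gt0 e x; have h1 := vC x; have h2 := norm_cas (dot y x).
  suff : `|v x| * `|cas (dot y x)| <= C * 2.
    by move=> h3; rewrite -mulrA [X in X <= _]mulrC [2 * C]mulrC ler_pM2r.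
  by rewrite ler_pM.
Qed.

(** Fubini yields measurability in [t] for an integrand that is integrable on the product: the
    factor [laplace 1 t] makes it so, and is divided out afterwards. *)
Lemma measurable_hartley f : mu.-integrable setT (EFin \o f) ->
  measurable_fun setT (hartley f).
Proof.
move=> fi; have h := @laplace_cas_prod_integrable 1 f (fun=> 1) 1 ltr01 fi (measurable_cst _) (fun=> ltac:(by rewrite normr1)).
have /integrable_measurable m := RFubini_int h.
rewrite (_ : hartley f = fun t => (laplace 1 t)^-1 * \int[mu]_x (laplace 1 t * 1 * (cas (dot x t) * f x))).
  apply: measurable_funM => //; under eq_fun do rewrite laplaceE -expRN opprK mul1r.
  apply: measurableT_comp => //; apply: measurable_sum => i.
  by apply: measurableT_comp => //; exact: measurable_tnth.
apply/funext => t; rewrite RintegralZl//; last exact: integrable_hartley.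
by rewrite mulr1 mulrA mulVf ?mul1r// gt_eqF ?laplace_gt0.
Qed.

Lemma integral_laplace_cas2 e x y : 0 < e ->
  \int[mu]_t (laplace e t * (cas (dot y t) * cas (dot x t))) = poisson e (vsub y x).
Proof.
move=> e0; have mc (v : Rvec R d) : measurable_fun setT (fun t => cos (dot v t)).
  by apply: measurable_cos_dot => //; exact: measurable_cst.
have ms (v : Rvec R d) : measurable_fun setT (fun t => sin (dot v t)).
  by apply: measurable_sin_dot => //; exact: measurable_cst.
have ic v := integrable_laplaceVM e0 (mc v) (fun t => (sincos_bounded (dot v t)).1).
have is_ v := integrable_laplaceVM e0 (ms v) (fun t => (sincos_bounded (dot v t)).2).
pose w := vsub y (vneg x).
transitivity (\int[mu]_t (laplace e t * cos (dot (vsub y x) t) + laplace e t * sin (dot w t))).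
  apply: eq_Rintegral => t _; rewrite cas_mul mulrDr.
  by rewrite /w !vsubE !dot_rescale !divr1 dot_vneg opprK.
rewrite RintegralD//.
by rewrite (laplace_cos_sin _ e0).1 (laplace_cos_sin _ e0).2 addr0.
Qed.

Lemma poisson_bounded e (u : Rvec R d) : 0 < e -> `|poisson e u| <= (2 / e) ^+ d.
Proof.
move=> e0; rewrite ger0_norm ?poisson_ge0//.
rewrite -{2}(card_ord d) -prodr_const; apply: ler_prod => i _.
rewrite cauchy_ge0//= /cauchy ler_pdivrMr ?cauchy_den_gt0//.
rewrite -mulrA ler_pM2l// ler_pdivlMl// -expr2.
by rewrite lerDl sqr_ge0.
Qed.

Lemma integrable_poissonM e f y : 0 < e -> mu.-integrable setT (EFin \o f) ->
  mu.-integrable setT (EFin \o (fun x => f x * poisson e (vsub y x))).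
Proof.
move=> e0 fi; under eq_fun do rewrite mulrC.
apply: (@integrable_mulb _ _ _ _ ((2 / e) ^+ d)) => //.
- apply: (measurableT_comp (measurable_poisson e0)).
  by apply: measurable_vsub => //; exact: measurable_cst.
- by move=> x; exact: poisson_bounded.
Qed.

Lemma laplace_hartley e f y : 0 < e -> mu.-integrable setT (EFin \o f) ->
  \int[mu]_t (laplace e t * cas (dot y t) * hartley f t) =
  \int[mu]_x (f x * poisson e (vsub y x)).
Proof.
move=> e0 fi.
have mv : measurable_fun setT (fun t => cas (dot y t)).
  by apply: measurable_cas_dot => //; exact: measurable_cst.
have h := laplace_cas_prod_integrable e0 fi mv (fun t => norm_cas _).
transitivity (\int[mu]_t \int[mu]_x (laplace e t * cas (dot y t) * (cas (dot x t) * f x))).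
  apply: eq_Rintegral => t _; rewrite RintegralZl//.
  exact: integrable_hartley.
rewrite (RFubini h); apply: eq_Rintegral => x _ /=.
rewrite -(integral_laplace_cas2 x y e0) -RintegralZl//; last first.
  under eq_fun do rewrite mulrC.
  apply: (@integrable_mulb _ _ _ _ 4) => //; last exact: integrable_laplaceV.
    by apply: measurable_funM; apply: measurable_cas_dot => //; exact: measurable_cst.
  move=> t; rewrite normrM (_ : 4 = 2 * 2) ?ler_pM// ?norm_cas//; ring.
by apply: eq_Rintegral => t _; ring.
Qed.

Lemma measurable_hartley_comp d' (T : measurableType d') f (u : T -> Rvec R d) :
  mu.-integrable setT (EFin \o f) -> measurable_fun setT u ->
  measurable_fun setT (fun z => hartley f (u z)).
Proof. by move=> fi mu'; exact: (measurableT_comp (measurable_hartley fi)). Qed.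

(* By laplace_hartley the left side is the double integral of
   g(x) g(y) poisson(x - y), to which AM-GM applies. *)
Lemma laplace_hartley_sqr_le e g : 0 < e -> mu.-integrable setT (EFin \o g) ->
  isL2 mu g ->
  (\int[mu]_x (laplace e x * hartley g x ^+ 2)%:E <= ((2 * pi) ^+ d * sqnorm mu g)%:E)%E.
Proof.
move=> e0 gi g2; pose H := hartley g.
have mg := integrable_measurable gi.
have mH : measurable_fun setT H by exact: measurable_hartley.
pose C := 2 * \int[mu]_x `|g x|.
have HC t : `|H t| <= C by exact: hartley_bounded.
have h := laplace_cas_prod_integrable e0 gi mH HC.
have iE : mu.-integrable setT (EFin \o (fun x => laplace e x * H x ^+ 2)).
  under eq_fun do rewrite mulrC.
  apply: (@integrable_mulb _ _ _ _ (C ^+ 2)); last exact: integrable_laplaceV.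
    exact: measurable_funX.
  by move=> x; rewrite normrX lerXn2r ?nnegrE//; exact: le_trans (HC x).
rewrite -(Rintegral_EFin iE).
have E : \int[mu]_x (laplace e x * H x ^+ 2) =
    \int[mu]_t \int[mu]_s (g t * g s * poisson e (vsub t s)).
  transitivity (\int[mu]_x \int[mu]_t (laplace e x * H x * (cas (dot t x) * g t))).
    apply: eq_Rintegral => x _; rewrite RintegralZl//; last exact: integrable_hartley.
    by rewrite expr2 mulrA.
  rewrite (RFubini h); apply: eq_Rintegral => t _ /=.
  transitivity (g t * \int[mu]_s (g s * poisson e (vsub t s))).
    rewrite -laplace_hartley// -RintegralZl//; first by apply: eq_Rintegral => x _; rewrite -/H; ring.
    under eq_fun do rewrite mulrAC mulrC.
    apply: (@integrable_mulb _ _ _ _ 2) => //.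
    - by apply: measurable_cas_dot => //; exact: measurable_cst.
    - by move=> x; exact: norm_cas.
    under eq_fun do rewrite mulrC.
    by apply: integrable_mulb HC _ => //; exact: integrable_laplaceV.
  rewrite -RintegralZl//; last exact: integrable_poissonM.
  by apply: eq_Rintegral => s _; ring.
have mP : measurable_fun setT (fun z : Rvec R d * Rvec R d => poisson e (vsub z.1 z.2)).
  by apply: (measurableT_comp (measurable_poisson e0)); exact: measurable_vsub.
have mF : measurable_fun setT (fun z : Rvec R d * Rvec R d => `|g z.1 * g z.2 * poisson e (vsub z.1 z.2)|).
  apply: measurableT_comp => //; apply: measurable_funM => //.
  by apply: measurable_funM; exact: measurableT_comp.
have mS : measurable_fun setT (fun z : Rvec R d * Rvec R d => (g z.1 ^+ 2 + g z.2 ^+ 2) / 2 * poisson e (vsub z.1 z.2)).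
  apply: measurable_funM => //; apply: measurable_funM => //.
  by apply: measurable_funD; apply: measurable_funX; exact: measurableT_comp.
pose P (z : Rvec R d * Rvec R d) := poisson e (vsub z.1 z.2).
have P0 z : 0 <= P z by exact: poisson_ge0.
pose S1 z := (2^-1 * g z.1 ^+ 2 * P z)%:E.
pose S2 z := (2^-1 * g z.2 ^+ 2 * P z)%:E.
have S10 z : (0 <= S1 z)%E by rewrite lee_fin; apply: mulr_ge0 => //; apply: mulr_ge0 => //; exact: sqr_ge0.
have S20 z : (0 <= S2 z)%E by rewrite lee_fin; apply: mulr_ge0 => //; apply: mulr_ge0 => //; exact: sqr_ge0.
have mS1 : measurable_fun setT S1.
  apply/measurable_EFinP; apply: measurable_funM => //; apply: measurable_funM => //.
  by apply: measurable_funX; exact: measurableT_comp.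
have mS2 : measurable_fun setT S2.
  apply/measurable_EFinP; apply: measurable_funM => //; apply: measurable_funM => //.
  by apply: measurable_funX; exact: measurableT_comp.
have half t : (\int[mu]_s (2^-1 * g t ^+ 2 * poisson e (vsub t s))%:E = ((2^-1 * (2 * pi) ^+ d) * g t ^+ 2)%:E)%E.
  under eq_integral do rewrite EFinM.
  rewrite ge0_integralZl//.
  - by rewrite integral_poisson_vsub// -EFinM; congr (_%:E); ring.
  - apply/measurable_EFinP; apply: (measurableT_comp (measurable_poisson e0)).
    by apply: measurable_vsub => //; exact: measurable_cst.
  - by move=> s _; rewrite lee_fin poisson_ge0.
  - by rewrite lee_fin mulr_ge0// sqr_ge0.
have tot : (\int[mu]_t ((2^-1 * (2 * pi) ^+ d) * g t ^+ 2)%:E = (2^-1 * ((2 * pi) ^+ d * sqnorm mu g))%:E)%E.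
  under eq_integral do rewrite EFinM.
  rewrite ge0_integralZl//.
  - by rewrite sqnormE// -EFinM mulrA.
  - by apply/measurable_EFinP; exact: measurable_funX.
  - by move=> s _; rewrite lee_fin sqr_ge0.
  - by rewrite lee_fin mulr_ge0// exprn_ge0// mulr_ge0// pi_ge0.
have SE : (\int[(mu \x mu)%E]_z (S1 z + S2 z) = ((2 * pi) ^+ d * sqnorm mu g)%:E)%E.
  rewrite ge0_integralD// fubini_tonelli1// fubini_tonelli2//.
  rewrite (eq_integral (fun t => ((2^-1 * (2 * pi) ^+ d) * g t ^+ 2)%:E)); last first.
    by move=> t _; exact: half.
  rewrite [X in (_ + X)%E](eq_integral (fun t => ((2^-1 * (2 * pi) ^+ d) * g t ^+ 2)%:E)); last first.
    move=> t _; rewrite -half; apply: eq_integral => s _.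
    by rewrite /S2 /P/= poisson_vsubC.
  by rewrite tot -EFinD; congr (_%:E); field.
pose F z := g z.1 * g z.2 * P z.
have mF' : measurable_fun setT F.
  apply: measurable_funM => //.
  by apply: measurable_funM; exact: measurableT_comp.
have FS z : (`|F z|%:E <= S1 z + S2 z)%E.
  rewrite lee_fin /F normrM (ger0_norm (P0 z)) -mulrDl ler_wpM2r// normrM.
  have := sqr_ge0 (`|g z.1| - `|g z.2|).
  rewrite -(real_normK (num_real (g z.1))) -(real_normK (num_real (g z.2))).
  by move: `|g z.1| `|g z.2| => a b; rewrite !expr2; nra.
have iF : (mu \x mu)%E.-integrable setT (EFin \o F).
  apply/integrableP; split; first exact/measurable_EFinP.
  apply: (@le_lt_trans _ _ (\int[(mu \x mu)%E]_z (S1 z + S2 z))%E).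
    exact: ge0_le_integralT.
  by rewrite SE ltry.
rewrite E (RFubini1E iF); apply: (@le_trans _ _ (`|\int[(mu \x mu)%E]_z F z|)%:E).
  by rewrite lee_fin ler_norm.
apply: (le_trans (norm_Rintegral_le _ mF')).
by rewrite -SE; exact: ge0_le_integralT.
Qed.

Lemma cvg_laplace1 t : laplace k.+1%:R^-1 t @[k --> \oo] --> (1 : R).
Proof.
under eq_fun do rewrite laplaceE.
have h : - (k.+1%:R^-1 * \sum_(i < d) `|(tnth t i : R)|) @[k --> \oo] -->
    - (0 * \sum_(i < d) `|(tnth t i : R)|).
  by apply: cvgN; apply: cvgMl; exact: cvg_harmonic.
have := @cvg_comp _ _ _ _ expR _ _ _ h (@continuous_expR R _).
by rewrite mul0r oppr0 expR0.
Qed.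

Lemma nd_laplace t : {homo (fun k => laplace k.+1%:R^-1 t) : m n / (m <= n)%N >-> m <= n}.
Proof.
move=> m n mn; rewrite !laplaceE ler_expR lerN2 ler_wpM2r//; first by apply: sumr_ge0.
by rewrite lef_pV2 ?posrE// ler_nat ltnS.
Qed.

(** The damped integrals of [laplace_hartley_sqr_le] increase to the full one as [e] decreases to 0,
    so their common bound survives by monotone convergence. *)
Lemma hartley_L2 g : mu.-integrable setT (EFin \o g) -> isL2 mu g ->
  isL2 mu (hartley g) /\ sqnorm mu (hartley g) <= (2 * pi) ^+ d * sqnorm mu g.
Proof.
move=> gi g2; have mH := measurable_hartley gi.
have le : (\int[mu]_x (hartley g x ^+ 2)%:E <= ((2 * pi) ^+ d * sqnorm mu g)%:E)%E.
  pose u k x := (laplace k.+1%:R^-1 x * hartley g x ^+ 2)%:E.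
  have -> : (\int[mu]_x (hartley g x ^+ 2)%:E = \int[mu]_x limn (u^~ x))%E.
    apply: eq_integral => x _; apply/esym/cvg_lim => //; apply: cvg_EFin.
      by apply: nearW.
    rewrite -[X in _ --> X]mul1r; apply: cvgMl; exact: cvg_laplace1.
  rewrite monotone_convergence//.
  - apply: lime_le.
      apply: ereal_nondecreasing_is_cvgn => m n mn; apply: ge0_le_integralT => x.
        by rewrite lee_fin mulr_ge0 ?sqr_ge0// ltW// laplace_gt0.
      by rewrite lee_fin ler_wpM2r ?sqr_ge0//; exact: nd_laplace.
    by apply: nearW => k; apply: laplace_hartley_sqr_le => //; rewrite invr_gt0.
  - move=> k; apply/measurable_EFinP; apply: measurable_funM.
      exact: measurable_laplaceV.
    exact: measurable_funX.
  - by move=> k x _; rewrite lee_fin mulr_ge0 ?sqr_ge0// ltW// laplace_gt0.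
  - by move=> x _ m n mn; rewrite lee_fin ler_wpM2r ?sqr_ge0//; exact: nd_laplace.
have H2 : isL2 mu (hartley g).
  by apply/isL2P; split=> //; apply: le_lt_trans le _; rewrite ltry.
by split=> //; rewrite -lee_fin -sqnormE.
Qed.

End hartley.

(** * Inversion of the Hartley transform *)

Section smear.
Context {R : realType} {d : nat}.
Notation mu := (leb R d).
Implicit Types (a b : 'I_d -> R) (x y t : Rvec R d).

(* smear is the Poisson smoothing of (2 pi)^d times the indicator of a box.
   Inversion is tested against it rather than against the indicator because it
   is a Hartley transform, and it decays fast enough (smear_le) to be integrated
   against the square-integrable kernels K_b. *)
Definition smear1 (e a b x : R) : R := 2 * atan ((b - x) / e) - 2 * atan ((a - x) / e).

Definition smear e a b x : R := \prod_(i < d) smear1 e (a i) (b i) (tnth x i).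

Lemma indic_box a b x :
  (\1_(box a b) x : R) = \prod_(i < d) \1_(`]a i, b i]%classic : set R) (tnth x i : R).
Proof.
rewrite indicE; case: (boolP (x \in box a b)) => [|/negP xab].
  rewrite inE => xab; rewrite big1// => i _.
  by rewrite indicE mem_set//= in_itv/=; exact: xab.
apply/esym; have [i hi] : exists i, ~~ (a i < (tnth x i : R) <= b i).
  apply/existsP; rewrite -negb_forall; apply/negP => /forallP h.
  by apply: xab; rewrite inE => i; exact: h.
rewrite (bigD1 i)//= indicE memNset ?mul0r//= in_itv/=; exact/negP.
Qed.

Lemma leb_box a b : (forall i, a i <= b i) ->
  (mu (box a b) = (\prod_(i < d) (b i - a i))%:E)%E.
Proof.
move=> ab; transitivity (\int[mu]_x (\1_(box a b) x : R)%:E)%E.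
  by rewrite integral_indic ?setIT//; exact: measurable_box.
under eq_integral do rewrite indic_box.
rewrite (@ge0_integral_prod _ _ (fun i (x : R) => \1_(`]a i, b i]%classic : set R) x))//; last first.
  by move=> i; apply: measurable_indic; exact: measurable_itv.
rewrite -prodEFin; apply: eq_bigr => i _.
rewrite integral_indic//= setIT; apply: etrans; first exact: lebesgue_measure_itv.
rewrite /= lte_fin; case: ltP => // h; have -> : a i = b i by apply/le_anti; rewrite ab h.
by rewrite subrr.
Qed.

Lemma smearE e a b x : 0 < e -> (forall i, a i <= b i) ->
  (\int[mu]_(y in box a b) (poisson e (vsub y x))%:E = (smear e a b x)%:E)%E.
Proof.
move=> e0 ab; rewrite integral_mkcond.
pose F (i : 'I_d) (y : R) := cauchy e (y - tnth x i) * \1_(`]a i, b i]%classic : set R) y.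
have mF i : measurable_fun setT (F i).
  apply: measurable_funM => //; apply: (measurableT_comp (measurable_cauchy e0)).
  exact: measurable_funB.
transitivity (\int[mu]_y (\prod_(i < d) F i (tnth y i))%:E)%E.
  apply: eq_integral => y _; rewrite patchE.
  have -> : \prod_(i < d) F i (tnth y i) = poisson e (vsub y x) * \1_(box a b) y.
    by rewrite big_split/= -indic_box; congr (_ * _); apply: eq_bigr => i _; rewrite tnth_vsub.
  by rewrite indicE; case: ifP; rewrite ?mulr1 ?mulr0.
rewrite ge0_integral_prod//; last by move=> i y; rewrite mulr_ge0// cauchy_ge0.
rewrite -prodEFin; apply: eq_bigr => i _; rewrite -integral_cauchy_itv// [RHS]integral_mkcond.
apply: eq_integral => y _; rewrite patchE /F indicE; case: ifP; by rewrite ?mulr1 ?mulr0.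
Qed.

(** Up to the constant [smear_cst a b], a majorant of all [smear e a b] with [e <= 1], both
    integrable and square-integrable. *)
Definition envelope x : R := \prod_(i < d) (1 + (tnth x i : R) ^+ 2)^-1.

Definition smear_cst a b : R :=
  \prod_(i < d) ((1 + 2 * (a i ^+ 2 + b i ^+ 2)) * (2 * pi) + 4 * (b i - a i)).

Lemma smear1_ge0 (e a b x : R) : 0 < e -> a <= b -> 0 <= smear1 e a b x.
Proof.
move=> e0 ab; rewrite /smear1 subr_ge0 ler_pM2l//.
by apply: le_atan; rewrite ler_pM2r ?invr_gt0// lerD2r.
Qed.

(** Integrate [cauchy_decay] over []a, b]], where [y^2 <= a^2 + b^2]; the total mass of [cauchy]
    gives [2 * pi] and the length of the interval gives [b - a]. *)
Lemma smear1_le (e a b x : R) : 0 < e -> e <= 1 -> a <= b ->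
  smear1 e a b x <= ((1 + 2 * (a ^+ 2 + b ^+ 2)) * (2 * pi) + 4 * (b - a)) * (1 + x ^+ 2)^-1.
Proof.
move=> e0 e1 ab; have x0 : 0 < 1 + x ^+ 2 by rewrite ltr_pwDl// sqr_ge0.
rewrite ler_pdivlMr// -lee_fin EFinM -integral_cauchy_itv//.
set k := 1 + 2 * (a ^+ 2 + b ^+ 2).
have k0 : 0 <= k by rewrite addr_ge0// mulr_ge0// addr_ge0// sqr_ge0.
have mc : measurable_fun setT (fun y : R => cauchy e (y - x)).
  by apply: (measurableT_comp (measurable_cauchy e0)); exact: measurable_funB.
have mc' D : measurable D -> measurable_fun D (fun y : R => (cauchy e (y - x))%:E).
  by move=> mD; apply/measurable_EFinP; exact: measurable_funTS.
rewrite -ge0_integralZr//; last 3 first.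
- exact: mc'.
- by move=> y _; rewrite lee_fin cauchy_ge0.
- by rewrite lee_fin ltW.
apply: (@le_trans _ _ (\int[@lebesgue_measure R]_(y in `]a, b]) ((k%:E * (cauchy e (y - x))%:E) + 4%:E))%E).
  apply: ge0_le_integral => //.
  - by move=> y _; rewrite -EFinM lee_fin mulr_ge0 ?cauchy_ge0// ltW.
  - by apply: emeasurable_funM => //; exact: mc'.
  - apply: emeasurable_funD => //; apply: emeasurable_funM => //; exact: mc'.
  - move=> y; rewrite /= in_itv/= => /andP[ay yb].
    rewrite -!EFinM -EFinD lee_fin; apply: le_trans (cauchy_decay x y e0 e1) _.
    rewrite lerD2r ler_wpM2r ?cauchy_ge0// lerD2l ler_pM2l//.
    have := sqr_ge0 a; have := sqr_ge0 b; case: (leP 0 y) => y0; nra.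
rewrite ge0_integralD//; last 2 first.
- by move=> y _; rewrite -EFinM lee_fin mulr_ge0 ?cauchy_ge0.
- by apply: emeasurable_funM => //; exact: mc'.
rewrite ge0_integralZl//; last 2 first.
- exact: mc'.
- by move=> y _; rewrite lee_fin cauchy_ge0.
rewrite integral_cst//= lebesgue_measure_itv/= lte_fin.
rewrite (EFinD (k * (2 * pi))); apply: leeD.
  rewrite EFinM lee_wpmul2l ?lee_fin//.
  have E : (\int[@lebesgue_measure R]_y (cauchy e (y - x))%:E = (2 * pi)%:E)%E.
    rewrite -(integral_cauchy e0).
    have := @ge0_integral_affine1 R (EFin \o cauchy e) x 1 ltr01.
    rewrite mul1e /= => <-.
    - by apply: eq_integral => y _; rewrite /= divr1 -cauchyN opprB.
    - by apply/measurable_EFinP; exact: measurable_cauchy.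
    - by move=> y; rewrite lee_fin cauchy_ge0.
  rewrite -E; apply: ge0_subset_integral => //.
  - exact: mc'.
  - by move=> y _; rewrite lee_fin cauchy_ge0.
case: ltP => [_|h]; first by rewrite -EFinB -EFinM.
by rewrite mule0 lee_fin mulr_ge0// subr_ge0.
Qed.

Lemma envelope_ge0 x : 0 <= envelope x.
Proof. by apply: prodr_ge0 => i _; rewrite invr_ge0 addr_ge0// sqr_ge0. Qed.

Lemma smear_ge0 e a b x : 0 < e -> (forall i, a i <= b i) -> 0 <= smear e a b x.
Proof. by move=> e0 ab; apply: prodr_ge0 => i _; exact: smear1_ge0. Qed.

Lemma smear_le e a b x : 0 < e -> e <= 1 -> (forall i, a i <= b i) ->
  smear e a b x <= smear_cst a b * envelope x.
Proof.
move=> e0 e1 ab; rewrite -big_split/=; apply: ler_prod => i _.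
by rewrite smear1_ge0//= smear1_le.
Qed.

Lemma measurable_smear1 (e a b : R) : measurable_fun setT (smear1 e a b).
Proof.
have ma c : measurable_fun setT (fun x : R => 2 * atan ((c - x) / e)).
  apply: measurable_funM => //; apply: (measurableT_comp (continuous_measurable_fun (@continuous_atan R))).
  by apply: measurable_funM => //; exact: measurable_funB.
exact: measurable_funB.
Qed.

Lemma measurable_smear e a b : measurable_fun setT (smear e a b).
Proof.
apply: (@measurable_prod_coord _ _ (fun i (x : R) => smear1 e (a i) (b i) x)) => i.
exact: measurable_smear1.
Qed.

Lemma cvg_atan_scale (z : R) : z != 0 ->
  atan (z / k.+1%:R^-1) @[k --> \oo] --> Num.sg z * (pi / 2).
Proof.
have h (y : R) : 0 < y -> atan (y / k.+1%:R^-1) @[k --> \oo] --> pi / 2.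
  move=> y0; apply: (@cvg_comp _ _ _ (fun k : nat => y / k.+1%:R^-1) atan _ (pinfty_nbhs R)).
    have hy : (y * k.+1%:R : R) @[k --> \oo] --> +oo.
      apply/cvgryPge => A; near=> k; rewrite -ler_pdivrMl//.
      apply: (@le_trans _ _ k%:R); last by rewrite ler_nat.
      by near: k; exact: nbhs_infty_ger.
    by under eq_fun do rewrite invrK.
  exact: cvgy_atan.
rewrite neq_lt => /orP[z0|z0]; last by rewrite gtr0_sg// mul1r; exact: h.
rewrite ltr0_sg// mulN1r.
have -> : (fun k : nat => atan (z / k.+1%:R^-1)) = (fun k : nat => - atan (- z / k.+1%:R^-1)).
  by apply/funext => k; rewrite mulNr atanN opprK.
by apply: cvgN; apply: h; rewrite oppr_gt0.
Unshelve. all: by end_near. Qed.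

Lemma cvg_smear1 (a b x : R) : a <= b -> x != a -> x != b ->
  smear1 k.+1%:R^-1 a b x @[k --> \oo] --> 2 * pi * \1_(`]a, b]%classic : set R) x.
Proof.
move=> ab xa xb.
have E : 2 * pi * \1_(`]a, b]%classic : set R) x =
    2 * (Num.sg (b - x) * (pi / 2)) - 2 * (Num.sg (a - x) * (pi / 2)) :> R.
  rewrite indicE; case: (boolP (x \in _)).
    rewrite inE/= in_itv/= => /andP[ax xb'].
    have xb2 : x < b by rewrite lt_neqAle xb.
    by rewrite gtr0_sg ?subr_gt0// ltr0_sg ?subr_lt0//; field.
  move=> /negP h; have {h} : x < a \/ b < x.
    case: (ltP x a) => [|ax]; first by left.
    right; rewrite ltNge; apply/negP => xb'; apply: h.
    by rewrite inE/= in_itv/= xb' andbT lt_neqAle eq_sym xa.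
  case=> h.
    have h2 := lt_le_trans h ab.
    have -> : Num.sg (b - x) = 1 by rewrite gtr0_sg ?subr_gt0.
    have -> : Num.sg (a - x) = 1 by rewrite gtr0_sg ?subr_gt0.
    by rewrite mulr0; ring.
  have h2 := le_lt_trans ab h.
  have -> : Num.sg (b - x) = -1 by rewrite ltr0_sg ?subr_lt0.
  have -> : Num.sg (a - x) = -1 by rewrite ltr0_sg ?subr_lt0.
  by rewrite mulr0; ring.
rewrite E; apply: cvgB; apply: cvgMr; apply: cvg_atan_scale; by rewrite subr_eq0 eq_sym.
Qed.

Lemma cvg_prodR (n : nat) (u : 'I_n -> R^nat) (l : 'I_n -> R) :
  (forall i, u i k @[k --> \oo] --> l i) ->
  \prod_(i < n) u i k @[k --> \oo] --> \prod_(i < n) l i.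
Proof.
elim: n => [|n IH] in u l *; move=> h.
  by rewrite big_ord0; under eq_fun do rewrite big_ord0; exact: cvg_cst.
rewrite big_ord_recl; under eq_fun do rewrite big_ord_recl.
by apply: cvgM; [exact: h|apply: (IH (fun i => u (lift ord0 i)) (fun i => l (lift ord0 i)))].
Qed.

Lemma cvg_smear a b : (forall i, a i <= b i) ->
  {ae mu, forall x, smear k.+1%:R^-1 a b x @[k --> \oo] --> (2 * pi) ^+ d * \1_(box a b) x}.
Proof.
move=> ab.
have ae1 (c : 'I_d -> R) : {ae mu, forall x (i : 'I_d), (tnth x i : R) != c i}.
  have h (i : 'I_d) : {ae mu, forall x, (tnth x i : R) != c i}.
    exists [set t : Rvec R d | (tnth t i : R) = c i]; split.
    - rewrite (_ : [set t | _] = (fun t : Rvec R d => tnth t i) @^-1` [set c i])//.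
      by rewrite -[X in measurable X]setTI; apply: (@measurable_tnth _ _ _ i) => //; exact: measurable_set1.
    - exact: leb_face0.
    - by move=> t /= /negP; rewrite negbK => /eqP.
  (* [ae_foralln] intersects families indexed by [nat], so the family over ['I_d] is extended by
     trivial statements. *)
  have : {ae mu, forall x k, if insub k is Some i then (tnth x (i : 'I_d) : R) != c i else true}.
    apply/ae_foralln => k; case: insubP => [i _ _|_]; first exact: h.
    by apply: nearW.
  by apply: filterS => x hx i; have := hx i; rewrite valK.
apply: filterS2 (ae1 a) (ae1 b) => x xa xb.
rewrite indic_box -{1}(card_ord d) -prodr_const -big_split/=.
by apply: cvg_prodR => i; apply: cvg_smear1.
Qed.

Lemma integrable_cst_box a b (k : R) : (forall i, a i <= b i) ->
  mu.-integrable (box a b) (EFin \o (fun=> k)).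
Proof.
move=> ab; apply: measurable_bounded_integrable => //.
- exact: measurable_box.
- by apply: (eq_ind_r (fun z => (z < +oo)%E) _ (leb_box ab)); exact: ltry.
- exact: bounded_cst.
Qed.

(** Letting [k] tend to infinity in the last hypothesis, dominated convergence on both sides gives
    equal integrals over every box. That hypothesis is the only point where integrable and
    square-integrable [f] are treated differently. *)
Lemma hartley_inversion (f g : Rvec R d -> R) :
  measurable_fun setT f ->
  mu.-integrable setT (EFin \o (fun x => f x * envelope x)) ->
  mu.-integrable setT (EFin \o g) ->
  (forall a b k, (forall i, a i <= b i) ->
    \int[mu]_x (f x * smear k.+1%:R^-1 a b x) =
    \int[mu]_(y in box a b) hartley (fun t => laplace k.+1%:R^-1 t * g t) y) ->
  {ae mu, forall x, (2 * pi) ^+ d * f x = hartley g x}.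
Proof.
move=> mf fe gi H.
pose F a b x := f x * ((2 * pi) ^+ d * \1_(box a b) x).
have mbox a b := @measurable_box R d a b.
have dom a b (ab : forall i, a i <= b i) :
    mu.-integrable setT (EFin \o F a b) /\
    (\int[mu]_x (f x * smear k.+1%:R^-1 a b x)%:E @[k --> \oo] --> \int[mu]_x (F a b x)%:E)%E.
  have [|||||h1 _ h2] := @dominated_convergence _ _ _ mu setT measurableT
    (fun k x => (f x * smear k.+1%:R^-1 a b x)%:E) (EFin \o F a b)
    (EFin \o (fun x => smear_cst a b * `|f x * envelope x|)).
  - by move=> k; apply/measurable_EFinP/measurable_funM => //; exact: measurable_smear.
  - by apply/measurable_EFinP/measurable_funM => //; apply: measurable_funM => //.
  - apply: filterS (cvg_smear ab) => x hx _; apply: cvg_EFin; first exact: nearW.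
    by apply: cvgMr.
  - by apply: integrableMl_cst; exact: integrable_normr.
  - apply: nearW => x k _; rewrite lee_fin normrM (ger0_norm (smear_ge0 _ _ _))//.
    rewrite normrM (ger0_norm (envelope_ge0 x)) mulrCA ler_wpM2l// smear_le//.
    by rewrite invf_le1// ler1n.
  by split.
have Ldom a b (ab : forall i, a i <= b i) :
    mu.-integrable (box a b) (EFin \o hartley g) /\
    (\int[mu]_(y in box a b) (hartley (fun t => laplace k.+1%:R^-1 t * g t) y)%:E @[k --> \oo]
     --> \int[mu]_(y in box a b) (hartley g y)%:E)%E.
  have li k : mu.-integrable setT (EFin \o (fun t => laplace k.+1%:R^-1 t * g t)).
    apply: (@integrable_mulb _ _ _ _ 1) => //; first exact: measurable_laplaceV.
    by move=> t; rewrite gtr0_norm ?laplace_gt0// laplace_le1.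
  have [|||||h1 _ h2] := @dominated_convergence _ _ _ mu (box a b) (mbox a b)
    (fun k x => (hartley (fun t => laplace k.+1%:R^-1 t * g t) x)%:E) (EFin \o hartley g)
    (EFin \o (fun=> 2 * \int[mu]_x `|g x|)).
  - by move=> k; apply/measurable_EFinP/measurable_funTS; exact: measurable_hartley.
  - by apply/measurable_EFinP/measurable_funTS; exact: measurable_hartley.
  - apply: nearW => y _.
    (* Pointwise convergence of the damped transforms is a second dominated convergence, now in the
       frequency. *)
    have [|||||_ _ h] := @dominated_convergence _ _ _ mu setT measurableT
      (fun k t => (cas (dot t y) * (laplace k.+1%:R^-1 t * g t))%:E)
      (EFin \o (fun t => cas (dot t y) * g t)) (EFin \o (fun t => 2 * `|g t|)).
    + move=> k; apply: measurable_int; exact: (integrable_hartley y (li k)).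
    + by apply: measurable_int; exact: (integrable_hartley y gi).
    + apply: nearW => t _; apply: cvg_EFin; first exact: nearW.
      apply: cvgMr; rewrite -[X in _ --> X]mul1r; apply: cvgMl.
      exact: cvg_laplace1.
    + by apply: integrableMl_cst; exact: integrable_normr.
    + apply: nearW => t k _; rewrite lee_fin normrM ler_pM// ?norm_cas//.
      by rewrite normrM ler_piMl// gtr0_norm ?laplace_gt0// laplace_le1.
    move: h; rewrite -Rintegral_EFin; last exact: integrable_hartley.
    by under eq_fun do rewrite -Rintegral_EFin ?integrable_hartley//.
  - exact: integrable_cst_box.
  - apply: nearW => y k _; rewrite lee_fin; apply: le_trans (hartley_bounded y (li k)) _.
    rewrite ler_pM2l//; apply: le_Rintegral => //.
    + exact: integrable_normr.
    + exact: integrable_normr.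
    + by move=> t _; rewrite normrM ler_piMl// gtr0_norm ?laplace_gt0// laplace_le1.
  by split.
have empty a b : ~ (forall i, a i <= b i) -> box a b = set0.
  move=> nab; apply/seteqP; split=> // x xab; apply: nab => i.
  by have /andP[/ltW h1 h2] := xab i; exact: le_trans h2.
have patchF a b : ((fun x => ((2 * pi) ^+ d * f x)%:E) \_ (box a b) = EFin \o F a b)%E.
  apply/funext => x; rewrite patchE /= /F indicE.
  by case: ifP => _; rewrite ?mulr1 ?mulr0// mulrC.
apply: box_integral_unique => a b.
- have [ab|/empty ->] := pselect (forall i, a i <= b i); last exact: integrable_set0.
  by apply/(integrable_mkcond _ (mbox a b)); rewrite patchF; exact: (dom _ _ ab).1.
- have [ab|/empty ->] := pselect (forall i, a i <= b i); last exact: integrable_set0.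
  exact: (Ldom _ _ ab).1.
have [ab|/empty ->] := pselect (forall i, a i <= b i); last by rewrite !integral_set0.
rewrite integral_mkcond patchF.
have h1 := (dom _ _ ab).2; have h2 := (Ldom _ _ ab).2.
apply: (cvg_unique _ h1); first exact: ereal_hausdorff.
apply: cvg_trans h2; apply: near_eq_cvg; apply: nearW => k.
have i1 : mu.-integrable setT (EFin \o (fun x => f x * smear k.+1%:R^-1 a b x)).
  apply: le_integrable (integrableMl_cst (smear_cst a b) (integrable_normr fe)) => //.
    by apply/measurable_EFinP/measurable_funM => //; exact: measurable_smear.
  move=> x _; rewrite lee_fin normrM (ger0_norm (smear_ge0 _ _ _))//.
  apply: le_trans (ler_norm _).
  rewrite normrM (ger0_norm (envelope_ge0 x)) mulrCA ler_wpM2l// smear_le//.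
  by rewrite invf_le1// ler1n.
rewrite -(Rintegral_EFin i1) H//.
rewrite /Rintegral fineK//; apply: integrable_fin_num; first exact: mbox.
have li : mu.-integrable setT (EFin \o (fun t => laplace k.+1%:R^-1 t * g t)).
  apply: (@integrable_mulb _ _ _ _ 1) => //; first exact: measurable_laplaceV.
  by move=> t; rewrite gtr0_norm ?laplace_gt0// laplace_le1.
apply: le_integrable (integrable_cst_box (2 * \int[mu]_x `|laplace k.+1%:R^-1 x * g x|) ab) => //.
  by apply/measurable_EFinP/measurable_funTS; exact: measurable_hartley.
move=> x _; rewrite lee_fin; apply: le_trans (ler_norm _); exact: hartley_bounded.
Qed.

End smear.

Section inversion.
Context {R : realType} {d : nat}.
Notation mu := (leb R d).
Implicit Types (a b : 'I_d -> R) (x y t : Rvec R d).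

Lemma laplaceM_integrable e (g : Rvec R d -> R) : 0 < e -> mu.-integrable setT (EFin \o g) ->
  mu.-integrable setT (EFin \o (fun t => laplace e t * g t)).
Proof.
move=> e0; apply: (@integrable_mulb _ _ _ _ 1); first exact: measurable_laplaceV.
by move=> t; rewrite gtr0_norm ?laplace_gt0// laplace_le1// ltW.
Qed.

Lemma laplaceM_hartley_integrable e (g : Rvec R d -> R) : 0 < e ->
  mu.-integrable setT (EFin \o g) ->
  mu.-integrable setT (EFin \o (fun t => laplace e t * hartley g t)).
Proof.
move=> e0 gi; under eq_fun do rewrite mulrC.
apply: integrable_mulb (integrable_laplaceV d e0); first exact: measurable_hartley.
by move=> t; exact: hartley_bounded.
Qed.

Lemma integrable_indic_box a b : (forall i, a i <= b i) ->
  mu.-integrable setT (EFin \o (\1_(box a b) : Rvec R d -> R)).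
Proof.
move=> ab; have mb : measurable (box a b) by exact: measurable_box.
apply/integrableP; split; first by apply/measurable_EFinP; exact: measurable_indic.
rewrite (eq_integral (fun x => (\1_(box a b) x : R)%:E)); last first.
  by move=> x _; rewrite /= ger0_norm.
rewrite integral_indic// setIT.
by apply: (eq_ind_r (fun z => (z < +oo)%E) _ (leb_box ab)); exact: ltry.
Qed.

(** Integrating [laplace_hartley] over the box and exchanging the integrals moves the smoothing from
    [f] to the indicator. *)
Lemma smear_hartley e a b (f : Rvec R d -> R) : 0 < e -> (forall i, a i <= b i) ->
  mu.-integrable setT (EFin \o f) ->
  \int[mu]_x (f x * smear e a b x) =
  \int[mu]_(y in box a b) hartley (fun t => laplace e t * hartley f t) y.
Proof.
move=> e0 ab fi; rewrite [RHS]Rintegral_mkcond.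
have mb : measurable (box a b) by exact: measurable_box.
have mi : measurable_fun setT (\1_(box a b) : Rvec R d -> R) by exact: measurable_indic.
have ib : mu.-integrable setT (EFin \o (fun y => (2 / e) ^+ d * \1_(box a b) y)).
  by apply: integrableMl_cst; exact: integrable_indic_box.
pose F (z : Rvec R d * Rvec R d) := \1_(box a b) z.1 * (f z.2 * poisson e (vsub z.1 z.2)).
have iF : (mu \x mu)%E.-integrable setT (EFin \o F).
  apply: (integrable_prod_le _ ib fi).
    apply: measurable_funM; first exact: measurableT_comp.
    apply: measurable_funM; first by apply: measurableT_comp => //; exact: integrable_measurable fi.
    by apply: (measurableT_comp (measurable_poisson e0)); exact: measurable_vsub.
  move=> y x; rewrite /F/= !normrM [_ * `|\1__ y|]mulrC -mulrA ler_wpM2l//.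
  rewrite mulrC ler_wpM2r//.
  by apply: le_trans (poisson_bounded _ e0) (ler_norm _).
transitivity (\int[mu]_y \int[mu]_x F (y, x)); last first.
  apply: eq_Rintegral => y _; rewrite patchE.
  transitivity (\1_(box a b) y * \int[mu]_x (f x * poisson e (vsub y x))).
    by rewrite -RintegralZl//; exact: integrable_poissonM.
  rewrite -laplace_hartley// indicE; case: ifP => _; rewrite ?mul0r ?mul1r//.
  by apply: eq_Rintegral => t _; rewrite dotC; ring.
rewrite (RFubini iF); apply: eq_Rintegral => x _.
have ip : mu.-integrable setT (EFin \o (fun y => \1_(box a b) y * poisson e (vsub y x))).
  under eq_fun do rewrite mulrC.
  apply: (@integrable_mulb _ _ _ _ ((2 / e) ^+ d)).
  - by apply: (measurableT_comp (measurable_poisson e0)); apply: measurable_vsub => //; exact: measurable_cst.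
  - by move=> y; exact: poisson_bounded.
  - exact: integrable_indic_box.
transitivity (f x * \int[mu]_y (\1_(box a b) y * poisson e (vsub y x))); last first.
  by rewrite -RintegralZl//; apply: eq_Rintegral => y _; rewrite /F/=; ring.
congr (_ * _); apply: EFin_inj; rewrite Rintegral_EFin// -smearE// [LHS]integral_mkcond.
apply: eq_integral => y _; rewrite patchE indicE.
by case: ifP; rewrite ?mul1r ?mul0r.
Qed.

Lemma envelopeE x : envelope x = 2^-1 ^+ d * poisson 1 x.
Proof.
have -> : 2^-1 ^+ d = \prod_(i < d) 2^-1 :> R by rewrite prodr_const card_ord.
rewrite -big_split/=; apply: eq_bigr => i _.
by rewrite /cauchy expr1n mulr1 mulrA mulVf// mul1r.
Qed.

Lemma integrable_poisson e : 0 < e -> mu.-integrable setT (EFin \o @poisson R d e).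
Proof.
move=> e0; apply/integrableP; split; first by apply/measurable_EFinP; exact: measurable_poisson.
rewrite (eq_integral (fun u => (poisson e u)%:E)); last first.
  by move=> u _; rewrite /= ger0_norm// poisson_ge0.
by rewrite integral_poisson// ltry.
Qed.

Lemma integrable_envelope : mu.-integrable setT (EFin \o @envelope R d).
Proof.
have := integrableMl_cst (2^-1 ^+ d) (integrable_poisson ltr01).
by apply: eq_integrable => // x _ /=; rewrite envelopeE.
Qed.

Lemma measurable_envelope : measurable_fun setT (@envelope R d).
Proof. exact: integrable_measurable integrable_envelope. Qed.

Lemma envelope_le1 x : envelope x <= 1.
Proof.
apply: prodr_ile1 => i _; rewrite invr_ge0 addr_ge0 ?sqr_ge0//=.
by rewrite invf_le1 ?ltr_pwDl ?sqr_ge0// lerDl sqr_ge0.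
Qed.

Lemma isL2_bounded_integrable (g : Rvec R d -> R) (C : R) :
  mu.-integrable setT (EFin \o g) -> (forall x, `|g x| <= C) -> isL2 mu g.
Proof.
move=> gi gC; have mg := integrable_measurable gi; split=> //.
have := integrable_mulb mg gC gi.
by apply: eq_integrable => // x _ /=; rewrite expr2.
Qed.

Lemma isL2_envelope : isL2 mu envelope.
Proof.
apply: (isL2_bounded_integrable (C := 1) integrable_envelope) => x.
by rewrite ger0_norm ?envelope_ge0// envelope_le1.
Qed.

Lemma isL2_smear e a b : 0 < e -> e <= 1 -> (forall i, a i <= b i) -> isL2 mu (smear e a b).
Proof.
move=> e0 e1 ab; apply: (isL2_le _ (isL2Z (smear_cst a b) isL2_envelope)).
  exact: measurable_smear.
move=> x; rewrite ger0_norm ?smear_ge0//; apply: le_trans (ler_norm _).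
exact: smear_le.
Qed.

Lemma hartley_inversion_L1 (f : Rvec R d -> R) :
  mu.-integrable setT (EFin \o f) -> mu.-integrable setT (EFin \o hartley f) ->
  {ae mu, forall x, (2 * pi) ^+ d * f x = hartley (hartley f) x}.
Proof.
move=> fi Hi; apply: hartley_inversion => //.
- exact: integrable_measurable fi.
- under eq_fun do rewrite mulrC.
  apply: (@integrable_mulb _ _ _ _ 1) fi; first exact: measurable_envelope.
  by move=> x; rewrite ger0_norm ?envelope_ge0// envelope_le1.
- by move=> a b k ab; apply: smear_hartley => //.
Qed.

Lemma isL2_indic_box a b : (forall i, a i <= b i) -> isL2 mu (\1_(box a b) : Rvec R d -> R).
Proof.
move=> ab; apply: (@isL2_bounded_integrable _ 1).
  exact: integrable_indic_box.
by move=> x; rewrite indicE; case: (_ \in _); rewrite ?normr1 ?normr0.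
Qed.

Lemma hartleyB (f g : Rvec R d -> R) t : mu.-integrable setT (EFin \o f) ->
  mu.-integrable setT (EFin \o g) ->
  hartley (fun x => f x - g x) t = hartley f t - hartley g t.
Proof.
move=> fi gi; rewrite /hartley -RintegralB//; try exact: integrable_hartley.
by apply: eq_Rintegral => x _; rewrite mulrBr.
Qed.

Lemma sqnorm_le (f g : Rvec R d -> R) : isL2 mu f -> isL2 mu g ->
  (forall x, `|f x| <= `|g x|) -> sqnorm mu f <= sqnorm mu g.
Proof.
move=> [mf fi] [mg gi] fg; apply: le_Rintegral => // x _.
by rewrite -(real_normK (num_real (f x))) -(real_normK (num_real (g x))) lerXn2r ?nnegrE.
Qed.

(** Uniqueness of the limit of [Ak], phrased with squares because these are what Cauchy-Schwarz
    bounds. *)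
Lemma cvg0_le_eq (A B C1 C2 : R) (Ak s s' : R^nat) :
  (forall k, (Ak k - A) ^+ 2 <= C1 * s k) -> (forall k, (Ak k - B) ^+ 2 <= C2 * s' k) ->
  s k @[k --> \oo] --> 0 -> s' k @[k --> \oo] --> 0 -> A = B.
Proof.
move=> h1 h2 s0 s'0; apply/eqP; rewrite -subr_eq0 -sqrf_eq0 -(rwP eqP).
apply/le_anti; rewrite sqr_ge0 andbT.
have h : 2 * (C1 * s k) + 2 * (C2 * s' k) @[k --> \oo] --> 2 * (C1 * 0) + 2 * (C2 * 0).
  by apply: cvgD; apply: cvgMr; apply: cvgMr.
rewrite !mulr0 addr0 in h; rewrite -(cvg_lim _ h)//; apply: limr_ge.
  by apply/cvg_ex; exists 0.
apply: nearW => k.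
have -> : A - B = (Ak k - B) - (Ak k - A) by ring.
have := h1 k; have := h2 k; have := sqr_ge0 ((Ak k - B) + (Ak k - A)).
move: (Ak k - B) (Ak k - A) => u v; rewrite !expr2; nra.
Qed.

(** [smear_hartley] holds for each [r k]. Its left side is continuous in L2 because [smear] is
    square-integrable, its right side because the indicator of the box is and [hartley_L2] bounds
    the transform. In the limit it becomes the identity for [K] and [w] that [hartley_inversion]
    asks for. *)
Lemma hartley_inversion_L2 (K w : Rvec R d -> R) (r : nat -> Rvec R d -> R) :
  isL2 mu K -> isL2 mu w -> mu.-integrable setT (EFin \o w) ->
  (forall k, mu.-integrable setT (EFin \o r k)) -> (forall k, isL2 mu (r k)) ->
  sqnorm mu (fun x => r k x - K x) @[k --> \oo] --> 0 ->
  sqnorm mu (fun t => hartley (r k) t - w t) @[k --> \oo] --> 0 ->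
  {ae mu, forall x, (2 * pi) ^+ d * K x = hartley w x}.
Proof.
move=> K2 w2 wi ri r2 rK rw; apply: hartley_inversion => //.
- by case: K2.
- by apply: isL2M K2 isL2_envelope.
move=> a b j ab; set e := j.+1%:R^-1.
have e0 : 0 < e by rewrite invr_gt0.
have e1 : e <= 1 by rewrite invf_le1// ler1n.
have s2 := isL2_smear e0 e1 ab.
have b2 := isL2_indic_box ab.
have Hr2 k := (hartley_L2 (ri k) (r2 k)).1.
have lw : mu.-integrable setT (EFin \o (fun t => laplace e t * w t)) by exact: laplaceM_integrable.
have lr k := laplaceM_hartley_integrable e0 (ri k).
have l2 (g : Rvec R d -> R) : isL2 mu g -> isL2 mu (fun t => laplace e t * g t).
  move=> g2; apply: (isL2_le _ g2); first by apply: measurable_funM; [exact: measurable_laplaceV|case: g2].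
  by move=> t; rewrite normrM ler_piMl// gtr0_norm ?laplace_gt0// laplace_le1// ltW.
have boxE (g : Rvec R d -> R) : \int[mu]_(y in box a b) g y = \int[mu]_y (\1_(box a b) y * g y).
  rewrite Rintegral_mkcond; apply: eq_Rintegral => y _; rewrite patchE indicE.
  by case: ifP; rewrite ?mul1r ?mul0r.
apply: (cvg0_le_eq (Ak := fun k => \int[mu]_x (r k x * smear e a b x))
  (C1 := sqnorm mu (smear e a b)) (C2 := sqnorm mu (\1_(box a b) : Rvec R d -> R) * (2 * pi) ^+ d) _ _ rK rw) => k.
  have -> : \int[mu]_x (r k x * smear e a b x) - \int[mu]_x (K x * smear e a b x) =
     \int[mu]_x (smear e a b x * (r k x - K x)).
    rewrite -RintegralB//; [|exact: isL2M|exact: isL2M].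
    by apply: eq_Rintegral => x _; ring.
  by apply: cauchy_schwarz => //; exact: isL2B.
rewrite smear_hartley// !boxE.
have H1 := hartley_L2 (lr k) (l2 _ (Hr2 k)).
have H2 := hartley_L2 lw (l2 _ w2).
have di : mu.-integrable setT (EFin \o (fun t => laplace e t * hartley (r k) t - laplace e t * w t)).
  exact: integrableBr.
have d2 : isL2 mu (fun t => laplace e t * hartley (r k) t - laplace e t * w t).
  by apply: isL2B; apply: l2.
have H3 := hartley_L2 di d2.
rewrite -RintegralB//; [|exact: isL2M b2 H1.1|exact: isL2M b2 H2.1].
have -> : \int[mu]_x (\1_(box a b) x * hartley (fun t => laplace e t * hartley (r k) t) x -
     \1_(box a b) x * hartley (fun t => laplace e t * w t) x) =
   \int[mu]_x (\1_(box a b) x * hartley (fun t => laplace e t * hartley (r k) t - laplace e t * w t) x).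
  by apply: eq_Rintegral => x _; rewrite hartleyB// mulrBr.
apply: le_trans (cauchy_schwarz b2 H3.1) _.
rewrite -mulrA ler_wpM2l ?sqnorm_ge0//; apply: le_trans H3.2 _.
rewrite ler_wpM2l ?exprn_ge0 ?mulr_ge0 ?pi_ge0//.
apply: sqnorm_le => //; first exact: isL2B.
move=> t; rewrite -mulrBr normrM ler_piMl// gtr0_norm ?laplace_gt0//.
by apply: laplace_le1; exact: ltW.
Qed.

End inversion.

(** * Pinsker kernels *)

Section fourier_to_hartley.
Context {R : realType} {d : nat}.
Notation mu := (leb R d).
Implicit Types (x y t : Rvec R d).

Let CosT (f : Rvec R d -> R) t := \int[mu]_x (cos (dot x t) * f x).
Let SinT (f : Rvec R d -> R) t := \int[mu]_x (sin (dot x t) * f x).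

Let integrable_cosT f t : mu.-integrable setT (EFin \o f) ->
  mu.-integrable setT (EFin \o (fun x => cos (dot x t) * f x)).
Proof.
apply: (@integrable_mulb _ _ _ _ 1); last by move=> x; exact: (sincos_bounded _).1.
by apply: measurable_cos_dot => //; exact: measurable_cst.
Qed.

Let integrable_sinT f t : mu.-integrable setT (EFin \o f) ->
  mu.-integrable setT (EFin \o (fun x => sin (dot x t) * f x)).
Proof.
apply: (@integrable_mulb _ _ _ _ 1); last by move=> x; exact: (sincos_bounded _).2.
by apply: measurable_sin_dot => //; exact: measurable_cst.
Qed.

Let hartleyE f t : mu.-integrable setT (EFin \o f) -> hartley f t = CosT f t + SinT f t.
Proof.
move=> fi; rewrite /CosT /SinT -RintegralD//; [|exact: integrable_cosT|exact: integrable_sinT].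
by apply: eq_Rintegral => x _; rewrite /cas mulrDl.
Qed.

Let CosT_vneg f t : CosT f (vneg t) = CosT f t.
Proof. by apply: eq_Rintegral => x _; rewrite dotC dot_vneg cosN dotC. Qed.

Let SinT_vneg f t : mu.-integrable setT (EFin \o f) -> SinT f (vneg t) = - SinT f t.
Proof.
move=> fi; rewrite -mulN1r /SinT -RintegralZl//; last exact: integrable_sinT.
by apply: eq_Rintegral => x _; rewrite dotC dot_vneg sinN dotC mulN1r mulNr.
Qed.

Let CosT_hartley f t : mu.-integrable setT (EFin \o f) ->
  CosT f t = 2^-1 * (hartley f t + hartley f (vneg t)).
Proof. by move=> fi; rewrite !hartleyE// CosT_vneg SinT_vneg//; field. Qed.

Let SinT_hartley f t : mu.-integrable setT (EFin \o f) ->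
  SinT f t = 2^-1 * (hartley f t - hartley f (vneg t)).
Proof. by move=> fi; rewrite !hartleyE// CosT_vneg SinT_vneg//; field. Qed.

Notation cRe := (@complex.Re R).
Notation cIm := (@complex.Im R).

(** The even part of a Hartley transform is the cosine transform and its odd part the sine
    transform. *)
Lemma fourierE (f : Rvec R d -> R[i]) t :
  mu.-integrable setT (EFin \o (cRe \o f)) ->
  mu.-integrable setT (EFin \o (cIm \o f)) ->
  let r := cRe \o f in let s := cIm \o f in
  cRe (fourier f t) = 2^-1 * (hartley r t + hartley r (vneg t) - (hartley s t - hartley s (vneg t)))
  /\ cIm (fourier f t) = 2^-1 * (hartley s t + hartley s (vneg t) + (hartley r t - hartley r (vneg t))).
Proof.
move=> ri si r s.
have -> : 2^-1 * (hartley r t + hartley r (vneg t) - (hartley s t - hartley s (vneg t))) = CosT r t - SinT s t.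
  by rewrite CosT_hartley// SinT_hartley//; ring.
have -> : 2^-1 * (hartley s t + hartley s (vneg t) + (hartley r t - hartley r (vneg t))) = CosT s t + SinT r t.
  by rewrite CosT_hartley// SinT_hartley//; ring.
split.
  rewrite /CosT /SinT -RintegralB//; [|exact: integrable_cosT|exact: integrable_sinT].
  by apply: eq_Rintegral => x _; rewrite /r /s/=; case: (f x).
rewrite /CosT /SinT -RintegralD//; [|exact: integrable_cosT|exact: integrable_sinT].
by apply: eq_Rintegral => x _; rewrite /r /s/=; case: (f x).
Qed.

Lemma sqr_normc_E (z : R[i]) : Normc.normc z ^+ 2 = cRe z ^+ 2 + cIm z ^+ 2.
Proof. by case: z => a b; rewrite /Normc.normc sqr_sqrtr// addr_ge0// sqr_ge0. Qed.

Lemma cdist_sqr (f g : Rvec R d -> R[i]) :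
  (cdist f g ^+ 2 = \int[mu]_x (cRe (f x - g x) ^+ 2 + cIm (f x - g x) ^+ 2)%:E)%E.
Proof.
have h := @poweR_Lnorm _ _ _ mu (EFin \o (fun x => Normc.normc (f x - g x))) 2 (ltac:(by rewrite pnatr_eq0)).
rewrite /cdist /L2norm -sqr_poweR; last exact: Lnorm_ge0.
rewrite h; apply: eq_integral => x _ /=.
by rewrite powR_mulrn// real_normK ?num_real// sqr_normc_E.
Qed.

Lemma sqnorm_cvg0 (f : nat -> Rvec R d -> R) (c : R) (u : nat -> \bar R) :
  (forall k, isL2 mu (f k)) -> (forall k, (sqnorm mu (f k))%:E <= c%:E * u k ^+ 2)%E ->
  u k @[k --> \oo] --> 0%E -> sqnorm mu (f k) @[k --> \oo] --> 0.
Proof.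
move=> f2 fu /fine_cvgP[ufin u0].
have h : c * fine (u k) ^+ 2 @[k --> \oo] --> 0.
  have : c * (fine (u k) * fine (u k)) @[k --> \oo] --> c * (0 * 0).
    by apply: cvgMr; apply: cvgM.
  by rewrite !mulr0; under eq_fun do rewrite -expr2.
apply: (squeeze_cvgr _ (cvg_cst 0) h); apply: filterS ufin => k uk.
rewrite sqnorm_ge0/= -lee_fin EFinM; apply: le_trans (fu k) _.
by rewrite -{1}(fineK uk) -EFin_expe.
Qed.

(** As [w] is real and even, the Hartley transforms of the real parts of the approximating [u k]
    also converge to [w] in L2, and [hartley_inversion_L2] applies. *)
Lemma L2fourier_hartley (K w : Rvec R d -> R) :
  is_L2fourier (fun x => (K x)%:C%C) (fun t => (w t)%:C%C) ->
  mu.-integrable setT (EFin \o w) -> (forall t, w (vneg t) = w t) ->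
  isL2 mu K /\ {ae mu, forall x, (2 * pi) ^+ d * K x = hartley w x}.
Proof.
move=> [[K2 _] [w2 _] [u [uL uK uw]]] wi wN.
have {}K2 := Lfun2_isL2 K2; have {}w2 := Lfun2_isL2 w2.
split=> //; pose r k := cRe \o u k; pose s k := cIm \o u k.
have ri k : mu.-integrable setT (EFin \o r k) by apply: Lfun1_int; have [[]] := uL k.
have si k : mu.-integrable setT (EFin \o s k) by apply: Lfun1_int; have [[]] := uL k.
have r2 k : isL2 mu (r k) by apply: Lfun2_isL2; have [_ []] := uL k.
have s2 k : isL2 mu (s k) by apply: Lfun2_isL2; have [_ []] := uL k.
have Hr2 k := (hartley_L2 (ri k) (r2 k)).1.
have Hs2 k := (hartley_L2 (si k) (s2 k)).1.
have mr k := measurable_hartley (ri k).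
have ms k := measurable_hartley (si k).
have mrn k : measurable_fun setT (fun t => hartley (r k) (vneg t)) by apply: measurable_hartley_comp => //; exact: measurable_vneg.
have msn k : measurable_fun setT (fun t => hartley (s k) (vneg t)) by apply: measurable_hartley_comp => //; exact: measurable_vneg.
apply: (hartley_inversion_L2 (r := r)) => //.
  apply: (sqnorm_cvg0 (c := 1) _ _ uK) => [k|k]; first exact: isL2B.
  rewrite mul1e cdist_sqr -sqnormE; last exact: isL2B.
  apply: ge0_le_integralT => x; rewrite lee_fin ?sqr_ge0//.
  by rewrite /r/=; case: (u k x) => p q /=; rewrite lerDl sqr_ge0.
apply: (sqnorm_cvg0 (c := 2) _ _ uw) => [k|k]; first exact: isL2B.
rewrite -sqnormE; last exact: isL2B.
rewrite cdist_sqr.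
pose N t := cRe (fourier (u k) t - (w t)%:C%C) ^+ 2 + cIm (fourier (u k) t - (w t)%:C%C) ^+ 2.
have NE t : N t = (2^-1 * (hartley (r k) t + hartley (r k) (vneg t) - (hartley (s k) t - hartley (s k) (vneg t))) - w t) ^+ 2
   + (2^-1 * (hartley (s k) t + hartley (s k) (vneg t) + (hartley (r k) t - hartley (r k) (vneg t)))) ^+ 2.
  have [h1 h2] := fourierE t (ri k) (si k).
  by rewrite /N; move: h1 h2; case: (fourier (u k) t) => p q /= -> ->; rewrite subr0.
have N0 t : 0 <= N t by rewrite addr_ge0 ?sqr_ge0.
have mw : measurable_fun setT w by case: w2.
have mN : measurable_fun setT N.
  rewrite (_ : N = fun t => (2^-1 * (hartley (r k) t + hartley (r k) (vneg t) - (hartley (s k) t - hartley (s k) (vneg t))) - w t) ^+ 2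
   + (2^-1 * (hartley (s k) t + hartley (s k) (vneg t) + (hartley (r k) t - hartley (r k) (vneg t)))) ^+ 2); last exact/funext.
  apply: measurable_funD; apply: measurable_funX.
    apply: measurable_funB => //; apply: measurable_funM => //; apply: measurable_funB.
      exact: measurable_funD.
    exact: measurable_funB.
  apply: measurable_funM => //; apply: measurable_funD.
    exact: measurable_funD.
  exact: measurable_funB.
have mNE : measurable_fun setT (EFin \o N) by exact/measurable_EFinP.
(* The Hartley transform at [t] involves the Fourier transform at both [t] and [- t]; the two errors
   have the same integral, whence the factor 2. *)
apply: (@le_trans _ _ (\int[mu]_t ((N t)%:E + (N (vneg t))%:E))%E); last first.
  rewrite ge0_integralD//.
  - by rewrite (@ge0_integral_vneg _ _ (EFin \o N))// mule_natl mule2n.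
  - by move=> t _; rewrite lee_fin.
  - by move=> t _; rewrite lee_fin.
  - exact: (measurableT_comp mNE (@measurable_vneg _ _)).
apply: ge0_le_integralT => t; first by rewrite lee_fin sqr_ge0.
rewrite -EFinD lee_fin !NE vnegK wN.
move: (hartley (r k) t) (hartley (r k) (vneg t)) (hartley (s k) t) (hartley (s k) (vneg t)) (w t) => A B C D W.
set p := 2^-1 * (A + B - (C - D)) - W.
set q := 2^-1 * (C + D + (A - B)).
set p' := 2^-1 * (B + A - (D - C)) - W.
set q' := 2^-1 * (D + C + (B - A)).
(* The square of a half sum of four terms is at most the sum of their squares. *)
have -> : A - W = 2^-1 * (p + p' + q - q') by rewrite /p /p' /q /q'; field.
move: p q p' q' => p q p' q'.
have := sqr_ge0 (p - p'); have := sqr_ge0 (q + q'); have := sqr_ge0 (p - q); have := sqr_ge0 (p + q').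
have := sqr_ge0 (p' - q); have := sqr_ge0 (p' + q').
rewrite !expr2; nra.
Qed.

End fourier_to_hartley.

Section pinsker.
Context {R : realType} {d : nat}.
Notation mu := (leb R d).

Definition pinsker (b : R) (t : Rvec R d) : R := Num.max (1 - enorm t `^ b) 0.

Lemma pinsker_ge0 b t : 0 <= pinsker b t.
Proof. by rewrite le_max lexx orbT. Qed.

Lemma pinsker_le1 b t : pinsker b t <= 1.
Proof. by rewrite ge_max ler01 andbT lerBlDr lerDl powR_ge0. Qed.

Lemma measurable_pinsker b : measurable_fun setT (pinsker b).
Proof.
apply: measurable_maxr => //; apply: measurable_funB => //.
by apply: (measurableT_comp (measurable_powR b)); exact: measurable_enorm.
Qed.

Lemma enorm_coord (t : Rvec R d) i : `|(tnth t i : R)| <= enorm t.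
Proof.
rewrite -sqrtr_sqr ler_wsqrtr// (bigD1 i)//= lerDl.
by apply: sumr_ge0 => j _; exact: sqr_ge0.
Qed.

Lemma pinsker_support b t : 0 < b -> pinsker b t != 0 -> enorm t < 1.
Proof.
move=> b0; apply: contraNT; rewrite -leNgt => t1.
apply/eqP/max_idPr; rewrite subr_le0.
have h : (1 : R) `^ b <= enorm t `^ b.
  by apply: ge0_ler_powR; rewrite ?nnegrE ?enorm_ge0// ltW.
by rewrite powR1 in h.
Qed.

Lemma integrable_pinsker b : 0 < b -> mu.-integrable setT (EFin \o pinsker b).
Proof.
move=> b0; pose a : 'I_d -> R := fun=> -1; pose c : 'I_d -> R := fun=> 1.
have ac i : a i <= c i by rewrite /a /c; lra.
apply: le_integrable (integrable_indic_box ac) => //.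
  by apply/measurable_EFinP; exact: measurable_pinsker.
move=> t _; rewrite lee_fin ger0_norm ?pinsker_ge0//.
have [->//|/(pinsker_support b0) t1] := eqVneq (pinsker b t) 0.
rewrite indicE mem_set ?normr1 ?pinsker_le1// => i.
have := le_lt_trans (enorm_coord t i) t1; rewrite ltr_norml /a /c => /andP[-> h].
exact: ltW.
Qed.

Lemma isL2_pinsker b : 0 < b -> isL2 mu (pinsker b).
Proof.
move=> b0; apply: (isL2_bounded_integrable (C := 1)); first exact: integrable_pinsker.
by move=> t; rewrite ger0_norm ?pinsker_ge0 ?pinsker_le1.
Qed.

Lemma pinsker_vneg b t : pinsker b (vneg t) = pinsker b t.
Proof. by rewrite /pinsker enorm_vneg. Qed.

(** Later arguments reach a Pinsker kernel through these two facts. The formula holds almost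
    everywhere, so the value of [K] at a given point stays arbitrary. *)
Lemma pinsker_kernelE b (K : Rvec R d -> R) : 0 < b -> is_pinsker_kernel b K ->
  isL2 mu K /\ {ae mu, forall x, (2 * pi) ^+ d * K x = hartley (pinsker b) x}.
Proof.
move=> b0 hK.
exact: (L2fourier_hartley hK (integrable_pinsker b0) (pinsker_vneg b)).
Qed.

End pinsker.

(** * Radial integrals *)

Section ftc_pos.
Context {R : realType}.
Notation mu := (@lebesgue_measure R).
Implicit Types f F : R -> R.

Lemma powR_continuous_pos (a x : R) : 0 < x -> {for x, continuous (fun z : R => z `^ a)}.
Proof.
move=> x0; apply/differentiable_continuous/derivable1_diffP.
by have := is_derive1_powR a x0 => ?; exact: ex_derive.
Qed.

Lemma FTC_itv_pos f F (a b : R) : 0 < a -> a <= b ->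
  (forall x : R, 0 < x -> is_derive x (1 : R) F (f x)) ->
  (forall x : R, 0 < x -> {for x, continuous f}) ->
  (\int[mu]_(x in `[a, b]) (f x)%:E = (F b - F a)%:E)%E.
Proof.
move=> a0 + dF cf; rewrite le_eqVlt => /predU1P[->|ab].
  by rewrite subrr set_itv1 integral_set1.
have cF (x : R) : 0 < x -> {for x, continuous F}.
  move=> x0; apply/differentiable_continuous/derivable1_diffP.
  by have := dF _ x0 => ?; exact: ex_derive.
have xpos (x : R) : x \in `]a, b[ -> 0 < x by rewrite in_itv/= => /andP[ax _]; exact: lt_trans ax.
rewrite (@continuous_FTC2 _ f F a b)//.
- apply: continuous_in_subspaceT => x; rewrite inE/= in_itv/= => /andP[ax _].
  by apply: cf; exact: lt_le_trans ax.
- split.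
  + by move=> x xab; have := dF _ (xpos _ xab) => ?; exact: ex_derive.
  + by apply/cvg_at_right_filter/cF.
  + by apply/cvg_at_left_filter/cF; exact: lt_trans ab.
- by move=> x xab; rewrite derive1E; have := dF _ (xpos _ xab) => ?; rewrite derive_val.
Qed.

(** Real powers are differentiable away from 0 only: integrate over [[b / (k + 1), b]] and let [k]
    grow. *)
Lemma FTC_0_pos f F (b l : R) : 0 < b ->
  (forall x : R, 0 < x -> is_derive x (1 : R) F (f x)) ->
  (forall x : R, 0 < x -> {for x, continuous f}) ->
  (forall x : R, 0 < x <= b -> 0 <= f x) ->
  F x @[x --> 0^'+] --> l ->
  (\int[mu]_(x in `]0%R, b]) (f x)%:E = (F b - l)%:E)%E.
Proof.
move=> b0 dF cf f0 Fl.
pose S (k : nat) : set R := `[b * k.+1%:R^-1, b]%classic.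
have bk (k : nat) : 0 < b * k.+1%:R^-1 by rewrite mulr_gt0 ?invr_gt0.
have bkb (k : nat) : b * k.+1%:R^-1 <= b by rewrite ler_piMr ?(ltW b0)// invf_le1// ler1n.
have SE : \bigcup_k S k = `]0%R, b]%classic.
  apply/seteqP; split => x /=.
    move=> [k _]; rewrite /S/= !in_itv/= => /andP[h ->]; rewrite andbT.
    exact: lt_le_trans h.
  rewrite in_itv/= => /andP[x0 xb].
  exists (Num.truncn (b / x)) => //; rewrite /S/= in_itv/= xb andbT.
  rewrite ler_pdivrMr// mulrC -ler_pdivrMr//.
  exact/ltW/truncnS_gt.
have h1 : (\int[mu]_(x in S k) (f x)%:E @[k --> \oo] --> \int[mu]_(x in \bigcup_k S k) (f x)%:E)%E.
  apply: ge0_nondecreasing_set_cvg_integral.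
  - move=> m n mn; apply/subsetPset => x; rewrite /S/= !in_itv/= => /andP[h ->].
    rewrite andbT; apply: le_trans h; rewrite ler_pM2l//.
    by rewrite lef_pV2 ?posrE// ler_nat ltnS.
  - by move=> k; exact: measurable_itv.
  - move=> k; apply/measurable_EFinP; apply: (@subspace_continuous_measurable_fun _ _ _ (measurable_itv _)).
    apply: continuous_in_subspaceT => x; rewrite inE /S/= in_itv/= => /andP[h _].
    by apply: cf; exact: lt_le_trans h.
  - move=> k x; rewrite /S/= in_itv/= => /andP[h xb]; rewrite lee_fin f0// xb andbT.
    exact: lt_le_trans h.
rewrite SE in h1; apply: (cvg_unique _ h1); first exact: ereal_hausdorff.
have h2 : (F b - F (b * k.+1%:R^-1))%:E @[k --> \oo] --> (F b - l)%:E; last first.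
  apply: cvg_trans h2; apply: near_eq_cvg; apply: nearW => k.
  by rewrite /= -(FTC_itv_pos (bk k) (bkb k) dF cf).
apply: cvg_EFin; first exact: nearW.
apply: cvgB; first exact: cvg_cst.
move: Fl => /cvg_at_rightP; apply; split => // .
rewrite -(mulr0 b); apply: cvgMr; exact: cvg_harmonic.
Qed.

Lemma FTCy_pos f F (a l : R) : 0 < a ->
  (forall x : R, 0 < x -> is_derive x (1 : R) F (f x)) ->
  (forall x : R, 0 < x -> {for x, continuous f}) ->
  (forall x : R, a <= x -> 0 <= f x) ->
  F x @[x --> +oo] --> l ->
  (\int[mu]_(x in `[a, +oo[) (f x)%:E = (l - F a)%:E)%E.
Proof.
move=> a0 dF cf f0 Fl.
have cF (x : R) : 0 < x -> {for x, continuous F}.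
  move=> x0; apply/differentiable_continuous/derivable1_diffP.
  by have := dF _ x0 => ?; exact: ex_derive.
rewrite (@ge0_continuous_FTC2y _ f F a l)//.
- apply: continuous_in_subspaceT => x; rewrite inE/= in_itv/= andbT => ax.
  by apply: cf; exact: lt_le_trans ax.
- by move=> x ax; have := dF _ (lt_trans a0 ax) => ?; exact: ex_derive.
- by apply/cvg_at_right_filter/cF.
- move=> x; rewrite in_itv/= andbT => ax.
  by rewrite derive1E; have := dF _ (lt_trans a0 ax) => ?; rewrite derive_val.
Qed.

Lemma powR_split (a b x : R) : 0 < x -> x `^ (a + b) = x `^ a * x `^ b.
Proof. by move=> x0; rewrite powRD// (gt_eqF x0) implybT. Qed.

Lemma integral_powR0 (a u : R) : 0 < a -> 0 < u ->
  (\int[mu]_(s in `]0%R, u]) (a * s `^ (a - 1))%:E = (u `^ a)%:E)%E.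
Proof.
move=> a0 u0; apply: etrans; first apply: (@FTC_0_pos (fun s => a * s `^ (a - 1)) (fun z : R => z `^ a) u 0).
- exact: u0.
- by move=> x x0; apply: cvgMr; exact: powR_continuous_pos.
- by move=> x _; rewrite mulr_ge0 ?powR_ge0// ltW.
- exact: powR_cvg0.
by rewrite subr0.
Qed.

Lemma integral_onem_powR (c : R) : 0 < c ->
  (\int[mu]_(s in `]0%R, 1%R]) (2 * (1 - s) * s `^ c)%:E = (2 * ((c + 1)^-1 - (c + 2)^-1))%:E)%E.
Proof.
move=> c0.
have c1 : c + 1 != 0 by rewrite gt_eqF// addr_gt0.
have c2 : c + 2 != 0 by rewrite gt_eqF// addr_gt0.
pose F (s : R) := 2 * ((c + 1)^-1 * s `^ (c + 1) - (c + 2)^-1 * s `^ (c + 2)).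
apply: etrans; first apply: (@FTC_0_pos (fun s => 2 * (1 - s) * s `^ c) F 1 0).
- exact: ltr01.
- move=> x x0; have d1 := is_derive1_powR (c + 1) x0; have d2 := is_derive1_powR (c + 2) x0.
  rewrite /F; apply: is_derive_eq; rewrite /GRing.scale/=.
  have -> : c + 1 - 1 = c by ring.
  have -> : c + 2 - 1 = c + 1 by ring.
  rewrite (powR_split c 1 x0) powRr1 ?ltW//; field.
  by rewrite c1 c2.
- move=> x x0; apply: cvgM; last exact: powR_continuous_pos.
  by apply: cvgMr; apply: cvgB; [exact: cvg_cst|exact: cvg_id].
- by move=> x /andP[x0 x1]; rewrite !mulr_ge0 ?powR_ge0// subr_ge0.
- have h : 2 * ((c + 1)^-1 * x `^ (c + 1) - (c + 2)^-1 * x `^ (c + 2)) @[x --> (0:R)^'+] -->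
     2 * ((c + 1)^-1 * 0 - (c + 2)^-1 * 0).
    by apply: cvgMr; apply: cvgB; apply: cvgMr; apply: powR_cvg0; rewrite addr_gt0.
  by move: h; rewrite !mulr0 subr0 mulr0.
by rewrite /F !powR1 !mulr1 subr0.
Qed.

Lemma powRN_cvgy (p : R) : 0 < p -> x `^ (- p) @[x --> +oo] --> (0:R).
Proof.
move=> p0; apply/cvgr0Pnorm_lt => e e0.
near=> x; have x0 : 0 < x by near: x; exact: nbhs_pinfty_gt.
rewrite ger0_norm ?powR_ge0// powRN -[ltRHS]invrK ltf_pV2 ?posrE ?powR_gt0 ?invr_gt0//.
have -> : e^-1 = (e^-1 `^ p^-1) `^ p.
  by rewrite -powRrM mulVf ?gt_eqF// powRr1 // invr_ge0 ltW.
have xe : e^-1 `^ p^-1 < x by near: x; exact: nbhs_pinfty_gt.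
apply: gt0_ltr_powR; rewrite ?nnegrE ?powR_ge0 ?(ltW x0)//.
Unshelve. all: by end_near. Qed.

Lemma integral_powR_tail_from (p z : R) : 0 < p -> 1 <= z ->
  (\int[mu]_(s in `[z, +oo[) (p * s `^ (- p - 1))%:E = (z `^ (- p))%:E)%E.
Proof.
move=> p0 z1; have z0 : 0 < z by exact: lt_le_trans z1.
apply: etrans; first apply: (@FTCy_pos (fun s => p * s `^ (- p - 1)) (fun s => - s `^ (- p)) z 0) => //.
- move=> x x0; have d1 := is_derive1_powR (- p) x0.
  by apply: is_derive_eq; rewrite mulNr opprK.
- by move=> x x0; apply: cvgMr; exact: powR_continuous_pos.
- by move=> x _; rewrite mulr_ge0 ?powR_ge0// ltW.
- by rewrite -oppr0; apply: cvgN; exact: powRN_cvgy.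
by rewrite sub0r opprK.
Qed.

Lemma integral_expRN (c : R) : (\int[mu]_(u in `[c, +oo[) (expR (- u))%:E = (expR (- c))%:E)%E.
Proof.
apply: etrans; first apply: (@ge0_FTCy _ (fun u => expR (- u)) (fun u => - expR (- u)) c 0).
- by move=> x; apply: is_derive_eq; rewrite /GRing.scale/= mulrN1 opprK.
- by move=> x; apply: (@continuous_comp _ _ _ (fun u => - u) expR); [exact: opp_continuous|exact: continuous_expR].
- by move=> x _; exact: expR_ge0.
- by rewrite -oppr0; apply: cvgN; exact: cvgr_expR.
by rewrite sub0r opprK.
Qed.

(** With [z = |t|^b] this writes the squared Pinsker function as an integral over levels, as
    [ge0_integral_layer] requires; [integral_expRN] and [integral_powR_tail_from] do the same for
    the Gaussian and for a power of the norm. *)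
Lemma integral_onem (z : R) : 0 <= z <= 1 ->
  (\int[mu]_(s in `]z, 1%R]) (2 * (1 - s))%:E = ((1 - z) ^+ 2)%:E)%E.
Proof.
move=> /andP[z0 z1].
apply: etrans; first apply: (@FTC_itv _ (fun s => 2 * (1 - s)) (fun s => - (1 - s) ^+ 2)).
- move=> x; apply: is_derive_eq.
  by rewrite /GRing.scale/=; ring.
- by move=> x; apply: cvgMr; apply: cvgB; [exact: cvg_cst|exact: cvg_id].
- exact: z1.
by congr (_%:E); rewrite subrr expr0n/= oppr0 sub0r opprK.
Qed.

End ftc_pos.

Section ball.
Context {R : realType} {d : nat}.
Notation mu := (leb R d).
Implicit Types t : Rvec R d.

Definition ball_volume : \bar R := mu [set t | enorm t <= 1].

Lemma measurable_ball (r : R) : measurable [set t : Rvec R d | enorm t <= r].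
Proof.
have -> : [set t : Rvec R d | enorm t <= r] = setT `&` (@enorm R d) @^-1` `]-oo, r].
  by apply/seteqP; split => t /=; rewrite in_itv/= => // -[].
exact: measurable_enorm.
Qed.

Lemma ball_volume_lty : (ball_volume < +oo)%E.
Proof.
(* Boxes are open on the left, so [-1] as lower side would miss points of the ball. *)
have h : mu (box (fun=> -2 : R) (fun=> 1 : R)) = ((1 - -2) ^+ d)%:E.
  rewrite (@leb_box _ _ (fun=> -2) (fun=> 1)) => [|i]; last by lra.
  by rewrite prodr_const card_ord.
have : (ball_volume <= mu (box (fun=> (-2)%R : R) (fun=> 1%R : R)))%E.
  apply: le_measure; rewrite ?inE; [exact: measurable_ball|exact: measurable_box|].
  move=> t /= ht i; have := le_trans (enorm_coord t i) ht.
  by rewrite ler_norml => /andP[a ->]; rewrite andbT; apply: lt_le_trans a; lra.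
by move/le_lt_trans; apply; rewrite h ltry.
Qed.

Definition vball : R := fine ball_volume.

Lemma ball_volumeE : ball_volume = vball%:E.
Proof. by rewrite /vball fineK// ge0_fin_numE ?ball_volume_lty// /ball_volume measure_ge0. Qed.

Lemma vball_ge0 : 0 <= vball.
Proof. by apply: fine_ge0; rewrite /ball_volume measure_ge0. Qed.

Lemma enorm_rescale0 t (h : R) : 0 < h ->
  enorm (rescale [tuple (0 : R) | i < d] t h) = enorm t / h.
Proof.
move=> h0; rewrite /enorm.
have -> : \sum_(i < d) (tnth (rescale [tuple (0 : R)  | i < d] t h) i : R) ^+ 2 =
  (\sum_(i < d) (tnth t i : R) ^+ 2) * (h^-1) ^+ 2.
  by rewrite mulr_suml; apply: eq_bigr => i _; rewrite tnth_rescale tnth_mktuple sub0r exprMn sqrrN.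
rewrite sqrtrM ?sumr_ge0// => [|i _]; last exact: sqr_ge0.
by rewrite sqrtr_sqr ger0_norm// invr_ge0 ltW.
Qed.

Lemma leb_ball (r : R) : (0 < d)%N -> 0 <= r ->
  mu [set t | enorm t <= r] = (vball * r ^+ d)%:E.
Proof.
move=> d0; rewrite le_eqVlt => /predU1P[<-|r0].
  rewrite expr0n gtn_eqF// mulr0.
  apply: (@subset_measure0 _ _ _ mu _ [set t : Rvec R d | (tnth t (Ordinal d0) : R) = 0]).
  - exact: measurable_ball.
  - have -> : [set t : Rvec R d | (tnth t (Ordinal d0) : R) = 0] =
      setT `&` (fun t : Rvec R d => tnth t (Ordinal d0)) @^-1` [set 0].
      by apply/seteqP; split => t //= -[].
    exact: (@measurable_tnth _ _ d (Ordinal d0)).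
  - move=> t /= ht; apply/eqP; rewrite -normr_le0; exact: le_trans (enorm_coord t _) ht.
  - exact: leb_face0.
have m1 : measurable_fun setT (fun t : Rvec R d => (\1_[set t : Rvec R d | (enorm t <= 1)%R] t : R)%:E).
  by apply/measurable_EFinP; apply: measurable_indic; exact: measurable_ball.
have h0 (x : Rvec R d) : (0 <= (\1_[set t : Rvec R d | (enorm t <= 1)%R] x : R)%:E)%E.
  by rewrite lee_fin.
have := @ge0_integral_rescale R d _ [tuple (0 : R) | i < d] r r0 m1 h0.
have hI (s : R) : (\int[mu]_x (\1_[set t : Rvec R d | (enorm t <= s)%R] x : R)%:E = mu [set t | (enorm t <= s)%R])%E.
  by rewrite (integral_indic _ measurableT (measurable_ball s)) setIT.
rewrite hI -/ball_volume ball_volumeE -EFinM mulrC => <-; rewrite -hI.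
apply: eq_integral => t _; rewrite /= !indicE; congr ((nat_of_bool _)%:R%:E).
by apply/idP/idP; rewrite !inE/= enorm_rescale0// ler_pdivrMr// mul1r.
Qed.

(* A radial function written as the integral over s of phi(s) on the ball of
   radius psi(s): this replaces polar coordinates. *)
Lemma ge0_integral_layer (phi psi : R -> R) : (0 < d)%N ->
  measurable_fun setT phi -> measurable_fun setT psi ->
  (forall s, 0 <= phi s) -> (forall s, 0 <= psi s) ->
  (\int[mu]_t \int[@lebesgue_measure R]_s (if enorm t <= psi s then phi s else 0)%:E =
   \int[@lebesgue_measure R]_s (vball * psi s ^+ d * phi s)%:E)%E.
Proof.
move=> d0 mphi mpsi phi0 psi0.
pose F (z : Rvec R d * R) : \bar R := (if enorm z.1 <= psi z.2 then phi z.2 else 0)%:E.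
have mF : measurable_fun setT F.
  apply/measurable_EFinP; apply: measurable_fun_ifT.
  - apply: measurable_fun_ler.
    + by apply: (measurableT_comp measurable_enorm); exact: measurable_fst.
    + by apply: (measurableT_comp mpsi); exact: measurable_snd.
  - by apply: (measurableT_comp mphi); exact: measurable_snd.
  - exact: measurable_cst.
have F0 z : (0 <= F z)%E by rewrite /F lee_fin; case: ifP.
transitivity (\int[@lebesgue_measure R]_s \int[mu]_t F (t, s))%E.
  by rewrite -(@fubini_tonelli1 _ _ _ _ _ mu (@lebesgue_measure R) F)// -(@fubini_tonelli2 _ _ _ _ _ mu (@lebesgue_measure R) F).
apply: eq_integral => s _.
transitivity (\int[mu]_t ((phi s)%:E * (\1_[set t | enorm t <= psi s] t)%:E))%E.
  apply: eq_integral => t _; rewrite /F/= indicE -EFinM; congr (_%:E).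
  by case: ifPn => h; [rewrite mem_set// mulr1|rewrite memNset ?mulr0//=; exact/negP].
rewrite ge0_integralZl_EFin//; last first.
  by apply/measurable_EFinP; apply: measurable_indic; exact: measurable_ball.
rewrite integral_indic//; last exact: measurable_ball.
by rewrite setIT mulrC EFinM -leb_ball.
Qed.

End ball.
Arguments vball : clear implicits.
Arguments ball_volume : clear implicits.

Section ball_volume.
Context {R : realType}.
Notation mu := (@lebesgue_measure R).

Lemma integral_itv_if (i : interval R) (f : R -> R) :
  (\int[mu]_(x in [set` i]) (f x)%:E = \int[mu]_x (if x \in i then f x else 0)%:E)%E.
Proof.
rewrite integral_mkcond; apply: eq_integral => x _; rewrite /patch mem_setE.
by case: ifP.
Qed.

Lemma measurable_expRN : measurable_fun setT (fun t : R => expR (- t)).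
Proof.
by apply: (measurableT_comp (@measurable_expR R)); apply: measurable_funN; exact: measurable_id.
Qed.

(** [Gamma] is [fine] of this and would turn an infinite value into 0; the extended value is kept
    until [Gamma_vball] shows it finite. *)
Definition eGamma (a : R) : \bar R := (\int[mu]_(t in `]0%R, +oo[) (t `^ (a - 1) * expR (- t))%:E)%E.

Lemma Gamma_fine (a : R) : Gamma a = fine (eGamma a).
Proof. by []. Qed.

Lemma measurable_gamma_fun (a : R) : measurable_fun setT (fun t : R => t `^ (a - 1) * expR (- t)).
Proof.
apply: measurable_funM; first exact: measurable_powR.
exact: measurable_expRN.
Qed.

Lemma eGamma_ge0 a : (0 <= eGamma a)%E.
Proof. by apply: integral_ge0 => t _; rewrite lee_fin mulr_ge0 ?powR_ge0 ?expR_ge0. Qed.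

Lemma eGammaE a : eGamma a = (\int[mu]_t (if 0 < t then t `^ (a - 1) * expR (- t) else 0)%:E)%E.
Proof.
rewrite /eGamma integral_itv_if; apply: eq_integral => t _; by rewrite in_itv/= andbT.
Qed.

(** Tonelli on the region [0 < u <= s] replaces integration by parts: [s^a] is the integral of
    [a u^(a-1)] below [s], and [exp (- u)] that of [exp (- s)] above [u]. *)
Lemma eGammaD1 (a : R) : 0 < a -> (eGamma (a + 1) = a%:E * eGamma a)%E.
Proof.
move=> a0; rewrite (eGammaE a) -ge0_integralZl_EFin//; last first.
- exact: ltW.
- apply/measurable_EFinP; apply: measurable_fun_ifT; [|exact: measurable_gamma_fun|exact: measurable_cst].
  by apply: measurable_fun_ltr; [exact: measurable_cst|exact: measurable_id].
- by move=> t _; rewrite lee_fin; case: ifP => // _; rewrite mulr_ge0 ?powR_ge0 ?expR_ge0.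
pose F (z : R * R) : R := if (0 < z.2) && (z.2 <= z.1) then a * z.2 `^ (a - 1) * expR (- z.1) else 0.
have mF : measurable_fun setT (EFin \o F).
  apply/measurable_EFinP; apply: measurable_fun_ifT; last exact: measurable_cst.
    apply: measurable_and.
      by apply: measurable_fun_ltr; [exact: measurable_cst|exact: measurable_snd].
    by apply: measurable_fun_ler; [exact: measurable_snd|exact: measurable_fst].
  apply: measurable_funM.
    apply: measurable_funM; first exact: measurable_cst.
    by apply: (measurableT_comp (measurable_powR (a - 1))); exact: measurable_snd.
  by apply: (measurableT_comp (@measurable_expR R)); apply: measurable_funN; exact: measurable_fst.
have F0 z : (0 <= (EFin \o F) z)%E.
  by rewrite lee_fin /F; case: ifP => // _; rewrite !mulr_ge0 ?powR_ge0 ?expR_ge0// ltW.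
transitivity (\int[mu]_s \int[mu]_u (EFin \o F) (s, u))%E.
  rewrite eGammaE; apply: eq_integral => s _.
  case: ifPn => s0; last first.
    rewrite integral0_eq// => u _; rewrite /F/= ; case: ifP => // /andP[u0 us].
    by move: s0; rewrite (lt_le_trans u0 us).
  have -> : a + 1 - 1 = a by ring.
  rewrite EFinM -(integral_powR0 a0 s0) muleC.
  rewrite -ge0_integralZl_EFin ?expR_ge0//; last first.
  - by apply/measurable_EFinP; apply: measurable_funTS; apply: measurable_funM; [exact: measurable_cst|exact: measurable_powR].
  - by move=> u _; rewrite lee_fin mulr_ge0 ?powR_ge0 ?ltW.
  rewrite integral_itv_if; apply: eq_integral => u _; rewrite /F/= in_itv/=.
  by case: ifPn => h //; rewrite mulrC.
transitivity (\int[mu]_u \int[mu]_s (EFin \o F) (s, u))%E.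
  by rewrite -(@fubini_tonelli1 _ _ _ _ _ mu mu (EFin \o F))// -(@fubini_tonelli2 _ _ _ _ _ mu mu (EFin \o F)).
apply: eq_integral => u _; case: ifPn => u0; last first.
  by rewrite mule0 integral0_eq// => s _; rewrite /F/= (negbTE u0).
rewrite -EFinM mulrA EFinM -integral_expRN -ge0_integralZl_EFin//; last first.
- by rewrite mulr_ge0 ?powR_ge0 ?ltW.
- apply/measurable_EFinP; apply: measurable_funTS.
  exact: measurable_expRN.
rewrite integral_itv_if; apply: eq_integral => s _; rewrite /F/= u0/= in_itv/= andbT.
by case: ifP.
Qed.

Lemma integral_gauss d :
  (\int[leb R d]_t (expR (- enorm t ^+ 2))%:E = (pi `^ (d%:R / 2))%:E)%E.
Proof.
transitivity (\int[leb R d]_t (\prod_(i < d) expR (- (tnth t i : R) ^+ 2))%:E)%E.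
  by apply: eq_integral => t _; rewrite sqr_enorm -sumrN expR_sum.
have mg : measurable_fun setT (fun x : R => expR (- x ^+ 2)).
  apply: (measurableT_comp (@measurable_expR R)); apply: measurable_funN.
  exact: exprn_measurable.
rewrite (@ge0_integral_prod R d (fun _ x => expR (- x ^+ 2)))//.
have -> : (\int[mu]_x (expR (- x ^+ 2))%:E = (Num.sqrt pi)%:E)%E.
  by have := @integralT_gauss R; rewrite /gauss_fun.
rewrite prodEFin prodr_const card_ord; congr (_%:E).
by rewrite -powR12_sqrt ?pi_ge0// -powR_mulrn ?powR_ge0// -powRrM mulrC.
Qed.

(* exp(- |t|^2) is integrated both as a product and by layers. *)
Lemma vball_Gamma d : (0 < d)%N ->
  ((vball R d)%:E * eGamma (d%:R / 2 + 1) = (pi `^ (d%:R / 2))%:E)%E.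
Proof.
move=> d0; rewrite -integral_gauss.
pose phi (s : R) : R := if 0 <= s then expR (- s) else 0.
have mphi : measurable_fun setT phi.
  apply: measurable_fun_ifT; last exact: measurable_cst.
    by apply: measurable_fun_ler; [exact: measurable_cst|exact: measurable_id].
  exact: measurable_expRN.
have phi0 s : 0 <= phi s by rewrite /phi; case: ifP => // _; exact: expR_ge0.
transitivity (\int[mu]_s (vball R d * Num.sqrt s ^+ d * phi s)%:E)%E; last first.
  rewrite -(ge0_integral_layer d0 mphi _ phi0 (@sqrtr_ge0 R)); last exact: (continuous_measurable_fun (@sqrt_continuous R)).
  apply: eq_integral => t _; rewrite -integral_expRN integral_itv_if.
  apply: eq_integral => s _; rewrite /phi in_itv/= andbT; have et := enorm_ge0 t.
  have -> : (enorm t ^+ 2 <= s) = (0 <= s) && (enorm t <= Num.sqrt s).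
    apply/idP/andP => [h|[s0 h]].
      split; first exact: le_trans (sqr_ge0 _) h.
      by rewrite -(ger0_norm et) -sqrtr_sqr ler_wsqrtr.
    by rewrite -(sqr_sqrtr s0) ler_sqr ?nnegrE.
  by case: (0 <= s); case: (enorm t <= _).
rewrite eGammaE -ge0_integralZl_EFin ?vball_ge0//; last first.
- apply/measurable_EFinP; apply: measurable_fun_ifT; [|exact: measurable_gamma_fun|exact: measurable_cst].
  by apply: measurable_fun_ltr; [exact: measurable_cst|exact: measurable_id].
- by move=> t _; rewrite lee_fin; case: ifP => // _; rewrite mulr_ge0 ?powR_ge0 ?expR_ge0.
apply: eq_integral => s _; rewrite -EFinM; congr (_%:E); rewrite -mulrA; congr (_ * _).
have -> : d%:R / 2 + 1 - 1 = d%:R / 2 :> R by ring.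
rewrite /phi; case: (ltgtP 0 s) => [s0|s0|<-].
- have -> : Num.sqrt s ^+ d = s `^ (d%:R / 2); last by [].
  by rewrite -powR12_sqrt ?(ltW s0)// -powR_mulrn ?powR_ge0// -powRrM mulrC.
- by rewrite mulr0.
- by rewrite sqrtr0 expr0n gtn_eqF// mul0r.
Qed.

(** The product in [vball_Gamma] is finite and nonzero, so neither of its factors is 0 or infinite;
    one use of [eGammaD1] then turns [Gamma (d / 2 + 1)] into [Gamma (d / 2)]. *)
Lemma Gamma_vball d : (0 < d)%N ->
  0 < vball R d /\ sphere_area d = d%:R * vball R d :> R.
Proof.
move=> d0; have d20 : 0 < d%:R / 2 :> R by rewrite divr_gt0// ltr0n.
have h := vball_Gamma d0.
have pp : 0 < pi `^ (d%:R / 2) :> R by rewrite powR_gt0 ?pi_gt0.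
have v0 : 0 < vball R d.
  rewrite lt_neqAle vball_ge0 andbT eq_sym; apply/eqP => v0; move: h; rewrite v0 mul0e => -[] /eqP.
  by rewrite lt_eqF.
split => //; move: h; rewrite (eGammaD1 d20) /sphere_area Gamma_fine.
case: (eGamma (d%:R / 2)) (eGamma_ge0 (d%:R / 2)) => [g| |]//= g0.
  rewrite -!EFinM => -[e].
  have g0' : g != 0 by apply/eqP => g0'; move: pp; rewrite -e g0' !mulr0 ltxx.
  by rewrite -e; field.
by rewrite !gt0_muley ?lte_fin.
Qed.

(** The level [s] of [integral_onem] is reached on the ball of radius [s^(1/b)], which leaves the
    one-dimensional integral of [2 (1 - s) s^(d/b)]. *)
Lemma integral_pinsker_sqr d (b : R) : (0 < d)%N -> 0 < b ->
  sqnorm (leb R d) (pinsker b) = 2 * vball R d * b ^+ 2 / ((d%:R + b) * (d%:R + 2 * b)).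
Proof.
move=> d0 b0.
pose phi (s : R) : R := if 0 <= s <= 1 then 2 * (1 - s) else 0.
have mphi : measurable_fun setT phi.
  apply: measurable_fun_ifT; last exact: measurable_cst.
    apply: measurable_and.
      by apply: measurable_fun_ler; [exact: measurable_cst|exact: measurable_id].
    by apply: measurable_fun_ler; [exact: measurable_id|exact: measurable_cst].
  by apply: measurable_funM; [exact: measurable_cst|apply: measurable_funB; [exact: measurable_cst|exact: measurable_id]].
have phi0 s : 0 <= phi s by rewrite /phi; case: ifP => // /andP[_ h]; rewrite mulr_ge0// subr_ge0.
pose psi (s : R) := s `^ b^-1.
have psi0 s : 0 <= psi s by exact: powR_ge0.
have := ge0_integral_layer d0 mphi (measurable_powR b^-1) phi0 psi0.
have -> : (\int[leb R d]_t \int[mu]_s (if (enorm t <= psi s)%R then phi s else 0%R)%:E =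
   \int[leb R d]_t ((pinsker b t) ^+ 2)%:E)%E.
  apply: eq_integral => t _; have et := enorm_ge0 t.
  have e1 s : 0 <= s -> (enorm t <= psi s) = (enorm t `^ b <= s).
    move=> s0; rewrite /psi; apply/idP/idP => h.
      have -> : s = (s `^ b^-1) `^ b by rewrite -powRrM mulVf ?gt_eqF// powRr1.
      by apply: ge0_ler_powR; rewrite ?nnegrE ?powR_ge0// ltW.
    have -> : enorm t = (enorm t `^ b) `^ b^-1 by rewrite -powRrM mulfV ?gt_eqF// powRr1.
    by apply: ge0_ler_powR; rewrite ?nnegrE ?powR_ge0 ?invr_ge0// ltW.
  transitivity (\int[mu]_s (if s \in `[enorm t `^ b, 1] then 2 * (1 - s) else 0)%:E)%E.
    apply: eq_integral => s _; rewrite /phi in_itv/=.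
    case: (leP 0 s) => s0 /=; last first.
      rewrite if_same; case: ifP => // /andP[h _].
      by have := le_lt_trans h s0; rewrite ltNge powR_ge0.
    by rewrite e1//; case: (enorm t `^ b <= s); case: (s <= 1).
  rewrite -integral_itv_if /pinsker; case: (leP (enorm t `^ b) 1) => h1.
    rewrite max_l ?subr_ge0// -integral_onem ?powR_ge0//.
    rewrite -integral_itv_obnd_cbnd//.
    apply/measurable_EFinP; apply: measurable_funTS.
    by apply: measurable_funM; [exact: measurable_cst|apply: measurable_funB; [exact: measurable_cst|exact: measurable_id]].
  rewrite max_r ?subr_le0 ?(ltW h1)// expr0n/= set_itv_ge ?integral_set0//.
  by rewrite bnd_simp -ltNge.
rewrite (sqnormE (isL2_pinsker b0)) => h; apply: EFin_inj; rewrite h.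
transitivity ((vball R d)%:E * \int[mu]_(s in `]0%R, 1%R]) (2 * (1 - s) * s `^ (d%:R / b))%:E)%E.
  rewrite integral_itv_if -ge0_integralZl_EFin ?vball_ge0//; last first.
  - apply/measurable_EFinP; apply: measurable_fun_ifT; last exact: measurable_cst.
      apply: measurable_and.
        by apply: measurable_fun_ltr; [exact: measurable_cst|exact: measurable_id].
      by apply: measurable_fun_ler; [exact: measurable_id|exact: measurable_cst].
    apply: measurable_funM; last exact: measurable_powR.
    by apply: measurable_funM; [exact: measurable_cst|apply: measurable_funB; [exact: measurable_cst|exact: measurable_id]].
  - move=> s _; rewrite lee_fin; case: ifP => // /andP[_ h'].
    by rewrite !mulr_ge0 ?powR_ge0// subr_ge0.
  apply: eq_integral => s _; rewrite -EFinM; congr (_%:E); rewrite in_itv/= /phi -mulrA; congr (_ * _).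
  case: (ltgtP 0 s) => [s0|s0|<-]/=.
  - rewrite /psi -powR_mulrn ?powR_ge0// -powRrM mulrC (mulrC b^-1); case: ifP => //.
    by rewrite mul0r.
  - by rewrite mulr0.
  - by rewrite /psi powR0 ?invr_eq0 ?gt_eqF// expr0n gtn_eqF// mul0r.
rewrite integral_onem_powR ?divr_gt0 ?ltr0n// -EFinM; congr (_%:E); field.
have ? : 0 < d%:R :> R by rewrite ltr0n.
by do ?[apply/andP; split]; rewrite gt_eqF// ?addr_gt0// ?mulr_gt0.
Qed.

(** By layers, balls of radius [s >= 1] weighted by [q s^(-q-1)]: the resulting integrand
    [s^(d-q-1)] is integrable at infinity as soon as [q > d]. *)
Lemma integrable_radial_decay d (q : R) : (0 < d)%N -> d%:R < q ->
  (leb R d).-integrable setT (EFin \o (fun t : Rvec R d => Num.max 1 (enorm t) `^ (- q))).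
Proof.
move=> d0 dq; have q0 : 0 < q by apply: lt_trans dq; rewrite ltr0n.
pose phi (s : R) : R := if 1 <= s then q * s `^ (- q - 1) else 0.
have mphi : measurable_fun setT phi.
  apply: measurable_fun_ifT; last exact: measurable_cst.
    by apply: measurable_fun_ler; [exact: measurable_cst|exact: measurable_id].
  by apply: measurable_funM; [exact: measurable_cst|exact: measurable_powR].
have phi0 s : 0 <= phi s by rewrite /phi; case: ifP => // _; rewrite mulr_ge0 ?powR_ge0// ltW.
pose psi (s : R) := Num.max s 0.
have mpsi : measurable_fun setT psi.
  by apply: measurable_maxr; [exact: measurable_id|exact: measurable_cst].
have psi0 s : 0 <= psi s by rewrite le_max lexx orbT.
have h := ge0_integral_layer d0 mphi mpsi phi0 psi0.
have mF : measurable_fun setT (fun t : Rvec R d => Num.max 1 (enorm t) `^ (- q)).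
  apply: (measurableT_comp (measurable_powR (- q))).
  by apply: measurable_maxr; [exact: measurable_cst|exact: measurable_enorm].
apply/integrableP; split; first exact/measurable_EFinP.
have -> : (\int[leb R d]_x `|((Num.max 1 (enorm x) `^ (- q))%R)%:E| =
   \int[leb R d]_t \int[mu]_s (if (enorm t <= psi s)%R then phi s else 0%R)%:E)%E.
  apply: eq_integral => t _; rewrite /= ger0_norm ?powR_ge0//.
  rewrite -integral_powR_tail_from// ?le_max ?lexx// integral_itv_if.
  apply: eq_integral => s _; rewrite in_itv/= andbT /phi /psi ge_max.
  by case: (leP 1 s) => s1 /=; [rewrite max_l//; exact: le_trans s1|rewrite if_same].
rewrite h; have qd : 0 < q - d%:R by rewrite subr_gt0.
have -> : (\int[mu]_s (vball R d * psi s ^+ d * phi s)%:E =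
  (vball R d * (q / (q - d%:R)))%:E * \int[mu]_(s in `[1%R, +oo[) ((q - d%:R) * s `^ (- (q - d%:R) - 1))%:E)%E.
  rewrite integral_itv_if -ge0_integralZl_EFin; last first.
  - by apply: mulr_ge0; [exact: vball_ge0|apply: divr_ge0; exact: ltW].
  - apply/measurable_EFinP; apply: measurable_fun_ifT; last exact: measurable_cst.
      rewrite (_ : (fun x => x \in `[1, +oo[) = (fun x => 1 <= x)); last by apply/funext => x; rewrite in_itv/= andbT.
      by apply: measurable_fun_ler; [exact: measurable_cst|exact: measurable_id].
    by apply: measurable_funM; [exact: measurable_cst|exact: measurable_powR].
  - by move=> s _; rewrite lee_fin; case: ifP => // _; rewrite mulr_ge0 ?powR_ge0// ltW.
  - exact: measurableT.
  apply: eq_integral => s _; rewrite -EFinM; congr (_%:E); rewrite in_itv/= andbT /phi /psi.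
  case: (leP 1 s) => s1; last by rewrite !mulr0.
  have s0 : 0 < s by exact: lt_le_trans s1.
  rewrite max_l ?ltW// -powR_mulrn ?ltW//.
  have -> : - (q - d%:R) - 1 = d%:R + (- q - 1) by ring.
  rewrite (powR_split d%:R (- q - 1) s0); field; by rewrite gt_eqF.
by rewrite integral_powR_tail_from// -EFinM ltry.
Qed.

End ball_volume.

(** * Sampling from a Sobolev density *)

Section variance.
Context d (T : measurableType d) (R : realType).
Context (mu : {sigma_finite_measure set T -> \bar R}).

Lemma integral_cst1 (k : \bar R) : mu setT = 1%E -> (\int[mu]_x k = k)%E.
Proof.
move=> mu1; transitivity (k * mu setT)%E; first exact: integral_cst.
by rewrite mu1 mule1.
Qed.

Lemma integrable_cst1 (k : R) : mu setT = 1%E -> mu.-integrable setT (EFin \o (fun=> k)).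
Proof.
move=> mu1; apply/integrableP; split; first exact/measurable_EFinP/measurable_cst.
by rewrite (integral_cst1 (`|k|)%:E mu1) ltry.
Qed.

Lemma isL2_cst1 (k : R) : mu setT = 1%E -> isL2 mu (fun=> k).
Proof. by move=> mu1; split; [exact: measurable_cst|exact: integrable_cst1]. Qed.

Lemma Rintegral_cst1 (k : R) : mu setT = 1%E -> \int[mu]_x k = k.
Proof. by move=> mu1; rewrite /Rintegral integral_cst1. Qed.

Lemma isL2_integrable1 (g : T -> R) : mu setT = 1%E -> isL2 mu g ->
  mu.-integrable setT (EFin \o g).
Proof.
move=> mu1 hg; have := isL2M hg (isL2_cst1 1 mu1).
by congr (_.-integrable _ _); apply/funext => x /=; rewrite mulr1.
Qed.

Lemma integral_sqr_mean (g : T -> R) (a c : R) : mu setT = 1%E -> isL2 mu g ->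
  \int[mu]_x g x = 0 ->
  (\int[mu]_x ((a + c * g x) ^+ 2)%:E = (a ^+ 2 + c ^+ 2 * sqnorm mu g)%:E)%E.
Proof.
move=> mu1 hg g0; have ha := isL2_cst1 a mu1; have hcg := isL2Z c hg.
rewrite (sqnormE (isL2D ha hcg)) sqnormD// sqnormZ//.
have -> : \int[mu]_x (a * (c * g x)) = 0.
  rewrite (_ : (fun x => _) = (fun x => (a * c) * g x)); last by apply/funext => x; rewrite mulrA.
  by rewrite RintegralZl ?g0 ?mulr0//; exact: isL2_integrable1.
by rewrite mulr0 addr0 /sqnorm Rintegral_cst1.
Qed.

(** The constant [a] carries the induction, absorbing the observation split off at each step; later
    it holds the bias. Weights equal to 0 restrict the sum to a subsample. *)
Lemma integral_sqr_sum_mpow (g : T -> R) n (a : R) (c : 'I_n -> R) : mu setT = 1%E ->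
  isL2 mu g -> \int[mu]_x g x = 0 ->
  (\int[mpow mu n]_Y ((a + \sum_(i < n) c i * g (tnth Y i)) ^+ 2)%:E =
   (a ^+ 2 + (\sum_(i < n) c i ^+ 2) * sqnorm mu g)%:E)%E.
Proof.
move=> mu1 hg g0; have mg := hg.1.
elim: n a c => [|n IH] a c.
  by rewrite integral_mpow0 !big_ord0 addr0 mul0r addr0.
have mF (m : nat) (a' : R) (c' : 'I_m -> R) : measurable_fun setT (fun Y : m.-tuple T => ((a' + \sum_(i < m) c' i * g (tnth Y i)) ^+ 2)%:E).
  apply/measurable_EFinP; apply: measurable_funX; apply: measurable_funD; first exact: measurable_cst.
  apply: measurable_sum => i; apply: measurable_funM; first exact: measurable_cst.
  by apply: (measurableT_comp mg); exact: measurable_tnth.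
rewrite ge0_integral_mpowS; last first.
- by move=> Y; rewrite lee_fin sqr_ge0.
- exact: mF.
transitivity (\int[mu]_x ((a + c ord0 * g x) ^+ 2 + (\sum_(i < n) c (lift ord0 i) ^+ 2) * sqnorm mu g)%:E)%E.
  apply: eq_integral => x _; rewrite -(IH _ (fun i => c (lift ord0 i))).
  apply: eq_integral => Y _; rewrite big_ord_recl tnth_cons_pair0 addrA.
  congr (((_ + _) ^+ 2)%:E); by apply: eq_bigr => i _; rewrite tnth_cons_pairS.
rewrite (_ : (fun x => _) = (fun x => ((a + c ord0 * g x) ^+ 2)%:E + ((\sum_(i < n) c (lift ord0 i) ^+ 2) * sqnorm mu g)%:E)%E); last by apply/funext => x; rewrite EFinD.
rewrite ge0_integralD//; last first.
- by move=> x _; rewrite lee_fin mulr_ge0 ?sqnorm_ge0// sumr_ge0// => i _; exact: sqr_ge0.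
- apply/measurable_EFinP; apply: measurable_funX; apply: measurable_funD; first exact: measurable_cst.
  by apply: measurable_funM; [exact: measurable_cst|exact: mg].
- by move=> x _; rewrite lee_fin sqr_ge0.
rewrite integral_sqr_mean// integral_cst1// -EFinD big_ord_recl; congr (_%:E).
by rewrite mulrDl addrA.
Qed.

End variance.

Section density.
Context {R : realType} {d : nat} (p : density R d).
Notation mu := (leb R d).
Notation law := (density_law p).

Let mp := measurable_pdf p.
Let p0 := pdf_ge0 p.

Lemma integrable_pdf : mu.-integrable setT (EFin \o p).
Proof.
apply/integrableP; split; first exact/measurable_EFinP.
have -> : (\int[mu]_x `|(EFin \o p) x| = \int[mu]_x (p x)%:E)%E.
  by apply: eq_integral => x _; rewrite /= ger0_norm.
by rewrite integral_pdf ltry.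
Qed.

Lemma Rintegral_pdf : \int[mu]_x p x = 1.
Proof. by rewrite /Rintegral integral_pdf. Qed.

Lemma ge0_integral_law (F : Rvec R d -> \bar R) : measurable_fun setT F ->
  (forall x, 0 <= F x)%E -> (\int[law]_x F x = \int[mu]_x (F x * (p x)%:E))%E.
Proof.
move=> mF F0; apply: (@ge0_integral_dens _ _ _ mu (EFin \o p)) => //.
- exact/measurable_EFinP.
Qed.

Lemma Rintegral_law (F : Rvec R d -> R) : measurable_fun setT F ->
  \int[law]_x F x = \int[mu]_x (F x * p x).
Proof.
move=> mF; rewrite /Rintegral; congr fine.
rewrite integralE [RHS]integralE; congr (_ - _)%E.
  rewrite ge0_integral_law//; last exact/measurable_funepos/measurable_EFinP.
  apply: eq_integral => x _; rewrite !funeposE.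
  by rewrite EFinM maxeMl ?mul0e ?lee_fin.
rewrite ge0_integral_law//; last exact/measurable_funeneg/measurable_EFinP.
apply: eq_integral => x _; rewrite !funenegE.
by rewrite EFinM -mulNe maxeMl ?mul0e ?lee_fin.
Qed.

Lemma law_setT : law setT = 1%E.
Proof. exact: integral_pdf. Qed.

Lemma pdf_sup_ge0 (L : R) : {ae mu, forall x, p x <= L} -> 0 <= L.
Proof.
move=> pL; rewrite leNgt; apply/negP => L0.
have : (\int[mu]_x (p x)%:E = \int[mu]_x (cst 0%E x))%E.
  apply: ae_eq_integral => //; first exact/measurable_EFinP.
  by apply: filterS pL => x hx _; have := le_lt_trans hx L0; rewrite ltNge p0.
by rewrite integral_pdf integral0 => -[] /eqP; rewrite oner_eq0.
Qed.

Lemma isL2_law (L : R) (g : Rvec R d -> R) : {ae mu, forall x, p x <= L} -> isL2 mu g ->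
  isL2 law g /\ sqnorm law g <= L * sqnorm mu g.
Proof.
move=> pL hg; have mg := hg.1.
have m2 : measurable_fun setT (fun x => (g x ^+ 2)%:E) by exact/measurable_EFinP/measurable_funX.
have L0 := pdf_sup_ge0 pL.
have h : (\int[law]_x (g x ^+ 2)%:E <= (L * sqnorm mu g)%:E)%E.
  rewrite ge0_integral_law//; last by move=> x; rewrite lee_fin sqr_ge0.
  rewrite EFinM -(sqnormE hg) -ge0_integralZl_EFin//; last by move=> x _; rewrite lee_fin sqr_ge0.
  apply: ae_ge0_le_integral => //.
  - by move=> x _; rewrite -EFinM lee_fin mulr_ge0 ?sqr_ge0.
  - by apply: emeasurable_funM => //; exact/measurable_EFinP.
  - by move=> x _; rewrite -EFinM lee_fin mulr_ge0 ?sqr_ge0.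
  - by apply: emeasurable_funM => //; exact: measurable_cst.
  - by apply: filterS pL => x hx _; rewrite -!EFinM lee_fin mulrC ler_wpM2r ?sqr_ge0.
have hl : isL2 law g by apply/isL2P; split => //; apply: le_lt_trans h _; rewrite ltry.
by split=> //; rewrite -lee_fin -(sqnormE hl).
Qed.

Lemma sample_mean_variance n (A : {set 'I_n}) (a : R) (f : Rvec R d -> R) :
  isL2 law f -> (0 < #|A|)%N ->
  (\int[iid_law p n]_X ((a + (sample_mean X A f - \int[mu]_y (f y * p y))) ^+ 2)%:E <=
   (a ^+ 2 + #|A|%:R^-1 * sqnorm law f)%:E)%E.
Proof.
move=> hf A0; have law1 := law_setT; set m := \int[mu]_y _.
pose g y := f y - m.
have hg : isL2 law g by apply: isL2B => //; exact: isL2_cst1.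
have g0 : \int[law]_y g y = 0.
  rewrite /g RintegralB//; last 2 first.
  - exact: isL2_integrable1.
  - exact: integrable_cst1.
  by rewrite Rintegral_cst1// Rintegral_law ?subrr//; exact: hf.1.
pose c (i : 'I_n) : R := if i \in A then #|A|%:R^-1 else 0.
have A0' : #|A|%:R != 0 :> R by rewrite pnatr_eq0 -lt0n.
have -> : (\int[iid_law p n]_X ((a + (sample_mean X A f - m)) ^+ 2)%:E =
  \int[iid_law p n]_X ((a + \sum_(i < n) c i * g (tnth X i)) ^+ 2)%:E)%E.
  apply: eq_integral => X _; congr (((_ + _) ^+ 2)%:E).
  have -> : \sum_(i < n) c i * g (tnth X i) = \sum_(i in A) #|A|%:R^-1 * g (tnth X i).
    rewrite [RHS]big_mkcond; apply: eq_bigr => i _; rewrite /c; case: ifP => //.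
    by rewrite mul0r.
  by rewrite -mulr_sumr /g sumrB sumr_const -[m *+ _]mulr_natl mulrBr mulKf.
rewrite /iid_law integral_sqr_sum_mpow// lee_fin lerD2l.
(* A variance is at most the second moment: read [integral_sqr_mean] on [f = m + g]. *)
have sg : sqnorm law g <= sqnorm law f.
  have := integral_sqr_mean m 1 law1 hg g0.
  have -> : (\int[law]_y ((m + 1 * g y) ^+ 2)%:E = (sqnorm law f)%:E)%E.
    rewrite -(sqnormE hf); apply: eq_integral => y _; congr ((_ ^+ 2)%:E); rewrite /g; ring.
  by move=> [->]; rewrite expr1n mul1r lerDr sqr_ge0.
have -> : \sum_(i < n) c i ^+ 2 = #|A|%:R^-1.
  have -> : \sum_(i < n) c i ^+ 2 = \sum_(i in A) #|A|%:R^-1 ^+ 2.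
    rewrite [RHS]big_mkcond; apply: eq_bigr => i _; rewrite /c; case: ifP => //.
    by rewrite expr0n.
  by rewrite sumr_const -[_ *+ _]mulr_natl expr2 mulrA mulfV// mul1r.
by rewrite ler_wpM2l ?invr_ge0.
Qed.

End density.

(** * Sobolev densities: transform and uniform bound *)

Section charfun.
Context {R : realType} {d : nat} (p : density R d).
Notation mu := (leb R d).
Implicit Types (x y t : Rvec R d).

Lemma hartley0 t : hartley (fun=> 0 : R) t = 0 :> R.
Proof.
rewrite /hartley /Rintegral; have -> : (fun x => (cas (dot x t) * 0)%:E) = (fun=> 0%E) :> (Rvec R d -> \bar R).
  by apply/funext => x; rewrite mulr0.
by rewrite integral0.
Qed.

Lemma sqr_normc_charfun t : Normc.normc (charfun p t) ^+ 2 =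
  2^-1 * (hartley p t ^+ 2 + hartley p (vneg t) ^+ 2).
Proof.
have ip := integrable_pdf p.
have i0 : mu.-integrable setT (EFin \o (fun=> 0 : R)) by exact: integrable0.
have [h1 h2] := @fourierE R d (fun x => (p x)%:C%C) t ip i0.
rewrite sqr_normc_E /charfun h1 h2.
have -> : (@complex.Im R \o (fun x => (p x)%:C%C)) = fun=> 0 by [].
have -> : (@complex.Re R \o (fun x => (p x)%:C%C)) = p by [].
by rewrite !hartley0; field.
Qed.

(** [|charfun|^2] averages the squared Hartley transform over [t] and [- t], which a radial weight
    does not distinguish. The Sobolev condition thus becomes one on the Hartley transform. *)
Lemma integral_charfun_radial (F : R -> R) : measurable_fun setT F -> (forall s, 0 <= F s) ->
  (\int[mu]_t (F (enorm t) * Normc.normc (charfun p t) ^+ 2)%:E =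
   \int[mu]_t (F (enorm t) * hartley p t ^+ 2)%:E)%E.
Proof.
move=> mF F0; set I := RHS.
have mH := measurable_hartley (integrable_pdf p).
pose G t := F (enorm t) * hartley p t ^+ 2.
have mG : measurable_fun setT (EFin \o G).
  apply/measurable_EFinP; apply: measurable_funM.
    by apply: (measurableT_comp mF); exact: measurable_enorm.
  exact: measurable_funX.
have G0 t : (0 <= (EFin \o G) t)%E by rewrite lee_fin mulr_ge0 ?sqr_ge0.
have mGn : measurable_fun setT (EFin \o G \o @vneg R d) by apply: measurableT_comp => //; exact: measurable_vneg.
transitivity (\int[mu]_t ((2^-1)%:E * ((EFin \o G) t + (EFin \o G) (vneg t))))%E.
  apply: eq_integral => t _; rewrite /G/= enorm_vneg -EFinD -EFinM; congr (_%:E).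
  by rewrite sqr_normc_charfun; ring.
rewrite ge0_integralZl_EFin//; last 2 first.
- by move=> t _; apply: adde_ge0.
- by apply: emeasurable_funD.
rewrite ge0_integralD//.
rewrite (ge0_integral_vneg mG G0) ge0_muleDr ?integral_ge0//.
by rewrite -ge0_muleDl ?lee_fin// -EFinD (_ : 2^-1 + 2^-1 = 1 :> R) ?mul1e//; field.
Qed.

Lemma hartley_pdf_le2 t : `|hartley p t| <= 2.
Proof.
apply: le_trans (hartley_bounded t (integrable_pdf p)) _.
rewrite (_ : \int[mu]_x `|p x| = 1) ?mulr1// -(Rintegral_pdf p).
by apply: eq_Rintegral => x _; rewrite ger0_norm ?pdf_ge0.
Qed.

End charfun.

Definition radial_decay_mass (R : realType) (d : nat) (beta : R) : R :=
  \int[leb R d]_t (Num.max 1 (enorm t) `^ (- (2 * beta))).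

(** By inversion, [(2 pi)^-d] times the bound 2 on [cas] times a bound on the L1 norm of the
    transform. It depends on [d], [beta] and [Q] only, so the remainder is uniform over the
    class. *)
Definition pdf_bound (R : realType) (d : nat) (beta Q : R) : R :=
  ((2 * pi) ^+ d)^-1 * (2 * (2 * radial_decay_mass d beta + Q)).

Section sobolev.
Context {R : realType} {d : nat} (p : density R d) (beta Q : R).
Notation mu := (leb R d).
Hypothesis d_gt0 : (0 < d)%N.
Hypothesis beta_gt : d%:R / 2 < beta.
Hypothesis hp : Sobolev_class beta Q p.
Implicit Types (x y t : Rvec R d).

Let mH := measurable_hartley (integrable_pdf p).

Lemma sobolev_hartley : (\int[mu]_t (enorm t `^ (2 * beta) * hartley p t ^+ 2)%:E <= Q%:E)%E.
Proof.
move: hp; rewrite /Sobolev_class/= (integral_charfun_radial p (measurable_powR (2 * beta)))//.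
by move=> s; exact: powR_ge0.
Qed.

Lemma integrable_sobolev :
  mu.-integrable setT (EFin \o (fun t => enorm t `^ (2 * beta) * hartley p t ^+ 2)).
Proof.
have mG : measurable_fun setT (fun t => enorm t `^ (2 * beta) * hartley p t ^+ 2).
  apply: measurable_funM; last exact: measurable_funX.
  by apply: (measurableT_comp (measurable_powR (2 * beta))); exact: measurable_enorm.
apply/integrableP; split; first exact/measurable_EFinP.
apply: le_lt_trans (ltry Q); apply: le_trans sobolev_hartley.
apply: ge0_le_integralT => t //.
by rewrite /= ger0_norm// mulr_ge0 ?powR_ge0 ?sqr_ge0.
Qed.

Lemma integral_sobolev_le : \int[mu]_t (enorm t `^ (2 * beta) * hartley p t ^+ 2) <= Q.
Proof. by rewrite -lee_fin (Rintegral_EFin integrable_sobolev) sobolev_hartley. Qed.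

Let decay t : R := Num.max 1 (enorm t) `^ (- (2 * beta)).

Let int_decay : mu.-integrable setT (EFin \o decay).
Proof. by apply: integrable_radial_decay => //; move: beta_gt; rewrite ltr_pdivrMr// mulrC. Qed.

(* For |t| > 1 this is AM-GM; it makes the transform of a Sobolev density
   integrable, as beta > d/2. *)
Lemma norm_hartley_pdf_le t :
  `|hartley p t| <= 2 * decay t + enorm t `^ (2 * beta) * hartley p t ^+ 2.
Proof.
rewrite /decay; case: (leP (enorm t) 1) => h1.
  rewrite powR1 mulr1; apply: le_trans (hartley_pdf_le2 p t) _.
  by rewrite lerDl mulr_ge0 ?powR_ge0 ?sqr_ge0.
have t0 : 0 < enorm t by exact: lt_trans h1.
rewrite powRN -[hartley p t ^+ 2]real_normK ?num_real//.
have : 0 < enorm t `^ (2 * beta) by rewrite powR_gt0.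
move: (enorm t `^ _) (`|hartley p t|) (normr_ge0 (hartley p t)) => u v v0 u0.
rewrite -subr_ge0.
have -> : 2 * u^-1 + u * v ^+ 2 - v = u^-1 * ((u * v - 2^-1) ^+ 2 + 7 / 4).
  by field; rewrite gt_eqF.
by rewrite mulr_ge0 ?invr_ge0 ?(ltW u0)// addr_ge0 ?sqr_ge0.
Qed.

Lemma integrable_hartley_pdf : mu.-integrable setT (EFin \o hartley p).
Proof.
have h : mu.-integrable setT (EFin \o (fun t => 2 * decay t + enorm t `^ (2 * beta) * hartley p t ^+ 2)).
  by apply: integrableDr; [exact: integrableMl_cst|exact: integrable_sobolev].
apply: le_integrable h => //; first exact/measurable_EFinP.
move=> t _; rewrite /= lee_fin; apply: le_trans (norm_hartley_pdf_le t) _.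
exact: ler_norm.
Qed.

Lemma integral_hartley_pdf_le :
  \int[mu]_t `|hartley p t| <= 2 * radial_decay_mass d beta + Q.
Proof.
have h1 := integrableMl_cst 2 int_decay.
apply: (@le_trans _ _ (\int[mu]_t (2 * decay t + enorm t `^ (2 * beta) * hartley p t ^+ 2))).
  apply: le_Rintegral => //; first exact/integrable_normr/integrable_hartley_pdf.
    exact: integrableDr h1 integrable_sobolev.
  by move=> t _; exact: norm_hartley_pdf_le.
rewrite RintegralD//; last exact: integrable_sobolev.
rewrite RintegralZl//; apply: lerD; last exact: integral_sobolev_le.
by rewrite lexx.
Qed.

Lemma pdf_hartley : {ae mu, forall x, (2 * pi) ^+ d * p x = hartley (hartley p) x}.
Proof. exact: hartley_inversion_L1 (integrable_pdf p) integrable_hartley_pdf. Qed.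

Lemma pdf_le : {ae mu, forall x, p x <= pdf_bound d beta Q}.
Proof.
apply: filterS pdf_hartley => x hx; rewrite /pdf_bound.
have c0 : 0 < (2 * pi : R) ^+ d by rewrite exprn_gt0// mulr_gt0// pi_gt0.
rewrite -ler_pdivrMl ?invr_gt0// invrK hx.
apply: le_trans (ler_norm _) _; apply: le_trans (hartley_bounded x integrable_hartley_pdf) _.
by rewrite ler_pM2l// integral_hartley_pdf_le.
Qed.

Lemma isL2_pdf : isL2 mu p.
Proof.
have mp := measurable_pdf p.
apply/isL2P; split => //.
have h : mu.-integrable setT (EFin \o (fun x => pdf_bound d beta Q * p x)).
  exact/integrableMl_cst/integrable_pdf.
apply: le_lt_trans (integrable_lt h).
apply: ae_ge0_le_integral => //.
- by move=> x _; rewrite lee_fin sqr_ge0.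
- exact/measurable_EFinP/measurable_funX.
- apply/measurable_EFinP; apply: measurableT_comp => //.
  by apply: measurable_funM; [exact: measurable_cst|].
- apply: filterS pdf_le => x hx _; rewrite lee_fin.
  by apply: le_trans (ler_norm _); rewrite expr2 ler_wpM2r ?pdf_ge0.
Qed.

End sobolev.

(** * Bias and variance of the kernel estimators *)

Section kernel_bias.
Context {R : realType} {d : nat}.
Notation mu := (leb R d).
Implicit Types (x y t s : Rvec R d).

Lemma rescale_vneg x y (h : R) : rescale y x h = vneg (rescale x y h).
Proof. by apply: eq_from_tnth => i; rewrite !tnth_mktuple -mulNr opprB. Qed.

Lemma ae_rescale (P : Rvec R d -> Prop) x (h : R) : 0 < h ->
  {ae mu, forall z, P z} -> {ae mu, forall y, P (rescale x y h)}.
Proof.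
move=> h0 [N [mN N0 sub]].
have mr : measurable_fun setT (fun y : Rvec R d => rescale x y h).
  by apply: measurable_rescale; [exact: measurable_cst|exact: measurable_id].
exists ((fun y => rescale x y h) @^-1` N); split.
- by rewrite -[X in measurable X]setTI; exact: (mr measurableT).
- have m1 : measurable_fun setT (fun z : Rvec R d => (\1_N z : R)%:E).
    by apply/measurable_EFinP; apply: measurable_indic.
  have g0 z : (0 <= (\1_N z : R)%:E)%E by rewrite lee_fin.
  have := ge0_integral_rescale x h0 m1 g0.
  rewrite (integral_indic _ measurableT mN) setIT [X in (_ * X)%E]N0 mule0 => <-.
  rewrite -[LHS]/(mu _) -[X in mu X]setIT -(integral_indic _ measurableT); last first.
    by rewrite -[X in measurable X]setTI; exact: (mr measurableT).
  by apply: eq_integral => y _; rewrite !indicE.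
- by move=> y /= hy; apply: sub.
Qed.

Lemma ae_rescale2 (P : Rvec R d -> Prop) x (h : R) : 0 < h ->
  {ae mu, forall z, P z} -> {ae mu, forall y, P (rescale y x h)}.
Proof.
move=> h0 hP.
have h1 : {ae mu, forall z, P (vneg z)}.
  have := ae_rescale [tuple (0 : R) | i < d] ltr01 hP.
  by apply: filterS => y; rewrite -vnegE.
have := ae_rescale x h0 h1; apply: filterS => y; by rewrite (rescale_vneg x y).
Qed.

Lemma isL2_rescale (K : Rvec R d -> R) y (h : R) : 0 < h -> isL2 mu K ->
  isL2 mu (fun x => K (rescale y x h)).
Proof.
move=> h0 hK; have mK := hK.1; apply/isL2P; split.
  by apply: (measurableT_comp mK); apply: measurable_rescale; [exact: measurable_cst|exact: measurable_id].
have m3 : measurable_fun setT (fun z : Rvec R d => (K z ^+ 2)%:E).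
  by apply/measurable_EFinP; apply: measurable_funX.
have n1 (z : Rvec R d) : (0 <= (K z ^+ 2)%:E)%E by rewrite lee_fin sqr_ge0.
by rewrite (ge0_integral_rescale y h0 m3 n1) (sqnormE hK) -EFinM ltry.
Qed.

Definition dilate (h : R) t : Rvec R d := [tuple h * (tnth t i : R) | i < d].

Lemma measurable_dilate h : measurable_fun setT (dilate h).
Proof.
by apply: measurable_mktuple => i; apply: measurable_funM; [exact: measurable_cst|exact: measurable_tnth].
Qed.

Lemma dilateE (h : R) t : 0 < h -> dilate h t = vneg (rescale [tuple (0 : R) | i < d] t h^-1).
Proof.
move=> h0; apply: eq_from_tnth => i; rewrite !tnth_mktuple sub0r invrK.
by rewrite mulNr opprK mulrC.
Qed.

Lemma dilate_vneg (h : R) t : dilate h (vneg t) = vneg (dilate h t).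
Proof. by apply: eq_from_tnth => i; rewrite !tnth_mktuple mulrN. Qed.

Lemma dot_dilate_rescale (h : R) t y x : 0 < h ->
  dot (dilate h t) (rescale y x h) = dot y t - dot x t.
Proof.
move=> h0; rewrite /dot -sumrB; apply: eq_bigr => i _; rewrite !tnth_mktuple.
by field; rewrite gt_eqF.
Qed.

Lemma Rintegral_dilate (f : Rvec R d -> R) (h : R) : 0 < h -> measurable_fun setT f ->
  \int[mu]_t f (dilate h t) = (h ^+ d)^-1 * \int[mu]_t f t.
Proof.
move=> h0 mf.
transitivity (\int[mu]_t (f \o @vneg R d) (rescale [tuple (0 : R) | i < d] t h^-1)).
  by apply: eq_Rintegral => t _; rewrite dilateE.
rewrite (Rintegral_rescale _ (f := f \o @vneg R d)) ?invr_gt0//; last first.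
  by apply: measurableT_comp => //; exact: measurable_vneg.
by rewrite Rintegral_vneg// exprVn.
Qed.

Lemma enorm_dilate (h : R) t : 0 < h -> enorm (dilate h t) = h * enorm t.
Proof.
by move=> h0; rewrite dilateE// enorm_vneg enorm_rescale0 ?invr_gt0// invrK mulrC.
Qed.

Lemma integrable_dilate (f : Rvec R d -> R) (h : R) : 0 < h ->
  mu.-integrable setT (EFin \o f) -> mu.-integrable setT (EFin \o (fun t => f (dilate h t))).
Proof.
move=> h0 hf; have mf := integrable_measurable hf.
have mfd : measurable_fun setT (fun t => f (dilate h t)).
  by apply: (measurableT_comp mf); exact: measurable_dilate.
apply/integrableP; split; first exact/measurable_EFinP.
have mn : measurable_fun setT (fun t : Rvec R d => (`|f (vneg t)|)%:E).
  apply/measurable_EFinP; apply: measurableT_comp => //; apply: measurableT_comp => //.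
  exact: measurable_vneg.
have n0 (t : Rvec R d) : (0 <= (`|f (vneg t)|)%:E)%E by rewrite lee_fin.
have hi : 0 < h^-1 by rewrite invr_gt0.
have e1 := ge0_integral_rescale [tuple (0 : R) | i < d] hi mn n0.
have mn' : measurable_fun setT (fun t : Rvec R d => (`|f t|)%:E).
  by apply/measurable_EFinP; apply: measurableT_comp.
have n0' (t : Rvec R d) : (0 <= (`|f t|)%:E)%E by rewrite lee_fin.
have e2 := ge0_integral_vneg mn' n0'.
have -> : (\int[mu]_t `|(EFin \o (fun t => f (dilate h t))) t| =
  (h^-1 ^+ d)%:E * \int[mu]_t (`|f t|)%:E)%E.
  by rewrite -e2 -e1; apply: eq_integral => t _; rewrite /= dilateE.
by rewrite lte_mul_pinfty ?lee_fin ?exprn_ge0 ?ltW ?integrable_lt.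
Qed.

Lemma Rintegral_odd (f : Rvec R d -> R) : mu.-integrable setT (EFin \o f) ->
  (forall t, f (vneg t) = - f t) -> \int[mu]_t f t = 0.
Proof.
move=> hf fN; have := Rintegral_vneg (integrable_measurable hf).
rewrite (_ : (fun x => _) = (fun x => -1 * f x)); last by apply/funext => x; rewrite fN mulN1r.
by rewrite RintegralZl//; move: (\int[mu]_x f x) => v e; lra.
Qed.

Lemma integrable_cos (w : Rvec R d -> R) x y : mu.-integrable setT (EFin \o w) ->
  mu.-integrable setT (EFin \o (fun t => w t * cos (dot y t - dot x t))).
Proof.
move=> iw.
have : mu.-integrable setT (EFin \o (fun t => cos (dot y t - dot x t) * w t)).
  apply: (@integrable_mulb _ _ _ _ 1) => //.
  - apply: (measurableT_comp (continuous_measurable_fun (@continuous_cos R))).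
    by apply: measurable_funB; apply: measurable_dot => //; exact: measurable_cst.
  - by move=> t; have [] := sincos_bounded (dot y t - dot x t).
by congr (_.-integrable _ _); apply/funext => t /=; rewrite mulrC.
Qed.

Lemma integrable_sin (w : Rvec R d -> R) (u : Rvec R d -> R) : measurable_fun setT u ->
  mu.-integrable setT (EFin \o w) ->
  mu.-integrable setT (EFin \o (fun t => w t * sin (u t))).
Proof.
move=> mu_ iw.
have : mu.-integrable setT (EFin \o (fun t => sin (u t) * w t)).
  apply: (@integrable_mulb _ _ _ _ 1) => //.
  - exact: (measurableT_comp (continuous_measurable_fun (@continuous_sin R))).
  - by move=> t; have [] := sincos_bounded (u t).
by congr (_.-integrable _ _); apply/funext => t /=; rewrite mulrC.
Qed.

(** Scaling the kernel by [1 / h] dilates frequencies by [h]; the sine part is odd in [t] and drops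
    out because [w] is even. *)
Lemma hartley_rescale_even (w : Rvec R d -> R) (h : R) x y : 0 < h ->
  mu.-integrable setT (EFin \o w) -> (forall t, w (vneg t) = w t) ->
  (h ^+ d)^-1 * hartley w (rescale y x h) =
  \int[mu]_t (w (dilate h t) * cos (dot y t - dot x t)).
Proof.
move=> h0 iw wN; have mw := integrable_measurable iw.
have md t : measurable_fun setT (fun z : Rvec R d => dot t z) by apply: measurable_dot => //; exact: measurable_cst.
rewrite /hartley -Rintegral_dilate//; last first.
  by apply: measurable_funM => //; apply: measurable_cas_dot => //; exact: measurable_cst.
have iwd := integrable_dilate h0 iw.
have ms : measurable_fun setT (fun t : Rvec R d => dot y t - dot x t) by apply: measurable_funB.
transitivity (\int[mu]_t (w (dilate h t) * cos (dot y t - dot x t) + w (dilate h t) * sin (dot y t - dot x t))).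
  by apply: eq_Rintegral => t _; rewrite dot_dilate_rescale// /cas mulrDl !(mulrC (w _)).
rewrite RintegralD//; last 2 first.
- exact: integrable_cos iwd.
- exact: integrable_sin iwd.
rewrite (@Rintegral_odd (fun t => w (dilate h t) * sin (dot y t - dot x t))) ?addr0//.
  exact: integrable_sin iwd.
by move=> t; rewrite dilate_vneg wN !(dotC _ (vneg t)) !dot_vneg -opprD sinN mulrN !(dotC t).
Qed.

(** The convolution theorem for an even multiplier: by [cas_mul] the inner integral is a cosine
    transform plus an odd term. *)
Lemma hartley_mul_hartley (w f : Rvec R d -> R) x :
  mu.-integrable setT (EFin \o w) -> mu.-integrable setT (EFin \o f) ->
  (forall t, w (vneg t) = w t) ->
  hartley (fun t => w t * hartley f t) x =
  \int[mu]_y (f y * \int[mu]_t (w t * cos (dot y t - dot x t))).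
Proof.
move=> iw jf wN.
have mw := integrable_measurable iw; have mf := integrable_measurable jf.
have md t : measurable_fun setT (fun z : Rvec R d => dot t z) by apply: measurable_dot => //; exact: measurable_cst.
pose F (z : Rvec R d * Rvec R d) : R := w z.1 * cas (dot z.1 x) * (cas (dot z.2 z.1) * f z.2).
have iF : (mu \x mu)%E.-integrable setT (EFin \o F).
  apply: (@integrable_prod_le _ _ _ _ _ mu mu F (fun t => 2 * w t) (fun y => 2 * f y)).
  - apply: measurable_funM; apply: measurable_funM.
    + by apply: (measurableT_comp mw); exact: measurable_fst.
    + by apply: measurable_cas_dot; [exact: measurable_fst|exact: measurable_cst].
    + by apply: measurable_cas_dot; [exact: measurable_snd|exact: measurable_fst].
    + by apply: (measurableT_comp mf); exact: measurable_snd.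
  - exact: integrableMl_cst.
  - exact: integrableMl_cst.
  - move=> t y; rewrite /F/= !normrM (ger0_norm (ler0n _ 2)).
    apply: ler_pM; rewrite ?mulr_ge0//; last by rewrite ler_wpM2r ?norm_cas.
    by rewrite mulrC ler_wpM2r ?norm_cas.
transitivity (\int[mu]_t \int[mu]_y F (t, y)).
  apply: eq_Rintegral => t _; rewrite /F/= RintegralZl//; last exact: integrable_hartley.
  by rewrite /hartley; ring.
rewrite RFubini//; apply: eq_Rintegral => y _; rewrite /F/=.
transitivity (\int[mu]_t (f y * (w t * cos (dot y t - dot x t) + w t * sin (dot y t + dot x t)))).
  apply: eq_Rintegral => t _; rewrite (dotC t x).
  have -> : w t * cas (dot x t) * (cas (dot y t) * f y) = f y * (w t * (cas (dot y t) * cas (dot x t))) by ring.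
  by rewrite cas_mul mulrDr.
have is1 : mu.-integrable setT (EFin \o (fun t => w t * sin (dot y t + dot x t))).
  by apply: integrable_sin => //; apply: measurable_funD.
have ic := integrable_cos x y iw.
rewrite RintegralZl//; last exact: integrableDr.
rewrite RintegralD//; congr (_ * _).
rewrite (@Rintegral_odd (fun t => w t * sin (dot y t + dot x t))) ?addr0//.
by move=> t; rewrite wN !(dotC _ (vneg t)) !dot_vneg -opprD sinN mulrN !(dotC t).
Qed.

End kernel_bias.

Section kernel_risk.
Context {R : realType} {d : nat}.
Notation mu := (leb R d).
Implicit Types (x y t s : Rvec R d).

Lemma pi2d_gt0 : 0 < (2 * pi : R) ^+ d.
Proof. by rewrite exprn_gt0// mulr_gt0// pi_gt0. Qed.

Definition scaled_kernel (h : R) (K : Rvec R d -> R) x y : R := (h ^+ d)^-1 * K (rescale y x h).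

Lemma measurable_scaled_kernel h K x : measurable_fun setT K ->
  measurable_fun setT (scaled_kernel h K x).
Proof.
move=> mK; apply: measurable_funM; first exact: measurable_cst.
by apply: (measurableT_comp mK); apply: measurable_rescale; [exact: measurable_id|exact: measurable_cst].
Qed.

Lemma isL2_scaled_kernel h K x : 0 < h -> isL2 mu K -> isL2 mu (scaled_kernel h K x).
Proof.
move=> h0 hK; apply: isL2Z.
have hKn : isL2 mu (fun z => K (vneg z)).
  have := isL2_rescale [tuple (0 : R) | i < d] ltr01 hK.
  by congr isL2; apply/funext => z; rewrite vnegE.
have := isL2_rescale x h0 hKn.
by congr isL2; apply/funext => y; rewrite (rescale_vneg x y).
Qed.

Context (p : density R d) (beta Q : R).
Hypothesis d_gt0 : (0 < d)%N.
Hypothesis beta_gt : d%:R / 2 < beta.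
Hypothesis hp : Sobolev_class beta Q p.
Notation L := (pdf_bound d beta Q).

Definition mean_kernel (h : R) (K : Rvec R d -> R) x : R :=
  \int[mu]_y (scaled_kernel h K x y * p y).

Lemma beta_gt0 : 0 < beta.
Proof. by apply: le_lt_trans beta_gt; rewrite divr_ge0. Qed.

(** For fixed [x] the formula for [K] holds at almost every [y], which is enough under the integral:
    the identity is true at every [x]. *)
Lemma mean_kernelE (b h : R) (K : Rvec R d -> R) x : 0 < b -> 0 < h -> is_pinsker_kernel b K ->
  mean_kernel h K x =
  ((2 * pi) ^+ d)^-1 * hartley (fun t => pinsker b (dilate h t) * hartley p t) x.
Proof.
move=> b0 h0 /(pinsker_kernelE b0)[hK KE].
have iw : mu.-integrable setT (EFin \o (pinsker b : Rvec R d -> R)) by exact: integrable_pinsker.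
have iwd := integrable_dilate h0 iw.
have ip := integrable_pdf p.
have wN t : pinsker b (dilate h (vneg t)) = pinsker b (dilate h t).
  by rewrite dilate_vneg pinsker_vneg.
rewrite (hartley_mul_hartley x iwd ip wN).
have int2 : mu.-integrable setT (EFin \o (fun y => p y * \int[mu]_t (pinsker b (dilate h t) * cos (dot y t - dot x t)))).
  have : mu.-integrable setT (EFin \o (fun y => ((h ^+ d)^-1 * hartley (pinsker b) (rescale y x h)) * p y)).
    apply: (@integrable_mulb _ _ _ _ ((h ^+ d)^-1 * (2 * \int[mu]_t `|pinsker b t|))) => //.
    - apply: measurable_funM; first exact: measurable_cst.
      by apply: measurable_hartley_comp => //; apply: measurable_rescale; [exact: measurable_id|exact: measurable_cst].
    - move=> y; rewrite normrM ger0_norm ?invr_ge0 ?exprn_ge0 ?(ltW h0)//.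
      by rewrite ler_wpM2l ?invr_ge0 ?exprn_ge0 ?(ltW h0)// hartley_bounded.
  congr (_.-integrable _ _); apply/funext => y /=.
  by rewrite (hartley_rescale_even x y h0 iw (pinsker_vneg b)) mulrC.
rewrite -RintegralZl// /mean_kernel /Rintegral; congr fine.
apply: ae_eq_integral => //.
- apply/measurable_EFinP; apply: measurable_funM; last exact: measurable_pdf.
  by apply: measurable_scaled_kernel; exact: hK.1.
- have := integrable_measurable (integrableMl_cst ((2 * pi) ^+ d)^-1 int2).
  by move=> /measurable_EFinP.
- have := ae_rescale2 x h0 KE; apply: filterS => y hy _ /=; congr (_%:E).
  have := hartley_rescale_even x y h0 iw (pinsker_vneg b); rewrite /Rintegral => <-.
  rewrite -hy /scaled_kernel.
  have := pi2d_gt0; have : 0 < h ^+ d by rewrite exprn_gt0.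
  move: (h ^+ d) ((2 * pi) ^+ d) => u c u0 c0.
  by field; rewrite !gt_eqF.
Qed.

Definition bias h K x : R := mean_kernel h K x - p x.

(** With [u = h |t|] the defect is [min (u^b) 1]: it is at most [u^b <= u^beta] when [u < 1], and at
    most [1 <= u^beta] otherwise. *)
Lemma pinsker_defect b t (h : R) : 0 < h -> beta <= b ->
  (pinsker b (dilate h t) - 1) ^+ 2 <= h `^ (2 * beta) * enorm t `^ (2 * beta).
Proof.
move=> h0 bb; have b0 : 0 < b := lt_le_trans beta_gt0 bb.
have e0 := enorm_ge0 t.
rewrite /pinsker enorm_dilate//; set u := h * enorm t.
have u0 : 0 <= u by rewrite mulr_ge0// ltW.
rewrite -powRM ?(ltW h0)// -/u.
have -> : (Num.max (1 - u `^ b) 0 - 1) ^+ 2 = Num.min (u `^ b) 1 ^+ 2.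
  case: (leP (1 - u `^ b) 0) => h1.
    by rewrite min_r; [ring|rewrite -subr_le0].
  by rewrite min_l; [ring|rewrite -subr_ge0 ltW].
have -> : u `^ (2 * beta) = (u `^ beta) ^+ 2.
  by rewrite -powR_mulrn ?powR_ge0// -powRrM mulrC.
rewrite ler_sqr ?nnegrE ?powR_ge0 ?le_min ?powR_ge0 ?ler01//.
case: (leP 1 u) => u1.
  apply: le_trans (_ : 1 <= _); first by rewrite ge_min lexx orbT.
  by rewrite -(powRr0 u) ler_powR// ltW// beta_gt0.
apply: le_trans (_ : u `^ b <= _); first by rewrite ge_min lexx.
move: u0; rewrite le_eqVlt => /predU1P[<-|u0]; last by apply: ger_powR => //; rewrite u0 ltW.
by rewrite !powR0// gt_eqF// beta_gt0.
Qed.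

Lemma bias_bound (b h : R) K : 0 < h -> beta <= b -> is_pinsker_kernel b K ->
  isL2 mu (bias h K) /\
  sqnorm mu (bias h K) <= ((2 * pi) ^+ d)^-1 * (h `^ (2 * beta) * Q).
Proof.
move=> h0 bb HK; have b0 : 0 < b := lt_le_trans beta_gt0 bb.
have iH := integrable_hartley_pdf d_gt0 beta_gt hp.
have mH := integrable_measurable iH.
have mw : measurable_fun setT (fun t => pinsker b (dilate h t)).
  by apply: (measurableT_comp (measurable_pinsker b)); exact: measurable_dilate.
have iwH : mu.-integrable setT (EFin \o (fun t => pinsker b (dilate h t) * hartley p t)).
  apply: (@integrable_mulb _ _ _ _ 1) => //.
  by move=> t; rewrite ger0_norm ?pinsker_ge0 ?pinsker_le1.
pose g t := pinsker b (dilate h t) * hartley p t - hartley p t.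
have ig : mu.-integrable setT (EFin \o g) by exact: integrableBr.
have mg := integrable_measurable ig.
have hg2 : (\int[mu]_t (g t ^+ 2)%:E <= (h `^ (2 * beta) * Q)%:E)%E.
  apply: (@le_trans _ _ (\int[mu]_t ((h `^ (2 * beta))%:E * (enorm t `^ (2 * beta) * hartley p t ^+ 2)%:E))%E).
    apply: ge0_le_integralT => t; first by rewrite lee_fin sqr_ge0.
    rewrite -EFinM lee_fin /g.
    have -> : (pinsker b (dilate h t) * hartley p t - hartley p t) ^+ 2 =
      (pinsker b (dilate h t) - 1) ^+ 2 * hartley p t ^+ 2 by ring.
    by rewrite [leRHS]mulrA ler_wpM2r ?sqr_ge0// pinsker_defect.
  rewrite ge0_integralZl_EFin ?powR_ge0//; last 2 first.
  - by move=> t _; rewrite lee_fin mulr_ge0 ?powR_ge0 ?sqr_ge0.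
  - by apply/measurable_EFinP; exact: integrable_measurable (integrable_sobolev hp).
  by rewrite EFinM lee_wpmul2l ?lee_fin ?powR_ge0// sobolev_hartley.
have g2 : isL2 mu g by apply/isL2P; split => //; apply: le_lt_trans hg2 _; rewrite ltry.
have [hL hn] := hartley_L2 ig g2.
have biasE : {ae mu, forall x, bias h K x = ((2 * pi) ^+ d)^-1 * hartley g x}.
  apply: filterS (pdf_hartley d_gt0 beta_gt hp) => x hx.
  rewrite /bias (mean_kernelE x b0 h0 HK) /g hartleyB// mulrBr -hx.
  by rewrite [X in _ = _ - X]mulrA mulVf ?gt_eqF ?pi2d_gt0 ?mul1r.
have mb : measurable_fun setT (bias h K).
  apply: measurable_funB; last exact: measurable_pdf.
  rewrite (_ : mean_kernel h K = fun x => ((2 * pi) ^+ d)^-1 * hartley (fun t => pinsker b (dilate h t) * hartley p t) x).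
    by apply: measurable_funM; [exact: measurable_cst|exact: measurable_hartley].
  by apply/funext => x; exact: mean_kernelE HK.
have e2 : (\int[mu]_x (bias h K x ^+ 2)%:E = (sqnorm mu (fun x => ((2 * pi) ^+ d)^-1 * hartley g x))%:E)%E.
  rewrite -(sqnormE (isL2Z _ hL)); apply: ae_eq_integral => //.
  - exact/measurable_EFinP/measurable_funX.
  - by apply/measurable_EFinP/measurable_funX; exact: (isL2Z _ hL).1.
  - by apply: filterS biasE => x -> _.
have hb : isL2 mu (bias h K) by apply/isL2P; split => //; rewrite e2 ltry.
split => //; rewrite -lee_fin -(sqnormE hb) e2 lee_fin sqnormZ//.
have c0 := pi2d_gt0.
(* One of the two factors [(2 pi)^-d] cancels against the constant of [hartley_L2]. *)
rewrite expr2 -mulrA ler_pM2l ?invr_gt0//.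
rewrite mulrC ler_pdivrMr// mulrC; apply: le_trans hn _.
by rewrite ler_pM2l// -lee_fin -(sqnormE g2).
Qed.

Lemma sqnorm_pinsker_kernel b K : 0 < b -> is_pinsker_kernel b K ->
  isL2 mu K /\ sqnorm mu K <= ((2 * pi) ^+ d)^-1 * sqnorm mu (pinsker b).
Proof.
move=> b0 /(pinsker_kernelE b0)[hK KE]; split => //.
have iw : mu.-integrable setT (EFin \o (pinsker b : Rvec R d -> R)) by exact: integrable_pinsker.
have [hL hn] := hartley_L2 iw (isL2_pinsker b0).
have c0 := pi2d_gt0.
have e : (\int[mu]_x (K x ^+ 2)%:E = (sqnorm mu (fun x => ((2 * pi) ^+ d)^-1 * hartley (pinsker b) x))%:E)%E.
  rewrite -(sqnormE (isL2Z _ hL)); apply: ae_eq_integral => //.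
  - by apply/measurable_EFinP/measurable_funX; exact: hK.1.
  - by apply/measurable_EFinP/measurable_funX; exact: (isL2Z _ hL).1.
  - by apply: filterS KE => x <- _; rewrite mulKf// gt_eqF.
rewrite -lee_fin -(sqnormE hK) e lee_fin sqnormZ//.
rewrite expr2 -mulrA ler_pM2l ?invr_gt0//.
by rewrite mulrC ler_pdivrMr// mulrC.
Qed.

End kernel_risk.

Section kernel_estimator_risk.
Context {R : realType} {d : nat}.
Notation mu := (leb R d).
Implicit Types (x y t s : Rvec R d).

Lemma measurable_kernel_estimator n (S : {set 'I_n}) (h : R) (K : Rvec R d -> R)
    d' (T : measurableType d') (f : T -> n.-tuple (Rvec R d)) (g : T -> Rvec R d) :
  measurable_fun setT K -> measurable_fun setT f -> measurable_fun setT g ->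
  measurable_fun setT (fun z => kernel_estimator (f z) S h K (g z)).
Proof.
move=> mK mf mg; apply: measurable_funM; first exact: measurable_cst.
rewrite (_ : (fun z => _) = (fun z => \sum_(i < n) if i \in S then K (rescale (tnth (f z) i) (g z) h) else 0)); last first.
  by apply/funext => z; rewrite big_mkcond.
apply: measurable_sum => i; case: (i \in S); last exact: measurable_cst.
apply: (measurableT_comp mK).
apply: measurable_rescale => //; exact: (measurableT_comp (measurable_tnth i)).
Qed.

Context (p : density R d) (beta Q : R).
Hypothesis d_gt0 : (0 < d)%N.
Hypothesis beta_gt : d%:R / 2 < beta.
Hypothesis hp : Sobolev_class beta Q p.
Notation law := (density_law p).

Lemma kernel_estimator_variance n (S : {set 'I_n}) (h : R) (K : Rvec R d -> R) x :
  0 < h -> (0 < #|S|)%N -> isL2 mu K ->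
  (\int[iid_law p n]_X ((kernel_estimator X S h K x - p x) ^+ 2)%:E <=
   (bias p h K x ^+ 2)%:E + (#|S|%:R^-1)%:E * \int[mu]_y ((scaled_kernel h K x y) ^+ 2 * p y)%:E)%E.
Proof.
move=> h0 S0 hK; have hs := isL2_scaled_kernel x h0 hK.
have [hl hlb] := isL2_law (pdf_le d_gt0 beta_gt hp) hs.
have -> : (\int[iid_law p n]_X ((kernel_estimator X S h K x - p x) ^+ 2)%:E =
  \int[iid_law p n]_X ((bias p h K x + (sample_mean X S (scaled_kernel h K x) - mean_kernel p h K x)) ^+ 2)%:E)%E.
  apply: eq_integral => X _; congr ((_ ^+ 2)%:E).
  rewrite /bias /kernel_estimator /sample_mean /scaled_kernel -mulr_sumr invfM; ring.
have -> : (\int[mu]_y ((scaled_kernel h K x y) ^+ 2 * p y)%:E = (sqnorm law (scaled_kernel h K x))%:E)%E.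
  rewrite -(sqnormE hl) ge0_integral_law//.
  - by apply/measurable_EFinP/measurable_funX; exact: hs.1.
  - by move=> y; rewrite lee_fin sqr_ge0.
rewrite -EFinM -EFinD; exact: sample_mean_variance.
Qed.

(** Integrating in [x] first, every observation [y] contributes the same amount, and [p] has mass 1.
    Hence the variance keeps its sharp constant, free of [pdf_bound]. *)
Lemma integral_scaled_kernel_sqr (h : R) (K : Rvec R d -> R) : 0 < h -> isL2 mu K ->
  (\int[mu]_x \int[mu]_y ((scaled_kernel h K x y) ^+ 2 * p y)%:E =
   ((h ^+ d)^-1 * sqnorm mu K)%:E)%E.
Proof.
move=> h0 hK; have mK := hK.1.
pose F (z : Rvec R d * Rvec R d) : \bar R := ((scaled_kernel h K z.1 z.2) ^+ 2 * p z.2)%:E.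
have mF : measurable_fun setT F.
  apply/measurable_EFinP; apply: measurable_funM; last first.
    by apply: (measurableT_comp (measurable_pdf p)); exact: measurable_snd.
  apply: measurable_funX; apply: measurable_funM; first exact: measurable_cst.
  by apply: (measurableT_comp mK); apply: measurable_rescale; [exact: measurable_snd|exact: measurable_fst].
have F0 z : (0 <= F z)%E by rewrite lee_fin mulr_ge0 ?sqr_ge0 ?pdf_ge0.
transitivity (\int[mu]_y \int[mu]_x F (x, y))%E.
  by rewrite -(@fubini_tonelli1 _ _ _ _ _ mu mu F)// -(@fubini_tonelli2 _ _ _ _ _ mu mu F).
have e y : (\int[mu]_x F (x, y) = ((h ^+ d)^-1 * sqnorm mu K)%:E * (p y)%:E)%E.
  have m3 : measurable_fun setT (fun z : Rvec R d => (((h ^+ d)^-1 * K z) ^+ 2 * p y)%:E).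
    apply/measurable_EFinP; apply: measurable_funM; last exact: measurable_cst.
    by apply: measurable_funX; apply: measurable_funM; [exact: measurable_cst|].
  have n3 (z : Rvec R d) : (0 <= (((h ^+ d)^-1 * K z) ^+ 2 * p y)%:E)%E.
    by rewrite lee_fin mulr_ge0 ?sqr_ge0 ?pdf_ge0.
  rewrite (ge0_integral_rescale y h0 m3 n3).
  have -> : (\int[mu]_z (((h ^+ d)^-1 * K z) ^+ 2 * p y)%:E =
     \int[mu]_z (((h ^+ d)^-1 ^+ 2 * p y)%:E * (K z ^+ 2)%:E))%E.
    by apply: eq_integral => z _; rewrite -EFinM; congr (_%:E); ring.
  rewrite ge0_integralZl_EFin//; last 3 first.
  - by move=> z _; rewrite lee_fin sqr_ge0.
  - exact/measurable_EFinP/measurable_funX.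
  - by rewrite mulr_ge0 ?sqr_ge0 ?pdf_ge0.
  rewrite (sqnormE hK) -!EFinM; congr (_%:E).
  have : 0 < h ^+ d by rewrite exprn_gt0.
  by move: (h ^+ d) => u u0; field; rewrite gt_eqF.
transitivity (\int[mu]_y (((h ^+ d)^-1 * sqnorm mu K)%:E * (p y)%:E))%E.
  by apply: eq_integral => y _; exact: e.
rewrite ge0_integralZl_EFin//; last 3 first.
- by move=> z _; rewrite lee_fin pdf_ge0.
- by apply/measurable_EFinP; exact: measurable_pdf.
- by rewrite mulr_ge0 ?invr_ge0 ?exprn_ge0 ?sqnorm_ge0// ltW.
by rewrite integral_pdf mule1.
Qed.

Lemma kernel_estimator_risk n (S : {set 'I_n}) (b h : R) (K : Rvec R d -> R) :
  0 < h -> beta <= b -> (0 < #|S|)%N -> is_pinsker_kernel b K ->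
  (\int[iid_law p n]_X \int[mu]_x ((kernel_estimator X S h K x - p x) ^+ 2)%:E <=
   (((2 * pi) ^+ d)^-1 * (h `^ (2 * beta) * Q + (#|S|%:R * h ^+ d)^-1 * sqnorm mu (pinsker b)))%:E)%E.
Proof.
move=> h0 bb S0 HK.
have b0 : 0 < b := lt_le_trans (beta_gt0 beta_gt) bb.
have [hK nK] := sqnorm_pinsker_kernel b0 HK; have mK := hK.1.
have [hb nb] := bias_bound d_gt0 beta_gt hp h0 bb HK.
pose F (z : n.-tuple (Rvec R d) * Rvec R d) : \bar R := ((kernel_estimator z.1 S h K z.2 - p z.2) ^+ 2)%:E.
have mF : measurable_fun setT F.
  apply/measurable_EFinP; apply: measurable_funX; apply: measurable_funB.
    by apply: measurable_kernel_estimator; [exact: mK|exact: measurable_fst|exact: measurable_snd].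
  by apply: (measurableT_comp (measurable_pdf p)); exact: measurable_snd.
have F0 z : (0 <= F z)%E by rewrite lee_fin sqr_ge0.
have -> : (\int[iid_law p n]_X \int[mu]_x ((kernel_estimator X S h K x - p x) ^+ 2)%:E =
  \int[mu]_x \int[iid_law p n]_X F (X, x))%E.
  by rewrite -(@fubini_tonelli1 _ _ _ _ _ (iid_law p n) mu F)// -(@fubini_tonelli2 _ _ _ _ _ (iid_law p n) mu F).
apply: (@le_trans _ _ (\int[mu]_x ((bias p h K x ^+ 2)%:E + (#|S|%:R^-1)%:E * \int[mu]_y ((scaled_kernel h K x y) ^+ 2 * p y)%:E))%E).
  apply: ge0_le_integralT => x; first by apply: integral_ge0 => X _.
  exact: kernel_estimator_variance.
have mI : measurable_fun setT (fun x => \int[mu]_y ((scaled_kernel h K x y) ^+ 2 * p y)%:E)%E.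
  apply: (@measurable_fun_fubini_tonelli_F _ _ _ _ _ mu (fun z : Rvec R d * Rvec R d => ((scaled_kernel h K z.1 z.2) ^+ 2 * p z.2)%:E)).
  - apply/measurable_EFinP; apply: measurable_funM; last first.
      by apply: (measurableT_comp (measurable_pdf p)); exact: measurable_snd.
    apply: measurable_funX; apply: measurable_funM; first exact: measurable_cst.
    by apply: (measurableT_comp mK); apply: measurable_rescale; [exact: measurable_snd|exact: measurable_fst].
  - by move=> z; rewrite lee_fin mulr_ge0 ?sqr_ge0 ?pdf_ge0.
have I0 x : (0 <= \int[mu]_y ((scaled_kernel h K x y) ^+ 2 * p y)%:E)%E.
  by apply: integral_ge0 => y _; rewrite lee_fin mulr_ge0 ?sqr_ge0 ?pdf_ge0.
rewrite ge0_integralD//; last 4 first.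
- by move=> x _; rewrite lee_fin sqr_ge0.
- by apply/measurable_EFinP/measurable_funX; exact: hb.1.
- by move=> x _; rewrite mule_ge0 ?lee_fin ?invr_ge0.
- by apply: emeasurable_funM => //; exact: measurable_cst.
rewrite ge0_integralZl_EFin ?invr_ge0// integral_scaled_kernel_sqr//.
rewrite (sqnormE hb) -EFinM -EFinD lee_fin mulrDr lerD//.
rewrite [leRHS]mulrCA invfM -mulrA ler_wpM2l ?invr_ge0//.
by apply: ler_wpM2l => //; rewrite invr_ge0 exprn_ge0// ltW.
Qed.

End kernel_estimator_risk.

(** * Aggregation *)

Section projection.
Context d (T : measurableType d) (R : realType) (mu : {measure set T -> \bar R}).
Implicit Types (f g u : T -> R) (s : seq (T -> R)).

Definition inner f g : R := \int[mu]_x (f x * g x).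

(** Combinations are taken as functions, not up to null sets, since they are evaluated at validation
    points; the recursion matches an orthogonalisation that adds one generator at a time. *)
Fixpoint in_span s f : Prop :=
  if s is u :: s' then exists a g, in_span s' g /\ f = (fun x => a * u x + g x)
  else f = fun=> 0.

Fixpoint allL2 s : Prop := if s is u :: s' then isL2 mu u /\ allL2 s' else True.

Lemma in_span_isL2 s f : allL2 s -> in_span s f -> isL2 mu f.
Proof.
elim: s f => [|u s IH] f /=; first by move=> _ ->; exact: isL20.
move=> [hu hs] [a [g [sg ->]]]; apply: isL2D; [exact: isL2Z|exact: IH].
Qed.

Lemma in_span_lin s f g a b : in_span s f -> in_span s g ->
  in_span s (fun x => a * f x + b * g x).
Proof.
elim: s f g => [|u s IH] f g /=.
  by move=> -> ->; apply/funext => x; rewrite !mulr0 addr0.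
move=> [a1 [g1 [s1 ->]]] [a2 [g2 [s2 ->]]].
exists (a * a1 + b * a2), (fun x => a * g1 x + b * g2 x); split; first exact: IH.
by apply/funext => x; ring.
Qed.

Lemma innerC f g : inner f g = inner g f.
Proof. by apply: eq_Rintegral => x _; rewrite mulrC. Qed.

Lemma inner_lin f1 f2 g a b : isL2 mu f1 -> isL2 mu f2 -> isL2 mu g ->
  inner (fun x => a * f1 x + b * f2 x) g = a * inner f1 g + b * inner f2 g.
Proof.
move=> h1 h2 hg; rewrite /inner.
transitivity (\int[mu]_x (a * (f1 x * g x) + b * (f2 x * g x))).
  by apply: eq_Rintegral => x _; ring.
rewrite RintegralD//; last 2 first.
- exact/integrableMl_cst/isL2M.
- exact/integrableMl_cst/isL2M.
by rewrite !RintegralZl//; exact: isL2M.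
Qed.

Lemma inner_self f : inner f f = sqnorm mu f.
Proof. by []. Qed.

Lemma inner_eq0 f g : isL2 mu f -> isL2 mu g -> sqnorm mu f = 0 -> inner f g = 0.
Proof.
move=> hf hg f0; have := cauchy_schwarz hf hg; rewrite f0 mul0r => h.
by apply/eqP; rewrite -sqrf_eq0 eq_le h sqr_ge0.
Qed.

Lemma inner0 f : inner f (fun=> 0) = 0.
Proof.
rewrite /inner /Rintegral (_ : (fun x => (f x * 0)%:E) = fun=> 0%E) ?integral0//.
by apply/funext => x; rewrite mulr0.
Qed.

(** Gram-Schmidt: project on the span of the tail, then on the part [r] of the new generator
    orthogonal to it. The generators may be dependent. *)
Lemma span_projection s q : allL2 s -> isL2 mu q ->
  exists2 g, in_span s g & forall f, in_span s f -> inner (fun x => q x - g x) f = 0.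
Proof.
elim: s q => [|u s IH] q /=.
  move=> _ hq; exists (fun=> 0) => // f ->.
  exact: inner0.
move=> [hu hs] hq.
have [gu sgu ou] := IH u hs hu.
have [gq sgq oq] := IH q hs hq.
have hgu := in_span_isL2 hs sgu; have hgq := in_span_isL2 hs sgq.
pose r x := u x - gu x.
have hr : isL2 mu r by exact: isL2B.
(* If [r] is null, division by 0 gives [c = 0], and orthogonality to [r] comes from [inner_eq0]. *)
pose c := inner q r / sqnorm mu r.
exists (fun x => c * u x + (1 * gq x + - c * gu x)).
  by exists c, (fun x => 1 * gq x + - c * gu x); split => //; exact: in_span_lin.
move=> f [a [g [sg ->]]]; have hg := in_span_isL2 hs sg.
have sg' : in_span s (fun x => 1 * g x + a * gu x) by exact: in_span_lin.
set g' := fun x => 1 * g x + a * gu x in sg'.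
have hg' := in_span_isL2 hs sg'.
have -> : (fun x => a * u x + g x) = (fun x => a * r x + 1 * g' x).
  by apply/funext => x; rewrite /r /g'; ring.
set e := fun x => q x - gq x.
have he : isL2 mu e by exact: isL2B.
have -> : (fun x => q x - (c * u x + (1 * gq x + - c * gu x))) = (fun x => 1 * e x + - c * r x).
  by apply/funext => x; rewrite /e /r; ring.
have hL : isL2 mu (fun x => 1 * e x + - c * r x) by apply: isL2D; exact: isL2Z.
rewrite innerC inner_lin// !(innerC _ (fun x => 1 * e x + - c * r x)) !inner_lin//.
have ou' f' : in_span s f' -> inner r f' = 0 by exact: ou.
have oq' f' : in_span s f' -> inner e f' = 0 by exact: oq.
rewrite (oq' _ sg') (ou' _ sg') !mulr0 addr0 mulr0 addr0.
have -> : inner e r = inner q r.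
  have -> : inner e r = inner (fun x => 1 * q x + -1 * gq x) r.
    by congr inner; apply/funext => x; rewrite /e; ring.
  by rewrite inner_lin// (innerC gq) (ou' _ sgq) mulr0 addr0 mul1r.
rewrite inner_self /c.
have [r0|r0] := eqVneq (sqnorm mu r) 0.
  by rewrite r0 innerC inner_eq0// mulr0 !mul0r ?mulr0 addr0 mulr0.
by rewrite mul1r mulNr divfK// subrr mulr0.
Qed.

End projection.

(** * Deviations of the validation mean over a span *)

Section vdev.
Context {R : realType} {d : nat} (p : density R d).
Notation mu := (leb R d).
Notation law := (density_law p).
Context (L : R).
Hypothesis pL : {ae mu, forall x, p x <= L}.
Hypothesis p2 : isL2 mu p.

Definition vdev n (Y : n.-tuple (Rvec R d)) (V : {set 'I_n}) (f : Rvec R d -> R) : R :=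
  sample_mean Y V f - inner mu f p.

Lemma vdev_lin n (Y : n.-tuple (Rvec R d)) V f g a b : isL2 mu f -> isL2 mu g ->
  vdev Y V (fun x => a * f x + b * g x) = a * vdev Y V f + b * vdev Y V g.
Proof.
move=> hf hg; rewrite /vdev inner_lin//.
have -> : sample_mean Y V (fun x => a * f x + b * g x) = a * sample_mean Y V f + b * sample_mean Y V g.
  by rewrite /sample_mean big_split/= -!mulr_sumr; ring.
by ring.
Qed.

Lemma vdev_lincomb n (Y : n.-tuple (Rvec R d)) V (I : finType) (c : I -> R) (q : I -> Rvec R d -> R) :
  (forall i, isL2 mu (q i)) -> vdev Y V (lincomb c q) = \sum_i c i * vdev Y V (q i).
Proof.
move=> hq; rewrite /lincomb.
elim: (index_enum I) => [|i r IH].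
  rewrite big_nil.
  rewrite (_ : (fun x => _) = fun=> 0); last by apply/funext => x; rewrite big_nil.
  rewrite /vdev innerC inner0 subr0 /sample_mean big1 ?mulr0//.
rewrite big_cons -IH.
rewrite (_ : (fun x => _) = (fun x => c i * q i x + 1 * (\sum_(j <- r) c j * q j x))); last first.
  by apply/funext => x; rewrite big_cons mul1r.
rewrite vdev_lin ?mul1r//.
by apply: isL2_sum => j _; exact: isL2Z.
Qed.

Lemma measurable_vdev n (V : {set 'I_n}) f : measurable_fun setT f ->
  measurable_fun setT (fun Y : n.-tuple (Rvec R d) => vdev Y V f).
Proof.
move=> mf; apply: measurable_funB; last exact: measurable_cst.
apply: measurable_funM; first exact: measurable_cst.
rewrite (_ : (fun z => _) = (fun z : n.-tuple (Rvec R d) => \sum_(i < n) if i \in V then f (tnth z i) else 0)); last first.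
  by apply/funext => z; rewrite big_mkcond.
apply: measurable_sum => i; case: (i \in V); last exact: measurable_cst.
by apply: (measurableT_comp mf); exact: measurable_tnth.
Qed.

Lemma vdev_variance n (V : {set 'I_n}) f : isL2 mu f -> (0 < #|V|)%N ->
  (\int[iid_law p n]_Y (vdev Y V f ^+ 2)%:E <= (L / #|V|%:R * sqnorm mu f)%:E)%E.
Proof.
move=> hf V0; have [hl hlb] := isL2_law pL hf.
apply: (@le_trans _ _ (0 ^+ 2 + #|V|%:R^-1 * sqnorm law f)%:E).
  apply: le_trans (sample_mean_variance 0 hl V0); apply: ge0_le_integralT => Y.
    by rewrite lee_fin sqr_ge0.
  by rewrite add0r.
by rewrite expr0n add0r lee_fin [leRHS]mulrAC [leRHS]mulrC ler_wpM2l ?invr_ge0.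
Qed.

(** Along a new orthogonal direction [r], the supremum over [a] of [2 a v(r) - a^2 |r|^2] is
    [v(r)^2 / |r|^2], of mean at most [L / |V|]; by orthogonality the directions add up. [Z] is a
    measurable majorant of the supremum over the whole span. *)
Lemma excess_bound n (V : {set 'I_n}) (s : seq (Rvec R d -> R)) : allL2 mu s -> (0 < #|V|)%N ->
  exists Z : n.-tuple (Rvec R d) -> \bar R,
    [/\ measurable_fun setT Z, forall Y, (0 <= Z Y)%E,
        (\int[iid_law p n]_Y Z Y <= ((size s)%:R * (L / #|V|%:R))%:E)%E &
        forall Y f, in_span s f -> ((2 * vdev Y V f - sqnorm mu f)%:E <= Z Y)%E].
Proof.
move=> + V0; elim: s => [|u s IH] /=.
  move=> _; exists (fun=> 0%E); split => //.
  - by rewrite integral0 mul0r.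
  - move=> Y f ->; rewrite lee_fin /sqnorm.
    rewrite /vdev innerC inner0 subr0 /sample_mean big1// mulr0 mulr0 sub0r oppr_le0.
    exact: Rintegral_ge0.
move=> [hu hs]; have [Z [mZ Z0 iZ bZ]] := IH hs.
have [g sg og] := span_projection hs hu; have hg := in_span_isL2 hs sg.
pose r x := u x - g x.
have hr : isL2 mu r by exact: isL2B.
(* If r is null, the weight +oo makes the bound hold for every Y, and not only
   for almost every Y, without changing the integral. *)
pose k : \bar R := if sqnorm mu r == 0 then +oo%E else ((sqnorm mu r)^-1)%:E.
have k0 : (0 <= k)%E by rewrite /k; case: ifP => // _; rewrite lee_fin invr_ge0 sqnorm_ge0.
pose Zr (Y : n.-tuple (Rvec R d)) : \bar R := (k * (vdev Y V r ^+ 2)%:E)%E.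
have Zr0 Y : (0 <= Zr Y)%E by apply: mule_ge0 => //; rewrite lee_fin sqr_ge0.
have mv2 : measurable_fun setT (fun Y : n.-tuple (Rvec R d) => (vdev Y V r ^+ 2)%:E).
  by apply/measurable_EFinP; apply: measurable_funX; apply: measurable_vdev; exact: hr.1.
have mZr : measurable_fun setT Zr by apply: emeasurable_funM => //; exact: measurable_cst.
exists (fun Y => Zr Y + Z Y)%E; split.
- exact: emeasurable_funD.
- by move=> Y; exact: adde_ge0.
- rewrite ge0_integralD//.
  have -> : ((size s).+1%:R * (L / #|V|%:R))%:E = ((L / #|V|%:R)%:E + ((size s)%:R * (L / #|V|%:R))%:E)%E.
    by rewrite -EFinD -natr1 mulrDl mul1r addrC.
  apply: leeD => //.
  rewrite ge0_integralZl//; last by move=> Y _; rewrite lee_fin sqr_ge0.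
  apply: (@le_trans _ _ (k * (L / #|V|%:R * sqnorm mu r)%:E)%E).
    by apply: lee_wpmul2l => //; exact: vdev_variance.
  have LV : 0 <= L / #|V|%:R by rewrite divr_ge0// (pdf_sup_ge0 pL).
  rewrite /k; case: eqVneq => [->|r0]; first by rewrite mulr0 mule0 lee_fin.
  by rewrite -EFinM lee_fin mulrCA mulVf// mulr1.
- move=> Y f [a [f' [sf' ->]]].
  have hf' := in_span_isL2 hs sf'.
  have sg' : in_span s (fun x => 1 * f' x + a * g x) by exact: in_span_lin.
  set g' := fun x => 1 * f' x + a * g x in sg'.
  have hg' := in_span_isL2 hs sg'.
  have -> : (fun x => a * u x + f' x) = (fun x => a * r x + 1 * g' x).
    by apply/funext => x; rewrite /r /g'; ring.
  rewrite vdev_lin//.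
  have hra := isL2Z a hr; have hg1 := isL2Z 1 hg'.
  rewrite sqnormD// !sqnormZ//.
  have -> : \int[mu]_x (a * r x * (1 * g' x)) = 0.
    transitivity (\int[mu]_x (a * (r x * g' x))).
      by apply: eq_Rintegral => x _; ring.
    have e0 : \int[mu]_x (r x * g' x) = 0 by exact: og.
    by rewrite RintegralZl ?e0 ?mulr0//; exact: isL2M.
  have -> : 2 * (a * vdev Y V r + 1 * vdev Y V g') - (a ^+ 2 * sqnorm mu r + 2 * 0 + 1 ^+ 2 * sqnorm mu g') =
    (2 * a * vdev Y V r - a ^+ 2 * sqnorm mu r) + (2 * vdev Y V g' - sqnorm mu g') by ring.
  rewrite EFinD; apply: leeD; last exact: bZ.
  rewrite /Zr /k; case: eqVneq => [->|r0].
    rewrite mulr0 subr0; have [->|v0] := eqVneq (vdev Y V r) 0.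
      by rewrite mulr0 expr0n mule0.
    by rewrite gt0_mulye ?leey// lte_fin exprn_even_gt0.
  have r1 : 0 < sqnorm mu r by rewrite lt_neqAle eq_sym r0 sqnorm_ge0.
  rewrite -EFinM lee_fin -subr_ge0.
  have -> : (sqnorm mu r)^-1 * vdev Y V r ^+ 2 - (2 * a * vdev Y V r - a ^+ 2 * sqnorm mu r) =
    (sqnorm mu r)^-1 * (vdev Y V r - a * sqnorm mu r) ^+ 2 by field.
  by rewrite mulr_ge0 ?invr_ge0 ?sqr_ge0 ?ltW.
Qed.

End vdev.

Section merge.
Context d (T : measurableType d) (R : realType).
Context (mu : {sigma_finite_measure set T -> \bar R}).
Hypothesis mu1 : mu setT = 1%E.

(* The observations of X at the indices in A, those of Y elsewhere: merging
   independent samples lets one integrate over the validation sample with the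
   training sample fixed. *)
Definition merge n (A : pred 'I_n) (X Y : n.-tuple T) : n.-tuple T :=
  [tuple if A i then tnth X i else tnth Y i | i < n].

Lemma measurable_merge n (A : pred 'I_n) d' (U : measurableType d') (f g : U -> n.-tuple T) :
  measurable_fun setT f -> measurable_fun setT g ->
  measurable_fun setT (fun z => merge A (f z) (g z)).
Proof.
move=> mf mg; apply/measurable_fun_tnthP => i.
rewrite (_ : _ \o _ = fun z => if A i then tnth (f z) i else tnth (g z) i); last first.
  by apply/funext => z; rewrite /= tnth_mktuple.
by case: (A i); apply: (measurableT_comp (measurable_tnth i)).
Qed.

Lemma merge_cons n (A : pred 'I_n.+1) x y (X Y : n.-tuple T) :
  merge A (cons_pair (x, X)) (cons_pair (y, Y)) =
  cons_pair (if A ord0 then x else y, merge (fun i => A (lift ord0 i)) X Y).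
Proof.
apply: eq_from_tnth => i; case: (unliftP ord0 i) => [j|] ->.
  by rewrite tnth_mktuple !tnth_cons_pairS tnth_mktuple.
by rewrite tnth_mktuple !tnth_cons_pair0.
Qed.

Lemma integral_merge n (A : pred 'I_n) (F : n.-tuple T -> \bar R) :
  measurable_fun setT F -> (forall X, 0 <= F X)%E ->
  (\int[mpow mu n]_X F X = \int[mpow mu n]_X \int[mpow mu n]_Y F (merge A X Y))%E.
Proof.
elim: n A F => [|n IH] A F mF F0.
  by rewrite !integral_mpow0; congr F; apply: eq_from_tnth; case.
pose A' i := A (lift ord0 i).
have mm (m : nat) (B : pred 'I_m) : measurable_fun setT (fun z : m.-tuple T * m.-tuple T => merge B z.1 z.2).
  by apply: measurable_merge; [exact: measurable_fst|exact: measurable_snd].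
have mFm : measurable_fun setT (fun z : n.+1.-tuple T * n.+1.-tuple T => F (merge A z.1 z.2)).
  exact: (measurableT_comp mF (mm _ A)).
rewrite ge0_integral_mpowS// ge0_integral_mpowS; last 2 first.
- exact: (@measurable_fun_fubini_tonelli_F _ _ _ _ _ (mpow mu n.+1) (fun z : n.+1.-tuple T * n.+1.-tuple T => F (merge A z.1 z.2))).
- by move=> X; apply: integral_ge0.
have mFc z : measurable_fun setT (fun t : n.-tuple T => F (cons_pair (z, t))).
  apply: (measurableT_comp mF); apply: (measurableT_comp (@measurable_cons_pair _ T n)).
  exact: pair1_measurable.
have mFc2 : measurable_fun setT (fun z : T * n.-tuple T => F (cons_pair z)).
  exact: (measurableT_comp mF (@measurable_cons_pair _ T n)).
have step x X : (\int[mpow mu n.+1]_Y F (merge A (cons_pair (x, X)) Y) =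
  \int[mu]_y \int[mpow mu n]_Y F (cons_pair (if A ord0 then x else y, merge A' X Y)))%E.
  rewrite ge0_integral_mpowS//; last first.
    by apply: (measurableT_comp mF); apply: measurable_merge; [exact: measurable_cst|exact: measurable_id].
  by apply: eq_integral => y _; apply: eq_integral => Y _; rewrite merge_cons.
case: (boolP (A ord0)) => A0.
  apply: eq_integral => x _; rewrite (IH A')//; apply: eq_integral => X _.
  by rewrite step A0 integral_cst1.
transitivity (\int[mu]_y \int[mpow mu n]_X \int[mpow mu n]_Y F (cons_pair (y, merge A' X Y)))%E.
  by apply: eq_integral => y _; rewrite (IH A').
pose G (z : T * n.-tuple T) := (\int[mpow mu n]_Y F (cons_pair (z.1, merge A' z.2 Y)))%E.
have mG : measurable_fun setT G.
  apply: (@measurable_fun_fubini_tonelli_F _ _ _ _ _ (mpow mu n) (fun z : (T * n.-tuple T) * n.-tuple T => F (cons_pair (z.1.1, merge A' z.1.2 z.2)))) => //.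
  apply: (measurableT_comp mFc2); apply: measurable_fun_pair.
    by apply: (measurableT_comp measurable_fst); exact: measurable_fst.
  apply: measurable_merge; last exact: measurable_snd.
  by apply: (measurableT_comp measurable_snd); exact: measurable_fst.
have G0 z : (0 <= G z)%E by apply: integral_ge0.
transitivity (\int[mpow mu n]_X \int[mu]_y G (y, X))%E.
  by rewrite -(@fubini_tonelli1 _ _ _ _ _ mu (mpow mu n) G)// -(@fubini_tonelli2 _ _ _ _ _ mu (mpow mu n) G).
rewrite -[LHS](integral_cst1 _ mu1).
apply: eq_integral => x _; apply: eq_integral => X _.
by rewrite step (negbTE A0).
Qed.

End merge.

Section measurable_param.
Context d1 d2 (T1 : measurableType d1) (T2 : measurableType d2) (R : realType).
Context (m2 : {sigma_finite_measure set T2 -> \bar R}).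

Lemma measurable_Rintegral (F : T1 * T2 -> R) : measurable_fun setT F ->
  measurable_fun setT (fun x => \int[m2]_y F (x, y)).
Proof.
move=> mF; apply: (measurableT_comp (fine_measurable measurableT)).
have mE : measurable_fun setT (EFin \o F) by exact/measurable_EFinP.
rewrite (_ : (fun x => _) = (fun x => \int[m2]_y (EFin \o F)^\+ (x, y) - \int[m2]_y (EFin \o F)^\- (x, y))%E); last first.
  apply/funext => x; rewrite integralE; congr (_ - _)%E; apply: eq_integral => y _.
    by rewrite !funeposE.
  by rewrite !funenegE.
apply: emeasurable_funB.
  apply: (@measurable_fun_fubini_tonelli_F _ _ _ _ _ m2 ((EFin \o F)^\+)%E) => [|z]; last exact: funepos_ge0.
  exact: measurable_funepos.
apply: (@measurable_fun_fubini_tonelli_F _ _ _ _ _ m2 ((EFin \o F)^\-)%E) => [|z]; last exact: funeneg_ge0.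
exact: measurable_funeneg.
Qed.

Lemma mpow_setT (mu : {sigma_finite_measure set T1 -> \bar R}) n :
  mu setT = 1%E -> mpow mu n setT = 1%E.
Proof.
move=> mu1; elim: n => [|n IH]; first by rewrite /= diracT.
rewrite -[LHS]mul1e -(integral_cst (mpow mu n.+1) measurableT 1%E).
rewrite ge0_integral_mpowS//.
transitivity (\int[mu]_x 1)%E; last exact: integral_cst1.
by apply: eq_integral => x _; exact: (integral_cst1 1%E IH).
Qed.

End measurable_param.

Section lincomb.
Context {R : realType} {d : nat} (I : finType).
Notation mu := (leb R d).
Implicit Types (c : I -> R) (q : I -> Rvec R d -> R).

Lemma isL2_lincomb c q : (forall i, isL2 mu (q i)) -> isL2 mu (lincomb c q).
Proof. by move=> q2; apply: isL2_sum => i _; exact: isL2Z. Qed.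

Lemma inner_lincomb c q f : (forall i, isL2 mu (q i)) -> isL2 mu f ->
  inner mu (lincomb c q) f = \sum_i c i * inner mu (q i) f.
Proof.
move=> q2 hf; rewrite /lincomb; elim: (index_enum I) => [|i r IH].
  rewrite big_nil innerC (_ : (fun x => _) = fun=> 0) ?inner0//.
  by apply/funext => x; rewrite big_nil.
rewrite big_cons -IH.
rewrite (_ : (fun x => _) = (fun x => c i * q i x + 1 * (\sum_(j <- r) c j * q j x))); last first.
  by apply/funext => x; rewrite big_cons mul1r.
rewrite inner_lin ?mul1r//.
by apply: isL2_sum => j _; exact: isL2Z.
Qed.

Lemma sample_mean_lincomb n (Y : n.-tuple (Rvec R d)) V c q :
  sample_mean Y V (lincomb c q) = \sum_i c i * sample_mean Y V (q i).
Proof.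
rewrite /sample_mean /lincomb exchange_big/= mulr_sumr; apply: eq_bigr => i _.
by rewrite -mulr_sumr mulrCA.
Qed.

Lemma lincomb_delta q j : lincomb (fun i => (i == j)%:R) q = q j.
Proof.
apply/funext => x; rewrite /lincomb (bigD1 j)//= eqxx mul1r big1 ?addr0// => i /negbTE ->.
by rewrite mul0r.
Qed.

Lemma lincombB a b q x : lincomb a q x - lincomb b q x = lincomb (fun i => a i - b i) q x.
Proof. by rewrite /lincomb -sumrB; apply: eq_bigr => i _; rewrite mulrBl. Qed.

Lemma lincombZ k a q x : k * lincomb a q x = lincomb (fun i => k * a i) q x.
Proof. by rewrite /lincomb mulr_sumr; apply: eq_bigr => i _; rewrite mulrA. Qed.

Lemma lincomb_lincomb D (b : 'I_D -> R) (cc : 'I_D -> I -> R) q :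
  lincomb b (fun j => lincomb (cc j) q) = lincomb (fun i => \sum_j b j * cc j i) q.
Proof.
apply/funext => x; rewrite /lincomb.
transitivity (\sum_j \sum_i b j * cc j i * q i x).
  by apply: eq_bigr => j _; rewrite mulr_sumr; apply: eq_bigr => i _; rewrite mulrA.
by rewrite exchange_big; apply: eq_bigr => i _; rewrite mulr_suml.
Qed.

End lincomb.

Section excess.
Context {R : realType} {d : nat} (p : density R d).
Notation mu := (leb R d).
Context (L : R) (n : nat) (S : {set 'I_n}) (I : finType).
Context (q : n.-tuple (Rvec R d) -> I -> Rvec R d -> R).
Hypothesis pL : {ae mu, forall x, p x <= L}.
Hypothesis p2 : isL2 mu p.
Hypothesis mq : forall i, measurable_fun setT (fun z : n.-tuple (Rvec R d) * Rvec R d => q z.1 i z.2).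
Hypothesis q2 : forall X i, isL2 mu (q X i).
Hypothesis q_merge : forall X Y, q (merge (mem S) X Y) = q X.
Notation V := (finset.setC S).
Implicit Types (X Y : n.-tuple (Rvec R d)) (c : I -> R).

Definition excess X c : R :=
  2 * vdev p X V (lincomb c (q X)) - sqnorm mu (lincomb c (q X)).

(* Rational coefficients make the supremum measurable in X; see excess_le for
   real ones. *)
Definition max_excess X : \bar R :=
  ereal_sup [set (excess X (fun i => ratr (c i)))%:E | c in [set: {ffun I -> rat}]].

Lemma measurable_lincomb c : measurable_fun setT (fun z : n.-tuple (Rvec R d) * Rvec R d => lincomb c (q z.1) z.2).
Proof. by apply: measurable_sum => i; apply: measurable_funM; [exact: measurable_cst|]. Qed.

Lemma measurable_excess c : measurable_fun setT (fun X => excess X c).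
Proof.
have ml := measurable_lincomb c.
apply: measurable_funB; last first.
  by apply: (@measurable_Rintegral _ _ _ _ _ mu (fun z => lincomb c (q z.1) z.2 ^+ 2)); exact: measurable_funX.
apply: measurable_funM; first exact: measurable_cst.
apply: measurable_funB; last first.
  apply: (@measurable_Rintegral _ _ _ _ _ mu (fun z => lincomb c (q z.1) z.2 * p z.2)).
  by apply: measurable_funM => //; apply: (measurableT_comp (measurable_pdf p)); exact: measurable_snd.
apply: measurable_funM; first exact: measurable_cst.
rewrite (_ : (fun z => _) = (fun z : n.-tuple (Rvec R d) => \sum_(i < n) if i \in V then lincomb c (q z) (tnth z i) else 0)); last first.
  by apply/funext => z; rewrite big_mkcond.
apply: measurable_sum => i; case: (i \in _); last exact: measurable_cst.
have mp : measurable_fun setT (fun X : n.-tuple (Rvec R d) => (X, tnth X i)).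
  by apply: measurable_fun_pair; [exact: measurable_id|exact: measurable_tnth].
exact: (measurableT_comp ml mp).
Qed.

Lemma lincomb0 X : lincomb (fun=> 0) (q X) = fun=> 0.
Proof. by apply/funext => x; rewrite /lincomb big1// => i _; rewrite mul0r. Qed.

Lemma excess0 X : excess X (fun=> 0) = 0.
Proof.
rewrite /excess lincomb0 /vdev innerC inner0 /sample_mean big1// mulr0 subr0 mulr0 sub0r.
by rewrite -inner_self inner0 oppr0.
Qed.

Lemma max_excess_ge0 X : (0 <= max_excess X)%E.
Proof.
apply: ereal_sup_ubound; exists [ffun=> 0] => //.
have -> : (fun i => ratr ([ffun=> 0] i)) = (fun=> 0) :> (I -> R).
  by apply/funext => i; rewrite ffunE raddf0.
by rewrite excess0.
Qed.

Lemma measurable_max_excess : measurable_fun setT max_excess.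
Proof.
(* Rational coefficient vectors are countable: the supremum is taken over their codes, with [-oo] at
   the integers that code nothing. *)
pose f (k : nat) X : \bar R :=
  if @unpickle {ffun I -> rat} k is Some c then (excess X (fun i => ratr (c i)))%:E else -oo%E.
have mf k : measurable_fun setT (f k).
  rewrite /f; case: unpickle => [c|]; last exact: measurable_cst.
  by apply/measurable_EFinP; exact: measurable_excess.
have -> : max_excess = (fun X => esups (f ^~ X) 0%N); last exact: measurable_fun_esups.
apply/funext => X; rewrite /max_excess /esups /sdrop; apply/eqP; rewrite eq_le; apply/andP; split.
  apply: ub_ereal_sup => _ [c _ <-]; apply: ereal_sup_ubound; exists (pickle c) => //.
  by rewrite /f pickleK.
apply: ub_ereal_sup => _ [k _ <-]; rewrite /f; case: unpickle => [c|]; last exact: leNye.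
by apply: ereal_sup_ubound; exists c.
Qed.

Lemma lincomb_in_span X c : in_span [seq q X i | i <- enum I] (lincomb c (q X)).
Proof.
have -> : lincomb c (q X) = fun x => \sum_(i <- enum I) c i * q X i x.
  by apply/funext => x; rewrite /lincomb big_enum.
elim: (enum I) => [|i r IH] /=; first by apply/funext => x; rewrite big_nil.
exists (c i), (fun x => \sum_(j <- r) c j * q X j x); split => //.
by apply/funext => x; rewrite big_cons.
Qed.

Lemma allL2_map X (r : seq I) : allL2 mu [seq q X i | i <- r].
Proof. by elim: r => //= i r IH; split. Qed.

Lemma vdev_merge X Y f : vdev p (merge (mem S) X Y) V f = vdev p Y V f.
Proof.
congr (_ * _ - _); apply: eq_bigr => i; rewrite finset.in_setC => /negbTE iS.
by rewrite tnth_mktuple /= iS.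
Qed.

(** Once [merge] has fixed the training observations, the family is deterministic, and
    [excess_bound] applies to the validation observations. *)
Lemma integral_max_excess : (0 < #|V|)%N ->
  (\int[iid_law p n]_X max_excess X <= (#|I|%:R * (L / #|V|%:R))%:E)%E.
Proof.
move=> V0; rewrite /iid_law (integral_merge (law_setT p) (mem S) measurable_max_excess max_excess_ge0).
apply: (@le_trans _ _ (\int[mpow (density_law p) n]_X (#|I|%:R * (L / #|V|%:R))%:E)%E); last first.
  by rewrite integral_cst1//; exact: (mpow_setT n (law_setT p)).
apply: ge0_le_integralT => X; first by apply: integral_ge0 => Y _; exact: max_excess_ge0.
have [Z [mZ Z0 iZ bZ]] := excess_bound pL p2 (allL2_map X (enum I)) V0.
apply: le_trans (_ : \int[mpow (density_law p) n]_Y Z Y <= _)%E; last first.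
  by move: iZ; rewrite size_map -cardE.
apply: ge0_le_integralT => Y; first exact: max_excess_ge0.
apply: ub_ereal_sup => _ [c _ <-]; rewrite /excess q_merge vdev_merge.
by apply: bZ; exact: lincomb_in_span.
Qed.

Lemma excess_poly X c : excess X c =
  2 * (\sum_i c i * vdev p X V (q X i)) - \sum_i c i * (\sum_j c j * inner mu (q X j) (q X i)).
Proof.
rewrite /excess (vdev_lincomb p2)// -inner_self inner_lincomb//; last exact: isL2_lincomb.
by congr (_ - _); apply: eq_bigr => i _; rewrite innerC inner_lincomb.
Qed.

Lemma rat_approx (x : R) : exists r : nat -> rat, ratr (r k) @[k --> \oo] --> x.
Proof.
have h k : exists r : rat, `|ratr r - x| < k.+1%:R^-1.
  have : x - k.+1%:R^-1 < x + k.+1%:R^-1 by rewrite ltrBlDr -addrA ltrDl addr_gt0// invr_gt0.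
  move=> /rat_in_itvoo[r]; rewrite in_itv/= => /andP[r1 r2]; exists r.
  by rewrite ltr_distl r1.
have [r hr] := choice h; exists r.
apply/cvgrPdist_le => e e0.
have [N _ hN] : \forall k \near \oo, (k.+1%:R^-1 : R) <= e.
  have := @cvg_harmonic R; move=> /cvgr0Pnorm_le /(_ e e0); apply: filterS => k.
  by rewrite /harmonic/= ger0_norm// invr_ge0.
by exists N => // k /= Nk; rewrite distrC; apply: le_trans (ltW (hr k)) _; exact: hN.
Qed.

(** By [excess_poly] the excess is a polynomial in the coefficients, so a bound at rational vectors
    extends to real ones by continuity. *)
Lemma excess_le X (w : R) c : (max_excess X <= w%:E)%E -> excess X c <= w.
Proof.
move=> hw.
have [r hr] := choice (fun i => rat_approx (c i)).
have he k : excess X (fun i => ratr (r i k)) <= w.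
  rewrite -lee_fin; apply: le_trans hw; apply: ereal_sup_ubound; exists [ffun i => r i k] => //.
  by congr (excess X _)%:E; apply/funext => i; rewrite ffunE.
have hc : excess X (fun i => ratr (r i k)) @[k --> \oo] --> excess X c.
  rewrite excess_poly.
  have -> : (fun k => excess X (fun i => ratr (r i k))) = (fun k => 2 * (\sum_i ratr (r i k) * vdev p X V (q X i)) - \sum_i ratr (r i k) * (\sum_j ratr (r j k) * inner mu (q X j) (q X i))).
    by apply/funext => k; exact: excess_poly.
  apply: cvgB.
    apply: cvgMr; apply: (cvg_big add_continuous) => i _; apply: cvgMl; exact: hr.
  apply: (cvg_big add_continuous) => i _; apply: cvgM; first exact: hr.
  apply: (cvg_big add_continuous) => j _; apply: cvgMl; exact: hr.
rewrite -(cvg_lim _ hc)//; apply: limr_le; first by apply/cvg_ex; exists (excess X c).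
by apply: nearW => k; exact: he.
Qed.

End excess.

(** Here [A = |f - p|^2], [B = |q - p|^2], [z = |f - q|^2]. The excess at [(f - q) / s] gives
    [2 s (vf - vq) <= s^2 w + z], the criterion gives [A - B <= 2 (vf - vq)], and together
    [(s - 2) A <= (s + 2) B + s^2 w]. *)
Lemma oracle_arith (R : realFieldType) (s w z vf vq P A B : R) : 2 < s ->
  z <= 2 * A + 2 * B -> A - P - 2 * vf <= B - P - 2 * vq ->
  2 * (s^-1 * vf + - s^-1 * vq) - s^-1 ^+ 2 * z <= w ->
  A <= (s + 2) / (s - 2) * B + s ^+ 2 / (s - 2) * w.
Proof.
move=> s2 h1 hcrit h2; have s0 : 0 < s by apply: lt_trans s2.
have s20 : 0 < s - 2 by rewrite subr_gt0.
have h3 : 2 * (vf - vq) * s <= s ^+ 2 * w + z.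
  have -> : 2 * (vf - vq) * s = s ^+ 2 * (2 * (s^-1 * vf + - s^-1 * vq) - s^-1 ^+ 2 * z) + z.
    by field; rewrite gt_eqF.
  by rewrite lerD2r ler_wpM2l// sqr_ge0.
have h4 : (A - B) * s <= 2 * (vf - vq) * s by apply: ler_wpM2r; [exact: ltW|lra].
have -> : (s + 2) / (s - 2) * B + s ^+ 2 / (s - 2) * w = (s - 2)^-1 * ((s + 2) * B + s ^+ 2 * w) by ring.
rewrite ler_pdivlMl//.
have -> : (s - 2) * A = A * s - 2 * A by ring.
have -> : (s + 2) * B = B * s + 2 * B by ring.
rewrite mulrBl in h4; move: h3 h4.
move: (2 * _ * s) (s ^+ 2 * w) (A * s) (B * s) => t1 t2 t3 t4 h3 h4.
by lra.
Qed.

Section oracle.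
Context {R : realType} {d : nat} (p : density R d).
Notation mu := (leb R d).
Context (n : nat) (S : {set 'I_n}) (I : finType).
Context (q : n.-tuple (Rvec R d) -> I -> Rvec R d -> R).
Hypothesis p2 : isL2 mu p.
Hypothesis q2 : forall X i, isL2 mu (q X i).
Notation V := (finset.setC S).
Implicit Types (X Y : n.-tuple (Rvec R d)) (c : I -> R).

Notation excess := (excess p S q).
Notation max_excess := (max_excess p S q).

Definition crit X (f : Rvec R d -> R) : R := sqnorm mu f - 2 * sample_mean X V f.

Lemma sqnormB (f g : Rvec R d -> R) : isL2 mu f -> isL2 mu g ->
  sqnorm mu (fun x => f x - g x) = sqnorm mu f - 2 * inner mu f g + sqnorm mu g.
Proof.
move=> hf hg; have := sqnormD hf (isL2Z (-1) hg).
rewrite sqnormZ// sqrrN expr1n mul1r.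
have -> : (fun x => f x + -1 * g x) = (fun x => f x - g x) by apply/funext => x; rewrite mulN1r.
move=> ->; congr (_ + _ + _); rewrite -mulrN; congr (_ * _).
transitivity (\int[mu]_x (-1 * (f x * g x))).
  by apply: eq_Rintegral => x _; ring.
by rewrite RintegralZl ?isL2M// mulN1r.
Qed.

Lemma critE X f : isL2 mu f ->
  crit X f = sqnorm mu (fun x => f x - p x) - sqnorm mu p - 2 * vdev p X V f.
Proof. by move=> hf; rewrite /crit /vdev sqnormB//; ring. Qed.

(* An orthonormal basis expresses the q_i only almost everywhere, which says
   nothing at the validation points; a finite maximal excess does. *)
Lemma null_vdev X (w : R) c : (max_excess X <= w%:E)%E ->
  sqnorm mu (lincomb c (q X)) = 0 -> sample_mean X V (lincomb c (q X)) = 0.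
Proof.
move=> hw c0.
have hl : isL2 mu (lincomb c (q X)) by exact: isL2_lincomb.
have h t : 2 * t * vdev p X V (lincomb c (q X)) <= w.
  have := excess_le p2 q2 (fun i => t * c i) hw.
  rewrite /excess.
  have -> : lincomb (fun i => t * c i) (q X) = (fun x => t * lincomb c (q X) x + 0 * lincomb c (q X) x).
    by apply/funext => x; rewrite mul0r addr0 lincombZ.
  rewrite (vdev_lin p2)// mul0r addr0.
  have -> : (fun x => t * lincomb c (q X) x + 0 * lincomb c (q X) x) = (fun x => t * lincomb c (q X) x).
    by apply/funext => x; rewrite mul0r addr0.
  by rewrite sqnormZ// c0 mulr0 subr0 mulrA.
have v0 : vdev p X V (lincomb c (q X)) = 0.
  apply/eqP; apply/negPn/negP => v0.
  (* This multiple brings the left-hand side to [w + 1]. *)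
  have := h ((w + 1) / (2 * vdev p X V (lincomb c (q X)))).
  have -> : 2 * ((w + 1) / (2 * vdev p X V (lincomb c (q X)))) * vdev p X V (lincomb c (q X)) = w + 1.
    by field.
  by rewrite gerDl ler10.
by move: v0; rewrite /vdev inner_eq0// subr0.
Qed.

Lemma sqnorm_orthonormal D (phi : 'I_D -> Rvec R d -> R) (b : 'I_D -> R) :
  (forall j, isL2 mu (phi j)) ->
  (forall j k, \int[mu]_x (phi j x * phi k x) = (j == k)%:R) ->
  sqnorm mu (lincomb b phi) = \sum_j b j ^+ 2.
Proof.
move=> h2 ho; rewrite -inner_self inner_lincomb//; last exact: isL2_lincomb.
apply: eq_bigr => j _; rewrite innerC inner_lincomb//.
rewrite (bigD1 j)//= big1 => [|k /negbTE kj]; last by rewrite /inner ho kj mulr0.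
by rewrite /inner ho eqxx mulr1 addr0.
Qed.

Lemma sqnorm_ae (f g : Rvec R d -> R) : measurable_fun setT f -> measurable_fun setT g ->
  {ae mu, forall x, f x = g x} -> sqnorm mu f = sqnorm mu g.
Proof.
move=> mf mg h; rewrite /sqnorm /Rintegral; congr fine; apply: ae_eq_integral => //.
- exact/measurable_EFinP/measurable_funX.
- exact/measurable_EFinP/measurable_funX.
- by apply: filterS h => x -> _.
Qed.

(** In an orthonormal basis the criterion of a coefficient vector [a] exceeds that of the empirical
    means [b] by the sum of the squares [(a_j - b_j)^2]. *)
Lemma linear_crit X (w : R) f j0 : (max_excess X <= w%:E)%E ->
  is_linear_aggregate X V (q X) f ->
  exists c, f = lincomb c (q X) /\ crit X f <= crit X (q X j0).
Proof.
move=> hw [D [phi [[phiL ho hc hq] ->]]].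
have h2 j : isL2 mu (phi j) by exact: Lfun2_isL2.
have [cc hcc] := choice hc.
have phiE : phi = fun j => lincomb (cc j) (q X) by apply/funext => j; exact: hcc.
set b := fun j => sample_mean X V (phi j).
exists (fun i => \sum_j b j * cc j i); split; first by rewrite {1}phiE lincomb_lincomb.
rewrite /crit sqnorm_orthonormal// sample_mean_lincomb.
have [a ha] := hq j0.
have hg : isL2 mu (lincomb a phi) by exact: isL2_lincomb.
have e2 : sqnorm mu (q X j0) = \sum_j a j ^+ 2.
  rewrite -(sqnorm_orthonormal a h2 ho); apply: sqnorm_ae ha; [exact: (q2 X j0).1|exact: hg.1].
(* The gap between [q_j0] and its expansion has null norm; as a combination of the [q_i] it falls
   under [null_vdev], so both have the same mean over the validation sample. *)
pose e := lincomb (fun i => (i == j0)%:R - \sum_j a j * cc j i) (q X).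
have eE x : e x = q X j0 x - lincomb a phi x.
  by rewrite /e -lincombB lincomb_delta -lincomb_lincomb -phiE.
have e0 : sqnorm mu e = 0.
  have -> : e = fun x => q X j0 x - lincomb a phi x by apply/funext.
  have hB := isL2B (q2 X j0) hg.
  rewrite (@sqnorm_ae _ (fun=> 0)) ?measurable_cst//; last 2 first.
  - exact: hB.1.
  - by apply: filterS ha => x ->; rewrite subrr.
  by rewrite -inner_self inner0.
have := null_vdev hw e0; rewrite -/e.
have -> : sample_mean X V e = sample_mean X V (q X j0) - sample_mean X V (lincomb a phi).
  rewrite /sample_mean -mulrBr -sumrB; congr (_ * _); apply: eq_bigr => i _; exact: eE.
move=> /subr0_eq ->; rewrite e2 sample_mean_lincomb -/b.
rewrite -subr_ge0.
have -> : \sum_j a j ^+ 2 - 2 * (\sum_i a i * sample_mean X V (phi i)) -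
  (\sum_j b j ^+ 2 - 2 * (\sum_i b i * sample_mean X V (phi i))) = \sum_j (a j - b j) ^+ 2.
  rewrite !mulr_sumr -!sumrB; apply: eq_bigr => j _; rewrite -/(b j); ring.
by apply: sumr_ge0 => j _; exact: sqr_ge0.
Qed.

Lemma convex_crit X f j0 : is_convex_aggregate X V (q X) f ->
  exists c, f = lincomb c (q X) /\ crit X f <= crit X (q X j0).
Proof.
move=> [lam [hl hmin ->]]; exists lam; split => //.
have h : convex_weights (fun i => (i == j0)%:R : R).
  by split => [i|]; [exact: ler0n|rewrite (bigD1 j0)//= eqxx big1 ?addr0// => i /negbTE ->].
have := hmin _ h; rewrite /convex_criterion lincomb_delta /L2norm.
rewrite !Lnorm2_sqr//; last exact: isL2_lincomb.
Qed.

Lemma oracle_ineq agg X (w s : R) f j0 : (max_excess X <= w%:E)%E -> 2 < s ->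
  is_aggregate agg X V (q X) f ->
  isL2 mu f /\ sqnorm mu (fun x => f x - p x) <=
    (s + 2) / (s - 2) * sqnorm mu (fun x => q X j0 x - p x) + s ^+ 2 / (s - 2) * w.
Proof.
move=> hw s2 hf.
have [c [fE hcrit]] : exists c, f = lincomb c (q X) /\ crit X f <= crit X (q X j0).
  case: agg hf => /= hf; [exact: linear_crit hw hf|exact: convex_crit hf].
have f2 : isL2 mu f by rewrite fE; exact: isL2_lincomb.
split => //; have hq := q2 X j0.
move: hcrit; rewrite !critE// => hcrit.
have s0 : 0 < s by apply: lt_trans s2.
(* the excess at (f - q_j0) / s *)
have := excess_le p2 q2 (fun i => s^-1 * (c i - (i == j0)%:R)) hw.
rewrite /excess.
have -> : lincomb (fun i => s^-1 * (c i - (i == j0)%:R)) (q X) = (fun x => s^-1 * f x + - s^-1 * q X j0 x).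
  by apply/funext => x; rewrite -lincombZ -lincombB -fE lincomb_delta; ring.
rewrite (vdev_lin p2)//.
have -> : (fun x => s^-1 * f x + - s^-1 * q X j0 x) = (fun x => s^-1 * (f x - q X j0 x)).
  by apply/funext => x; ring.
rewrite sqnormZ; last exact: isL2B.
have hu := isL2B f2 p2; have hv := isL2B hq p2.
have h1 : sqnorm mu (fun x => f x - q X j0 x) <= 2 * sqnorm mu (fun x => f x - p x) + 2 * sqnorm mu (fun x => q X j0 x - p x).
  have := sqnormB hu hv; have := sqnormD hu hv; rewrite -/(inner mu (fun x => f x - p x) (fun x => q X j0 x - p x)).
  have := sqnorm_ge0 mu (fun x => f x - p x + (q X j0 x - p x)).
  have -> : (fun x => f x - p x - (q X j0 x - p x)) = (fun x => f x - q X j0 x).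
    by apply/funext => x; ring.
  move: (sqnorm mu (fun x => f x - p x + (q X j0 x - p x))) => z0.
  move: (sqnorm mu (fun x => f x - q X j0 x)) (inner _ _ _) => z1 z2.
  move: (sqnorm mu (fun x => f x - p x)) (sqnorm mu (fun x => q X j0 x - p x)) => A B.
  by move=> *; lra.
move: h1 hcrit.
move: (sqnorm mu (fun x => f x - q X j0 x)) (vdev p X V f) (vdev p X V (q X j0)) => z vf vq.
move: (sqnorm mu p) (sqnorm mu (fun x => f x - p x)) (sqnorm mu (fun x => q X j0 x - p x)) => P A B.
move=> h1 hcrit h2.
exact: oracle_arith s2 h1 hcrit h2.
Qed.

End oracle.

(** Jensen's inequality, from the nonnegativity of the empirical variance; it reduces the average
    over splits to a single split. *)
Lemma sqr_mean_le (R : realFieldType) (I : finType) (A : {set I}) (u : I -> R) : (0 < #|A|)%N ->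
  (#|A|%:R^-1 * \sum_(i in A) u i) ^+ 2 <= \sum_(i in A) #|A|%:R^-1 * u i ^+ 2.
Proof.
move=> A0; have k0 : #|A|%:R != 0 :> R by rewrite pnatr_eq0 -lt0n.
set k : R := #|A|%:R in k0 *; set m := k^-1 * _.
have hs : \sum_(i in A) u i = k * m by rewrite /m mulVKf.
have : 0 <= \sum_(i in A) k^-1 * (u i - m) ^+ 2.
  by apply: sumr_ge0 => i _; rewrite mulr_ge0 ?sqr_ge0 ?invr_ge0.
have -> : \sum_(i in A) k^-1 * (u i - m) ^+ 2 =
  \sum_(i in A) k^-1 * u i ^+ 2 - 2 * k^-1 * m * (\sum_(i in A) u i) + \sum_(i in A) k^-1 * m ^+ 2.
  by rewrite mulr_sumr -sumrB -big_split/=; apply: eq_bigr => i _; ring.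
rewrite hs sumr_const -[(k^-1 * _) *+ _]mulr_natl -/k.
have -> : k * (k^-1 * m ^+ 2) = m ^+ 2 by rewrite mulVKf.
have -> : 2 * k^-1 * m * (k * m) = 2 * m ^+ 2 by field.
move: (\sum_(i in A) _) (m ^+ 2) => x y; lra.
Qed.

Section integral_sum_cond.
Context d (T : measurableType d) (R : realType) (mu : {measure set T -> \bar R}).

Lemma ge0_integral_sum_cond (I : Type) (r : seq I) (P : pred I) (f : I -> T -> \bar R) :
  (forall i, P i -> measurable_fun setT (f i)) -> (forall i x, P i -> 0 <= f i x)%E ->
  (\int[mu]_x (\sum_(i <- r | P i) f i x) = \sum_(i <- r | P i) \int[mu]_x f i x)%E.
Proof.
move=> mf f0.
transitivity (\int[mu]_x (\sum_(i <- r) (if P i then f i x else 0)))%E.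
  by apply: eq_integral => x _; rewrite big_mkcond.
rewrite ge0_integral_sum//; last 2 first.
- by move=> i; case: (boolP (P i)) => Pi; [exact: mf|exact: measurable_cst].
- by move=> i x _; case: ifPn => // Pi; exact: f0.
rewrite [RHS]big_mkcond; apply: eq_bigr => i _; case: (P i) => //.
exact: integral0.
Qed.

End integral_sum_cond.

(** * Risk of the averaged aggregate *)

Section risk.
Context {R : realType} {d : nat}.
Notation mu := (leb R d).
Implicit Types (x y t : Rvec R d).

Context (p : density R d) (beta Q : R).
Hypothesis d_gt0 : (0 < d)%N.
Hypothesis beta_gt : d%:R / 2 < beta.
Hypothesis hp : Sobolev_class beta Q p.
Context (K : R -> Rvec R d -> R).
Hypothesis K_pinsker : forall b, 0 < b -> is_pinsker_kernel b (K b).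
Context (n N : nat) (a0 : R).
Hypothesis exponent_gt0 : forall k : 'I_N, 0 < pinsker_exponent d N k :> R.
Hypothesis bandwidth_gt0 : forall j : 'I_(grid_size d n a0), 0 < bandwidth d n a0 j.

Let q (S : {set 'I_n}) (X : n.-tuple (Rvec R d)) := kernel_family X (a0 := a0) (N := N) K S.

Lemma isL2_kernel_family S X jk : isL2 mu (q S X jk).
Proof.
apply: isL2Z; apply: isL2_sum => i _; apply: isL2_rescale => //.
by have [] := pinsker_kernelE (exponent_gt0 jk.1) (K_pinsker (exponent_gt0 jk.1)).
Qed.

Lemma measurable_kernel_family S jk : measurable_fun setT
  (fun z : n.-tuple (Rvec R d) * Rvec R d => q S z.1 jk z.2).
Proof.
apply: measurable_kernel_estimator; [|exact: measurable_fst|exact: measurable_snd].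
by have [[]] := pinsker_kernelE (exponent_gt0 jk.1) (K_pinsker (exponent_gt0 jk.1)).
Qed.

Lemma kernel_family_merge S X Y : q S (merge (mem S) X Y) = q S X.
Proof.
apply/funext => jk; apply/funext => x; congr (_ * _); apply: eq_bigr => i iS.
by rewrite tnth_mktuple /= iS.
Qed.

Lemma measurable_loss S jk : measurable_fun setT
  (fun X : n.-tuple (Rvec R d) => \int[mu]_x ((q S X jk x - p x) ^+ 2)%:E)%E.
Proof.
apply: (@measurable_fun_fubini_tonelli_F _ _ _ _ _ mu (fun z : n.-tuple (Rvec R d) * Rvec R d => ((q S z.1 jk z.2 - p z.2) ^+ 2)%:E)).
- apply/measurable_EFinP; apply: measurable_funX; apply: measurable_funB.
    exact: measurable_kernel_family.
  by apply: (measurableT_comp (measurable_pdf p)); exact: measurable_snd.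
- by move=> z; rewrite lee_fin sqr_ge0.
Qed.

(** The oracle inequality holds for every sample with a measurable right-hand side, so only that
    side is integrated and [f] may depend on the sample in any way. *)
Lemma aggregate_risk agg (SS : {set {set 'I_n}}) (m : nat)
    (f : {set 'I_n} -> n.-tuple (Rvec R d) -> Rvec R d -> R) (s : R)
    (jk : 'I_N * 'I_(grid_size d n a0)) :
  SS != finset.set0 -> (forall S, S \in SS -> #|S| = m) -> (0 < m < n)%N ->
  (forall S X, S \in SS -> is_aggregate agg X (finset.setC S) (q S X) (f S X)) ->
  2 < s -> beta <= pinsker_exponent d N jk.1 ->
  (risk (averaged_aggregate SS f) p <=
   ((s + 2) / (s - 2) * (((2 * pi) ^+ d)^-1 * (bandwidth d n a0 jk.2 `^ (2 * beta) * Q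
      + (m%:R * bandwidth d n a0 jk.2 ^+ d)^-1 * sqnorm mu (pinsker (pinsker_exponent d N jk.1))))
    + s ^+ 2 / (s - 2) * ((N * grid_size d n a0)%:R * (pdf_bound d beta Q / (n - m)%:R)))%:E)%E.
Proof.
move=> SS0 SSm /andP[m0 mn] hf s2 bb.
set h := bandwidth d n a0 jk.2.
have kS : (0 < #|SS|)%N by rewrite card_gt0.
have pL := pdf_le d_gt0 beta_gt hp.
have p2 := isL2_pdf d_gt0 beta_gt hp.
set L := pdf_bound d beta Q in pL *.
set a := (s + 2) / (s - 2); set b := s ^+ 2 / (s - 2).
have s0 : 0 < s by apply: lt_trans s2.
have s20 : 0 < s - 2 by rewrite subr_gt0.
have ha : 0 <= a by apply: divr_ge0; [apply: addr_ge0 => //; exact: ltW|exact: ltW].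
have hb : 0 < b by rewrite divr_gt0 ?exprn_gt0.
pose W S := max_excess p S (q S).
pose B S X : \bar R := (\int[mu]_x ((q S X jk x - p x) ^+ 2)%:E)%E.
have W0 S X : (0 <= W S X)%E by exact: max_excess_ge0.
have B0 S X : (0 <= B S X)%E by apply: integral_ge0 => x _; rewrite lee_fin sqr_ge0.
have mW S : measurable_fun setT (W S).
  by apply: measurable_max_excess => jk'; exact: measurable_kernel_family.
have mB S : measurable_fun setT (B S) by exact: measurable_loss.
have loss S X : S \in SS -> isL2 mu (f S X) /\
    (\int[mu]_x ((f S X x - p x) ^+ 2)%:E <= a%:E * B S X + b%:E * W S X)%E.
  move=> hS; have hfS := hf S X hS.
  have hfin w : (W S X <= w%:E)%E -> isL2 mu (f S X) /\
      (\int[mu]_x ((f S X x - p x) ^+ 2)%:E <= (a * sqnorm mu (fun x => q S X jk x - p x) + b * w)%:E)%E.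
    move=> hw; have [h2 hle] := oracle_ineq p2 (fun X => @isL2_kernel_family S X) jk hw s2 hfS.
    by split => //; rewrite (sqnormE (isL2B h2 p2)) lee_fin.
  (* Square integrability is also needed where [W] is infinite, so it is read off the definition of
     the aggregate. *)
  have f2 : isL2 mu (f S X).
    case: agg hf hfS {hfin} => _ /=.
      move=> [D [phi [[phiL _ _ _] ->]]]; apply: isL2_lincomb => j; exact: Lfun2_isL2.
    by move=> [lam [_ _ ->]]; apply: isL2_lincomb => j; exact: isL2_kernel_family.
  split => //; have := W0 S X; have := hfin; rewrite /B (sqnormE (isL2B (isL2_kernel_family S X jk) p2)).
  case: (W S X) => [w| |]// => hfin' w0.
    by have [_] := hfin' w (lexx _); rewrite EFinD !EFinM.
  (* Where [W] is infinite the bound is [+oo], because [b > 0]. *)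
  by rewrite gt0_muley ?lte_fin// addeC addye ?leey// -EFinM.
pose k : R := #|SS|%:R^-1.
have k0 : 0 <= k by rewrite invr_ge0.
have step1 X : (L2norm (fun x => averaged_aggregate SS f X x - p x)%R ^+ 2 <=
   \sum_(S in SS) k%:E * (a%:E * B S X + b%:E * W S X))%E.
  have ms S : S \in SS -> measurable_fun setT (fun x => f S X x - p x).
    by move=> hS; exact: (isL2B (loss S X hS).1 p2).1.
  have avgE x : averaged_aggregate SS f X x - p x = k * \sum_(S in SS) (f S X x - p x).
    rewrite /averaged_aggregate sumrB sumr_const mulrBr -[p x *+ _]mulr_natl mulKf//.
    by rewrite pnatr_eq0 -lt0n.
  have ha2 : isL2 mu (fun x => averaged_aggregate SS f X x - p x).
    rewrite (_ : (fun x => _) = (fun x => k * \sum_(S in SS) (f S X x - p x))); last by apply/funext.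
    by apply: isL2Z; apply: isL2_sum => S hS; exact: (isL2B (loss S X hS).1 p2).
  rewrite /L2norm (Lnorm2_sqr_integral _ ha2.1).
  apply: (@le_trans _ _ (\int[mu]_x (\sum_(S in SS) (k * (f S X x - p x) ^+ 2)%:E)))%E.
    apply: ge0_le_integralT => x; first by rewrite lee_fin sqr_ge0.
    by rewrite sumEFin lee_fin avgE; exact: sqr_mean_le.
  rewrite ge0_integral_sum_cond//; last 2 first.
  - by move=> S hS; apply/measurable_EFinP; apply: measurable_funM; [exact: measurable_cst|apply: measurable_funX; exact: ms].
  - by move=> S x _; rewrite lee_fin mulr_ge0// sqr_ge0.
  apply: lee_sum => S hS.
  have -> : (\int[mu]_x (k * (f S X x - p x) ^+ 2)%:E = k%:E * \int[mu]_x ((f S X x - p x) ^+ 2)%:E)%E.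
    rewrite -ge0_integralZl_EFin//.
    - by move=> x _; rewrite lee_fin sqr_ge0.
    - by apply/measurable_EFinP; apply: measurable_funX; exact: ms.
  by apply: lee_wpmul2l; [rewrite lee_fin|exact: (loss S X hS).2].
have step2 S : S \in SS -> (\int[iid_law p n]_X (a%:E * B S X + b%:E * W S X) <=
   (a * (((2 * pi) ^+ d)^-1 * (h `^ (2 * beta) * Q + (m%:R * h ^+ d)^-1 * sqnorm mu (pinsker (pinsker_exponent d N jk.1))))
   + b * ((N * grid_size d n a0)%:R * (L / (n - m)%:R)))%:E)%E.
  move=> hS; have Sm := SSm S hS.
  have mcE (c : R) (F : n.-tuple (Rvec R d) -> \bar R) : measurable_fun setT F -> measurable_fun setT (fun X => c%:E * F X)%E.
    by move=> mF; apply: emeasurable_funM => //; exact: measurable_cst.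
  rewrite ge0_integralD//; last 4 first.
  - by move=> X _; rewrite mule_ge0 ?lee_fin.
  - exact: mcE.
  - by move=> X _; rewrite mule_ge0 ?lee_fin ?(ltW hb).
  - exact: mcE.
  rewrite !ge0_integralZl_EFin ?(ltW hb)//.
  rewrite EFinD !(EFinM a) !(EFinM b); apply: leeD; apply: lee_wpmul2l.
  - by rewrite lee_fin.
  - have h0 : 0 < h by exact: bandwidth_gt0.
    have := kernel_estimator_risk d_gt0 beta_gt hp (n := n) (S := S) h0 bb _ (K_pinsker (exponent_gt0 jk.1)).
    by rewrite Sm; apply.
  - by rewrite lee_fin ltW.
  - have V0 : (0 < #|finset.setC S|)%N by rewrite cardsCs finset.setCK card_ord Sm subn_gt0.
    have := integral_max_excess pL p2 (measurable_kernel_family S) (isL2_kernel_family S) (kernel_family_merge S) V0.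
    by rewrite card_prod !card_ord cardsCs finset.setCK card_ord Sm.
rewrite /risk.
apply: (@le_trans _ _ (\int[iid_law p n]_X (\sum_(S in SS) k%:E * (a%:E * B S X + b%:E * W S X)))%E).
  apply: ge0_le_integralT => X; last exact: step1.
  by apply: sqre_ge0.
have mI S : measurable_fun setT (fun X => a%:E * B S X + b%:E * W S X)%E.
  by apply: emeasurable_funD; apply: emeasurable_funM => //; exact: measurable_cst.
have I0 S X : (0 <= a%:E * B S X + b%:E * W S X)%E.
  by apply: adde_ge0; rewrite mule_ge0 ?lee_fin ?(ltW hb).
rewrite ge0_integral_sum_cond; last 2 first.
- by move=> S _; apply: emeasurable_funM => //; exact: measurable_cst.
- by move=> S X _; rewrite mule_ge0 ?lee_fin.
set C := (X in (_ <= X%:E)%E) in step2 *.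
apply: (@le_trans _ _ (\sum_(S in SS) (k * C)%:E)%E).
  apply: lee_sum => S hS; rewrite ge0_integralZl_EFin// (EFinM k C).
  by apply: lee_wpmul2l; [rewrite lee_fin|exact: step2].
rewrite sumEFin sumr_const lee_fin -[_ *+ _]mulr_natl mulrA mulfV ?mul1r//.
by rewrite pnatr_eq0 -lt0n.
Qed.

End risk.

(** * Asymptotics *)

Section asymptotics.
Context {R : realType}.

Lemma near_ln_ge (A : R) : \forall n \near \oo, A <= ln n%:R.
Proof.
have := nbhs_infty_ger (expR A); apply: filterS => n hn.
have n0 : 0 < (n%:R : R) by exact: lt_le_trans (expR_gt0 A) hn.
by rewrite -[leLHS]expRK ler_ln ?posrE ?expR_gt0.
Qed.

Lemma cvg_powR_ln (c : R) : 0 < c -> (n%:R `^ (- c) : R) @[n --> \oo] --> 0.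
Proof. by move=> c0; apply: (cvg_comp _ _ cvgr_idn (powRN_cvgy c0)). Qed.

Lemma cvg_inv_ln : (ln n%:R : R)^-1 @[n --> \oo] --> 0.
Proof.
apply/cvgr0Pnorm_le => e e0; have := near_ln_ge e^-1; apply: filterS => n hn.
have ei : 0 < e^-1 by rewrite invr_gt0.
have l0 : 0 < ln (n%:R : R) by exact: lt_le_trans hn.
by rewrite ger0_norm ?invr_ge0 ?(ltW l0)// invf_ple ?posrE.
Qed.

Lemma cvg_inv_nat : (n%:R^-1 : R) @[n --> \oo] --> 0.
Proof.
apply/cvgr0Pnorm_le => e e0; have := nbhs_infty_ger e^-1; apply: filterS => n hn.
have n0 : 0 < (n%:R : R) by apply: lt_le_trans hn; rewrite invr_gt0.
by rewrite ger0_norm ?invr_ge0 ?(ltW n0)// invf_ple ?posrE.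
Qed.

Lemma ln_le_powR (e x : R) : 0 < e -> 0 < x -> ln x <= e^-1 * x `^ e.
Proof.
move=> e0 x0; rewrite ler_pdivlMl// -ln_powR.
have h := powR_gt0 e x0.
have := @le_ln1Dx R (x `^ e - 1); have -> : 1 + (x `^ e - 1) = x `^ e by ring.
move=> hl; apply: (le_trans (hl _)); first by rewrite ltrBrDl subrr.
by rewrite gerBl.
Qed.

Lemma cvg_ln_powR (q c : R) : 0 <= q -> 0 < c ->
  ((ln n%:R : R) `^ q * n%:R `^ (- c)) @[n --> \oo] --> 0.
Proof.
move=> q0 c0.
have q1 : 0 < q + 1 by rewrite ltr_wpDl.
(* With this choice [e * q <= c / 2], so half of the decay is left after [ln_le_powR]. *)
pose e := c / (2 * (q + 1)).
have e0 : 0 < e by rewrite divr_gt0// mulr_gt0.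
have c2 : 0 < c / 2 by rewrite divr_gt0.
have h : (e^-1 `^ q * n%:R `^ (- (c / 2)) : R) @[n --> \oo] --> 0.
  by rewrite -(mulr0 (e^-1 `^ q)); apply: cvgMr; exact: cvg_powR_ln.
apply: (squeeze_cvgr _ (cvg_cst 0) h); near=> n.
have n1 : 1 <= (n%:R : R) by near: n; exact: nbhs_infty_ger.
have l0 : 0 <= ln (n%:R : R) by near: n; exact: near_ln_ge.
have n0 : 0 < (n%:R : R) by exact: lt_le_trans n1.
rewrite mulr_ge0 ?powR_ge0//=.
apply: (@le_trans _ _ ((e^-1 * n%:R `^ e) `^ q * n%:R `^ (- c))).
  rewrite ler_wpM2r ?powR_ge0//; apply: ge0_ler_powR; rewrite ?nnegrE//.
    by rewrite mulr_ge0 ?invr_ge0 ?powR_ge0 ?(ltW e0).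
  exact: ln_le_powR.
rewrite powRM ?powR_ge0 ?invr_ge0 ?(ltW e0)// -powRrM -mulrA -powR_split//.
rewrite ler_wpM2l ?powR_ge0// ler_powR//.
rewrite -subr_ge0 (_ : - (c / 2) - (e * q - c) = c / (2 * (q + 1))).
  by rewrite divr_ge0 ?(ltW c0)// mulr_ge0// ltW.
by rewrite /e; field; rewrite gt_eqF.
Unshelve. all: by end_near. Qed.

Lemma limn_esup_bounded (u : nat -> R) : (limn_esup (fun n => (u n)%:E) < +oo)%E ->
  exists B : R, \forall n \near \oo, u n <= B.
Proof.
rewrite limn_esup_lim.
have -> : limn (esups (fun n => (u n)%:E)) = ereal_inf (range (esups (fun n => (u n)%:E))).
  by apply: cvg_lim => //; exact: cvg_esups_inf.
move=> /ereal_inf_lt[_ [k _ <-]] h.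
have ub n : (k <= n)%N -> ((u n)%:E <= esups (fun n => (u n)%:E) k)%E.
  by move=> kn; apply: ereal_sup_ubound; exists n.
move: h ub; case: (esups _ k) => [B| |]// _ ub.
  by exists B; exists k => // n /= kn; rewrite -lee_fin ub.
by have := ub k (leqnn k).
Qed.

(** The bound [ln (1 + x) <= x] at [x = - a / (1 + a)]. *)
Lemma ln1D_ge (a : R) : 0 < a -> a / (1 + a) <= ln (1 + a).
Proof.
move=> a0; have a1 : 0 < 1 + a by rewrite addr_gt0.
have := @le_ln1Dx R (- (a / (1 + a))).
have -> : 1 + - (a / (1 + a)) = (1 + a)^-1 by field; rewrite gt_eqF.
rewrite lnV ?posrE// lerN2; apply.
by rewrite ltrN2 ltr_pdivrMr// mul1r ltrDr.
Qed.

End asymptotics.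

(** * Grids of exponents and bandwidths *)

Section grid.
Context {R : realType} (d : nat).
Hypothesis d_gt0 : (0 < d)%N.

Lemma pinsker_exponentE N j :
  pinsker_exponent d N j = d%:R / 2 + j%:R * (Num.sqrt N%:R)^-1 :> R.
Proof.
rewrite /pinsker_exponent; elim: j => [|j IH] /=; first by rewrite mul0r addr0.
by rewrite IH -[j.+1%:R]natr1 mulrDl mul1r addrA.
Qed.

Lemma pinsker_exponent_gt0 N j : 0 < pinsker_exponent d N j :> R.
Proof.
rewrite pinsker_exponentE ltr_wpDr ?mulr_ge0 ?invr_ge0 ?sqrtr_ge0//.
by rewrite divr_gt0// ltr0n.
Qed.

(** [N] steps of length [N^(-1/2)] cover a range of order [sqrt N]: the mesh shrinks while the range
    exceeds any [beta]. The last hypothesis says that the index found is at most [N - 1]. *)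
Lemma pinsker_exponent_choice N (beta : R) : (0 < N)%N -> d%:R / 2 < beta ->
  (beta - d%:R / 2) * Num.sqrt N%:R + 1 < N%:R ->
  exists k : 'I_N, beta <= pinsker_exponent d N k <= beta + (Num.sqrt N%:R)^-1.
Proof.
move=> N0 hb hN; set s : R := Num.sqrt N%:R in hN *.
have s0 : 0 < s by rewrite sqrtr_gt0 ltr0n.
pose k := (Num.truncn ((beta - d%:R / 2) * s)).+1.
have xs0 : 0 <= (beta - d%:R / 2) * s by rewrite mulr_ge0 ?ltW// subr_gt0.
have /andP[k1 k2] := truncn_itv xs0.
have kN : (k < N)%N.
  rewrite -(ltr_nat R); apply: le_lt_trans hN.
  by rewrite /k; move: (Num.truncn _) k1 => t k1; rewrite -[t.+1%:R]natr1 lerD2r.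
exists (Ordinal kN); rewrite pinsker_exponentE -/s /=.
rewrite -lerBlDl ler_pdivlMr// (ltW k2)/= /k.
move: (Num.truncn _) k1 => t k1; rewrite -[t.+1%:R]natr1 mulrDl mul1r addrA lerD2r.
by rewrite -lerBrDl ler_pdivrMr.
Qed.

Context (n : nat) (a0 : R).
Hypothesis a0_gt0 : 0 < a0.
Hypothesis ln_gt0 : 0 < ln (n%:R : R).
Notation a := (a0 / ln (n%:R : R)).
Notation hg := (h_geom d n a0).

Let n_gt0 : 0 < (n%:R : R).
Proof. by rewrite ltNge; apply/negP => /ln0 h; move: ln_gt0; rewrite h ltxx. Qed.

Let a_gt0 : 0 < a. Proof. exact: divr_gt0. Qed.

Lemma h_min_gt0 : 0 < h_min d n :> R.
Proof. by rewrite powR_gt0// mulr_gt0. Qed.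

Lemma h_geom_gt0 j : 0 < hg j.
Proof. by rewrite mulr_gt0 ?exprn_gt0 ?addr_gt0// h_min_gt0. Qed.

Lemma bandwidth_gt0 j : 0 < bandwidth d n a0 j.
Proof. by rewrite /bandwidth; case: ifP => // _; exact: h_geom_gt0. Qed.

(** Take logarithms and use [ln1D_ge]. The bound provides both the existence of [grid_last] and its
    size. *)
Lemma h_geom_lt1 j : hg j < 1 ->
  j%:R <= (d%:R^-1 * ln (n%:R * ln n%:R)) * ((1 + a) / a).
Proof.
move=> h; have := h_geom_gt0 j; move: h.
rewrite -(ltr_ln (_ : hg j \is Num.pos) (_ : 1 \is Num.pos)) ?posrE ?h_geom_gt0//.
rewrite /h_geom ln1 lnM ?posrE ?exprn_gt0 ?addr_gt0// ?h_min_gt0// lnXn ?addr_gt0// ln_powR.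
move=> h _.
have h1 : j%:R * ln (1 + a) <= d%:R^-1 * ln (n%:R * ln n%:R).
  by rewrite mulr_natl -subr_ge0 -oppr_le0 opprB addrC -mulNr addrC ltW.
have h2 := ln1D_ge a_gt0.
have a1 : 0 < 1 + a by rewrite addr_gt0.
have aa : 0 < a / (1 + a) by rewrite divr_gt0.
have -> : (1 + a) / a = (a / (1 + a))^-1 by rewrite [RHS]invf_div.
rewrite ler_pdivlMr//; apply: le_trans h1.
by rewrite ler_wpM2l.
Qed.

Lemma grid_lastP : h_min d n < 1 :> R ->
  hg (grid_last d n a0) < 1 /\ forall k, hg k < 1 -> (k <= grid_last d n a0)%N.
Proof.
move=> h0; rewrite /grid_last; apply: (@xgetPex _ 0%N [set j | hg j < 1 /\ forall k, hg k < 1 -> (k <= j)%N]).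
have ex : exists j, hg j < 1 by exists 0%N; rewrite /h_geom expr0 mul1r.
have bd : forall j, hg j < 1 -> (j <= Num.truncn ((d%:R^-1 * ln (n%:R * ln n%:R)) * ((1 + a) / a) : R))%N.
  by move=> j /h_geom_lt1 hj; rewrite -(@natrK R j) //; exact: le_truncn.
by case: (ex_maxnP ex bd) => j hj jmax; exists j.
Qed.

Lemma h_geom_choice (H : R) : h_min d n <= H -> H < 1 ->
  exists j : 'I_(grid_size d n a0), bandwidth d n a0 j <= H /\ H <= (1 + a) * bandwidth d n a0 j.
Proof.
move=> h0 h1.
have [g1 g2] := grid_lastP (le_lt_trans h0 h1).
have ex : exists j, hg j <= H by exists 0%N; rewrite /h_geom expr0 mul1r.
have bd : forall j, hg j <= H -> (j <= grid_last d n a0)%N.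
  by move=> j hj; apply: g2; exact: le_lt_trans hj h1.
case: (ex_maxnP ex bd) => j hj jmax.
have jl := bd _ hj.
have jlt : (j < grid_size d n a0)%N by rewrite /grid_size ltnS leqW.
exists (Ordinal jlt); rewrite /bandwidth /= jl; split => //.
(* By maximality of [j] the next geometric bandwidth exceeds [H]. *)
have : ~~ (hg j.+1 <= H) by apply/negP => /jmax; rewrite ltnn.
by rewrite -ltNge /h_geom exprS -mulrA => /ltW.
Qed.

(** One logarithm comes from the range of the grid on the logarithmic scale, the other from its mesh
    [a0 / ln n]. *)
Lemma grid_size_le : h_min d n < 1 :> R -> ln (ln (n%:R : R)) <= ln n%:R -> a0 <= ln n%:R -> 1 <= ln (n%:R : R) ->
  (grid_size d n a0)%:R <= (4 / (d%:R * a0) + 2) * ln n%:R ^+ 2 :> R.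
Proof.
move=> h0 hl ha l1.
have d0 : 0 < (d%:R : R) by rewrite ltr0n.
have [g1 _] := grid_lastP h0.
have := h_geom_lt1 g1; rewrite lnM ?posrE// /grid_size -[_.+2]addn2 natrD => hg1.
have -> : (4 / (d%:R * a0) + 2) * ln n%:R ^+ 2 = d%:R^-1 * (2 * ln n%:R) * (2 * ln n%:R / a0) + 2 * ln n%:R ^+ 2 :> R.
  by field; rewrite !gt_eqF.
apply: lerD; last first.
  by rewrite -[leLHS]mulr1 ler_pM2l// exprn_ege1.
apply: le_trans hg1 _; apply: ler_pM.
- by rewrite mulr_ge0 ?invr_ge0 ?(ltW d0)// addr_ge0 ?(ltW ln_gt0)// ln_ge0.
- by apply: divr_ge0; [apply: addr_ge0 => //|]; exact: ltW.
- by rewrite ler_pM2l ?invr_gt0// mulr2n mulrDl !mul1r lerD2l.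
have -> : (1 + a) / a = (ln n%:R + a0) / a0 by field; rewrite !gt_eqF.
rewrite ler_pM2r ?invr_gt0// mulr2n mulrDl !mul1r lerD2l//.
Qed.

End grid.

Lemma powRVl (R : realType) (x a : R) : 0 < x -> x^-1 `^ a = (x `^ a)^-1.
Proof. by move=> x0; rewrite -powR_inv1 ?(ltW x0)// -powRrM mulN1r powRN. Qed.

(** * Optimal bandwidth and the constant *)

Section optimum.
Context {R : realType} (d : nat) (beta Q : R).
Hypothesis d_gt0 : (0 < d)%N.
Hypothesis beta_gt0 : 0 < beta.
Hypothesis Q_gt0 : 0 < Q.
Notation gamma := (2 * beta + d%:R).
Notation r := (2 * beta / gamma).

Definition pinsker_energy (b : R) : R := sqnorm (leb R d) (pinsker b).

(** The derivative in [h] of [h^(2 beta) Q + E / (n h^d)] vanishes when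
    [h^gamma = d E / (2 beta Q n)]; this is [d E / (2 beta Q)] for [E = pinsker_energy beta]. *)
Definition optimal_scale : R := beta * sphere_area d / ((beta + d%:R) * gamma * Q).

(* the minimiser of h^(2 beta) Q + pinsker_energy beta / (n h^d) *)
Definition optimal_bandwidth (n : nat) : R := (optimal_scale / n%:R) `^ gamma^-1.

Let dR : 0 < d%:R :> R. Proof. by rewrite ltr0n. Qed.
Let gamma_gt0 : 0 < gamma. Proof. by rewrite addr_gt0// mulr_gt0. Qed.
Let v_gt0 : 0 < vball R d. Proof. by have [] := Gamma_vball (R := R) d_gt0. Qed.
Let sE : sphere_area d = d%:R * vball R d. Proof. by have [] := Gamma_vball (R := R) d_gt0. Qed.

Lemma sphere_area_gt0 : 0 < sphere_area d :> R.
Proof. by rewrite sE mulr_gt0. Qed.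

Lemma optimal_scale_gt0 : 0 < optimal_scale.
Proof.
apply: divr_gt0; first by apply: mulr_gt0 => //; exact: sphere_area_gt0.
by apply: mulr_gt0 => //; apply: mulr_gt0 => //; exact: addr_gt0.
Qed.

Lemma pinsker_constant_gt0 : 0 < pinsker_constant d beta Q.
Proof.
apply: mulr_gt0; [apply: divr_gt0|]; rewrite ?powR_gt0//.
- exact: mulr_gt0.
- by apply: mulr_gt0 => //; exact: pi2d_gt0.
- by apply: divr_gt0; [apply: mulr_gt0 => //; exact: sphere_area_gt0|exact: addr_gt0].
Qed.

(** As [d / gamma = 1 - r], every power reduces to [k^r], [n^r] and [(Q gamma)^r]; what remains is a
    rational identity. *)
Lemma optimum n : (0 < n)%N ->
  ((2 * pi) ^+ d)^-1 * (optimal_bandwidth n `^ (2 * beta) * Q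
     + (n%:R * optimal_bandwidth n ^+ d)^-1 * pinsker_energy beta) =
  pinsker_constant d beta Q * n%:R `^ (- r).
Proof.
move=> n0; have nR : 0 < n%:R :> R by rewrite ltr0n.
have k0 := optimal_scale_gt0; set k := optimal_scale in k0 *.
have kn0 : 0 < k / n%:R by rewrite divr_gt0.
have g0 : gamma != 0 by rewrite gt_eqF.
have e1 : optimal_bandwidth n `^ (2 * beta) = k `^ r * n%:R `^ (- r).
  rewrite /optimal_bandwidth -/k -powRrM (mulrC gamma^-1) powRM ?invr_ge0 ?(ltW k0) ?(ltW nR)//.
  by rewrite powRVl// powRN.
have dg : d%:R / gamma = 1 - r by field.
have e2 : optimal_bandwidth n ^+ d = k * (k `^ r)^-1 * (n%:R^-1 * n%:R `^ r).
  rewrite -powR_mulrn ?powR_ge0// /optimal_bandwidth -/k -powRrM (mulrC gamma^-1) dg.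
  rewrite (powR_split 1 (- r) kn0) powRr1 ?(ltW kn0)// powRN powRM ?invr_ge0 ?(ltW k0) ?(ltW nR)//.
  rewrite powRVl//; have := powR_gt0 r k0; have := powR_gt0 r nR.
  move: (n%:R `^ r) (k `^ r) => u w u0 w0.
  by field; rewrite !gt_eqF.
rewrite e1 e2 /pinsker_energy integral_pinsker_sqr// /pinsker_constant dg.
have gq : 0 < Q * gamma by rewrite mulr_gt0.
have bs : 0 < beta * sphere_area d / (beta + d%:R) :> R.
  by apply: divr_gt0; [apply: mulr_gt0 => //; exact: sphere_area_gt0|exact: addr_gt0].
have kE : k = (beta * sphere_area d / (beta + d%:R)) * (Q * gamma)^-1.
  rewrite /k /optimal_scale; move: (sphere_area d) => S.
  by field; rewrite !gt_eqF// addr_gt0.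
have krE : k `^ r = (beta * sphere_area d / (beta + d%:R)) `^ r * ((Q * gamma) `^ r)^-1.
  by rewrite {1}kE powRM ?(ltW bs)// ?invr_ge0 ?(ltW gq)// powRVl.
rewrite (powR_split 1 (- r) gq) powRr1 ?(ltW gq)// !powRN.
have kr := powR_gt0 r k0.
have -> : (beta * sphere_area d / (beta + d%:R)) `^ r = k `^ r * (Q * gamma) `^ r.
  by rewrite krE -[RHS]mulrA mulVf ?mulr1// gt_eqF// powR_gt0.
have nr := powR_gt0 r nR; have qr := powR_gt0 r gq; have P0 := pi2d_gt0 (R := R) (d := d).
move: (k `^ r) (n%:R `^ r) ((Q * gamma) `^ r) ((2 * pi) ^+ d) P0 kr nr qr => u1 u2 u3 u4 ? ? ? ?.
rewrite kE sE; move: (vball R d) v_gt0 => v v0.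
field.
by rewrite !gt_eqF// ?addr_gt0// ?mulr_gt0// addr_gt0.
Qed.

(** The denominator in [integral_pinsker_sqr] increases with [b], so only the factor [b ^+ 2]
    contributes. *)
Lemma pinsker_energy_le (b delta : R) : beta <= b -> b <= beta + delta ->
  pinsker_energy b <= (1 + delta / beta) ^+ 2 * pinsker_energy beta.
Proof.
move=> bb bd; have b0 : 0 < b by exact: lt_le_trans bb.
rewrite /pinsker_energy !integral_pinsker_sqr//.
have D1 : 0 < (d%:R + beta) * (d%:R + 2 * beta) by rewrite mulr_gt0// addr_gt0// mulr_gt0.
have D2 : 0 < (d%:R + b) * (d%:R + 2 * b) by rewrite mulr_gt0// addr_gt0// mulr_gt0.
apply: (@le_trans _ _ (2 * vball R d * b ^+ 2 / ((d%:R + beta) * (d%:R + 2 * beta)))).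
  apply: ler_wpM2l; first by rewrite mulr_ge0 ?sqr_ge0// mulr_ge0// ltW.
  rewrite lef_pV2 ?posrE//.
  apply: ler_pM; rewrite ?addr_ge0 ?mulr_ge0 ?(ltW beta_gt0) ?(ltW dR)// lerD2l//.
  by rewrite ler_pM2l.
have -> : (1 + delta / beta) ^+ 2 * (2 * vball R d * beta ^+ 2 / ((d%:R + beta) * (d%:R + 2 * beta))) =
  2 * vball R d * (beta + delta) ^+ 2 / ((d%:R + beta) * (d%:R + 2 * beta)).
  by field; rewrite !gt_eqF// ?addr_gt0// mulr_gt0.
rewrite ler_pM2r ?invr_gt0// ler_pM2l ?mulr_gt0//.
by rewrite lerXn2r ?nnegrE ?(ltW b0)//; exact: le_trans (ltW b0) bd.
Qed.

(** The three factors pay for the bandwidth grid, the reduced training sample and the exponent grid.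
    They are spent on the variance; the bias term only improves when [h <= H]. *)
Lemma pinsker_risk_le (h H a m n mu b delta : R) : 0 < h -> h <= H -> H <= (1 + a) * h ->
  0 < a -> 0 < n -> 0 < mu -> mu <= 1 -> n * mu <= m -> 0 <= delta -> beta <= b -> b <= beta + delta ->
  h `^ (2 * beta) * Q + (m * h ^+ d)^-1 * pinsker_energy b <=
  ((1 + a) ^+ d * mu^-1 * (1 + delta / beta) ^+ 2) *
  (H `^ (2 * beta) * Q + (n * H ^+ d)^-1 * pinsker_energy beta).
Proof.
move=> h0 hH Hh a_gt0 n0 mu0 mu1 nm d0 bb bd.
have H0 : 0 < H by exact: lt_le_trans hH.
have a1 : 1 <= 1 + a by rewrite lerDl ltW.
have f1 : 1 <= (1 + a) ^+ d by exact: exprn_ege1.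
have f2 : 1 <= mu^-1 by rewrite invf_ge1.
have f3 : 1 <= (1 + delta / beta) ^+ 2 by apply: exprn_ege1; rewrite lerDl divr_ge0 ?(ltW beta_gt0).
have hd0 : 0 < h ^+ d by rewrite exprn_gt0.
have Hd0 : 0 < H ^+ d by rewrite exprn_gt0.
have f10 := lt_le_trans ltr01 f1; have f20 := lt_le_trans ltr01 f2; have f30 := lt_le_trans ltr01 f3.
rewrite mulrDr; apply: lerD.
  rewrite mulrA ler_pM2r//; apply: (@le_trans _ _ (H `^ (2 * beta))).
    by apply: ge0_ler_powR; rewrite ?nnegrE ?(ltW h0) ?(ltW H0)// mulr_ge0 ?(ltW beta_gt0).
  rewrite ler_peMl ?powR_ge0//.
  by rewrite -[leLHS]mulr1 -[X in X * _ <= _]mulr1; apply: ler_pM => //; apply: ler_pM.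
have e : (1 + a) ^+ d / mu * (1 + delta / beta) ^+ 2 * ((n * H ^+ d)^-1 * pinsker_energy beta) =
  ((n * mu)^-1 * ((1 + a) ^+ d / H ^+ d)) * ((1 + delta / beta) ^+ 2 * pinsker_energy beta).
  by rewrite !invfM; ring.
rewrite e; apply: ler_pM.
- by rewrite invr_ge0 mulr_ge0 ?(ltW hd0)//; apply: le_trans nm; rewrite mulr_ge0 ?(ltW n0) ?(ltW mu0).
- exact: sqnorm_ge0.
- have nmu0 : 0 < n * mu by rewrite mulr_gt0.
  rewrite invfM; apply: ler_pM.
  + by rewrite invr_ge0; apply: le_trans nm; exact: ltW.
  + by rewrite invr_ge0 ltW.
  + by rewrite lef_pV2 ?posrE//; exact: lt_le_trans nm.
  + rewrite ler_pdivlMr// mulrC ler_pdivrMr// -exprMn lerXn2r ?nnegrE ?(ltW H0)//.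
    by rewrite mulr_ge0 ?(ltW h0)//; exact: le_trans a1.
- exact: pinsker_energy_le.
Qed.

End optimum.

Section rates.
Context {R : realType}.

Lemma train_size_bounds n (l := ln (n%:R : R)) : 1 < l ->
  n%:R * (1 - l^-1 - n%:R^-1) <= (@train_size R n)%:R :> R /\
  (@train_size R n)%:R <= n%:R * (1 - l^-1) :> R.
Proof.
move=> l1; have l0 : 0 < l by exact: lt_trans l1.
have n0 : 0 < (n%:R : R) by rewrite ltNge; apply/negP => /ln0 h; move: l0; rewrite /l h ltxx.
have x0 : 0 <= n%:R * (1 - l^-1).
  by rewrite mulr_ge0 ?(ltW n0)// subr_ge0 invf_le1// ltW.
have := truncn_itv x0; rewrite /train_size -/l => /andP[h1 h2]; split => //.
have -> : n%:R * (1 - l^-1 - n%:R^-1) = n%:R * (1 - l^-1) - 1 by field; rewrite !gt_eqF.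
by rewrite lerBlDr natr1 ltW.
Qed.

Lemma near_sqrt_gap (N : nat -> nat) (c : R) : N n @[n --> \oo] --> \oo -> 0 < c ->
  \forall n \near \oo, c * Num.sqrt (N n)%:R + 1 < (N n)%:R.
Proof.
(* If [t = sqrt N >= c + 2] then [t^2 >= c t + 2 t > c t + 1]. *)
move=> N_cvg c0; pose T := c + 2.
have h : \forall n \near \oo, T ^+ 2 <= (N n)%:R by exact: N_cvg (nbhs_infty_ger (T ^+ 2)).
apply: filterS h => n hn; set t : R := Num.sqrt _.
have T0 : 0 <= T by rewrite addr_ge0// ltW.
have Tt : T <= t by rewrite -(ger0_norm T0) -sqrtr_sqr ler_wsqrtr.
have -> : (N n)%:R = t ^+ 2 :> R by rewrite sqr_sqrtr.
have t0 : 0 < t by apply: lt_le_trans Tt; rewrite addr_gt0.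
apply: (@lt_le_trans _ _ (T * t)); last by rewrite expr2 ler_pM2r.
rewrite /T mulrDl ltrD2l; have : 2 <= t by apply: le_trans Tt; rewrite lerDr ltW.
by move=> t2; lra.
Qed.

Lemma cvg_inv_sqrt (N : nat -> nat) : N n @[n --> \oo] --> \oo ->
  (Num.sqrt (N n)%:R : R)^-1 @[n --> \oo] --> 0.
Proof.
move=> N_cvg; apply/cvgr0Pnorm_le => e e0.
have h : \forall n \near \oo, (e^-1) ^+ 2 <= ((N n)%:R : R) by exact: N_cvg (nbhs_infty_ger _).
apply: filterS h => n hn.
have ei : 0 < e^-1 by rewrite invr_gt0.
have h2 : e^-1 <= Num.sqrt (N n)%:R by rewrite -(ger0_norm (ltW ei)) -sqrtr_sqr ler_wsqrtr.
have s0 := lt_le_trans ei h2.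
by rewrite ger0_norm ?invr_ge0 ?(ltW s0)// invf_ple ?posrE.
Qed.

(** The [o(1)] of the theorem: the three factors of [pinsker_risk_le], the oracle factor
    [1 + 4 / ln n], and the remainder relative to the main term. *)
Definition excess_rate (d : nat) (a0 beta c q : R) (N : nat -> nat) (n : nat) : R :=
  (1 + a0 / ln n%:R) ^+ d * (1 - (ln n%:R)^-1 - n%:R^-1)^-1
    * (1 + (Num.sqrt (N n)%:R)^-1 / beta) ^+ 2 * (1 + 4 * (ln n%:R)^-1) - 1
  + c * (ln n%:R `^ q * n%:R `^ (- (d%:R / (2 * beta + d%:R)))).

Lemma cvg_excess_rate d (a0 beta c q : R) N : (0 < d)%N -> 0 < beta -> 0 <= q ->
  N n @[n --> \oo] --> \oo -> excess_rate d a0 beta c q N n @[n --> \oo] --> 0.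
Proof.
move=> d0 b0 q0 N_cvg.
have dR : 0 < d%:R :> R by rewrite ltr0n.
have li := @cvg_inv_ln R.
have e : 0 = (1 + a0 * 0) ^+ d * (1 - 0 - 0)^-1 * (1 + 0 / beta) ^+ 2 * (1 + 4 * 0) - 1 + c * 0 :> R.
  by rewrite !mulr0 mul0r !addr0 !subr0 !expr1n invr1 !mulr1 subrr.
rewrite [X in _ --> X]e; apply: cvgD; last first.
  apply: cvgMr; apply: cvg_ln_powR => //.
  by rewrite divr_gt0// addr_gt0// mulr_gt0.
apply: cvgB; last exact: cvg_cst.
have cX (k : nat) (f : nat -> R) (x : R) : f n @[n --> \oo] --> x -> f n ^+ k @[n --> \oo] --> x ^+ k.
  move=> fx; elim: k => [|k IH]; first by rewrite expr0; exact: cvg_cst.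
  by rewrite exprS; under eq_fun do rewrite exprS; exact: cvgM.
apply: cvgM; last first.
  by apply: cvgD; [exact: cvg_cst|apply: cvgMr].
apply: cvgM; last first.
  apply: cX; apply: cvgD; first exact: cvg_cst.
  by apply: cvgMl; exact: cvg_inv_sqrt.
apply: cvgM.
  by apply: cX; apply: cvgD; [exact: cvg_cst|apply: cvgMr].
apply: cvgV; first by rewrite !subr0 oner_eq0.
by apply: cvgB; [apply: cvgB => //; exact: cvg_cst|exact: cvg_inv_nat].
Qed.

Lemma near_optimal_bandwidth d (beta Q : R) : (0 < d)%N -> 0 < beta -> 0 < Q ->
  \forall n \near \oo, h_min d n <= optimal_bandwidth d beta Q n < 1.
Proof.
move=> d0 b0 Q0; have dR : 0 < d%:R :> R by rewrite ltr0n.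
have k0 := optimal_scale_gt0 d0 b0 Q0; set k := optimal_scale d beta Q in k0.
have g0 : 0 < 2 * beta + d%:R :> R by rewrite addr_gt0// mulr_gt0.
set g := 2 * beta + d%:R in g0.
have gi : 0 < g^-1 by rewrite invr_gt0.
pose c := d%:R^-1 - g^-1.
(* The optimal bandwidth is of order [n^(-1/g)], larger than [n^(-1/d)] by the power [n^c]. *)
have c0 : 0 < c by rewrite subr_gt0 ltf_pV2 ?posrE// ltrDr mulr_gt0.
near=> n.
have l1 : 1 <= ln (n%:R : R) by near: n; exact: near_ln_ge.
have n1 : k + 1 <= (n%:R : R) by near: n; exact: nbhs_infty_ger.
have n0 : 0 < (n%:R : R) by apply: lt_le_trans n1; rewrite addr_gt0.
have kn0 : 0 < k / n%:R by rewrite divr_gt0.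
have hc : n%:R `^ (- c) <= k `^ g^-1.
  near: n; have := @cvg_powR_ln R c c0; move=> /cvgr0Pnorm_le /(_ _ (powR_gt0 g^-1 k0)).
  by apply: filterS => n; rewrite ger0_norm// powR_ge0.
rewrite /optimal_bandwidth -/k -/g; apply/andP; split; last first.
  have e1 : 1 `^ g^-1 = 1 :> R by rewrite powR1.
  rewrite -[ltRHS]e1; apply: gt0_ltr_powR; rewrite ?nnegrE ?(ltW kn0)//.
  by rewrite ltr_pdivrMr// mul1r; apply: lt_le_trans n1; rewrite ltrDl.
apply: (@le_trans _ _ (n%:R `^ (- d%:R^-1))).
  rewrite /h_min !powRN lef_pV2 ?posrE ?powR_gt0 ?mulr_gt0 ?(lt_le_trans ltr01 l1)//.
  apply: ge0_ler_powR; rewrite ?nnegrE ?invr_ge0 ?(ltW dR) ?(ltW n0)//.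
    by rewrite mulr_ge0 ?(ltW n0)//; exact: le_trans l1.
  by rewrite ler_peMr// ltW.
rewrite powRM ?(ltW k0) ?invr_ge0 ?(ltW n0)// powRVl// -powRN.
have -> : - d%:R^-1 = - c + - g^-1 :> R by rewrite /c; ring.
by rewrite powR_split// ler_wpM2r// powR_ge0.
Unshelve. all: by end_near. Qed.

End rates.

Lemma pdf_bound_ge0 (R : realType) d (beta Q : R) : 0 <= Q -> 0 <= pdf_bound d beta Q.
Proof.
move=> Q0; have P0 := pi2d_gt0 (R := R) (d := d).
rewrite /pdf_bound mulr_ge0 ?invr_ge0 ?(ltW P0)// mulr_ge0// addr_ge0// mulr_ge0//.
by apply: Rintegral_ge0 => t _; exact: powR_ge0.
Qed.

(** The four powers of [l] come from the oracle factor (one), the bandwidth grid (two) and the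
    validation size [k >= n / l] (one); [lB] stands for the growth of [N]. *)
Lemma remainder_le (R : realType) (l n N G B L C k lB : R) : 1 <= l -> 0 < n ->
  0 <= N -> 0 <= G -> 0 <= L -> 0 < k ->
  N <= B * lB -> G <= C * l ^+ 2 -> n / l <= k ->
  (l + 2) ^+ 2 / l * (N * G * (L / k)) <= 9 * B * C * L * (lB * l ^+ 4) / n.
Proof.
move=> l1 n0 N0 G0 L0 k0 hN hG hk; have l0 : 0 < l by exact: lt_le_trans l1.
have hL : L / k <= L * (l / n).
  by rewrite ler_wpM2l// -[l / n]invf_div lef_pV2 ?posrE// divr_gt0.
have h1 : (l + 2) ^+ 2 / l <= 9 * l.
  rewrite ler_pdivrMr// -mulrA -expr2.
  have -> : 9 * l ^+ 2 = (3 * l) ^+ 2 by ring.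
  by rewrite lerXn2r ?nnegrE; lra.
have h2 : N * G <= (B * lB) * (C * l ^+ 2) by apply: ler_pM.
have -> : 9 * B * C * L * (lB * l ^+ 4) / n = 9 * l * ((B * lB) * (C * l ^+ 2) * (L * (l / n))).
  by field; rewrite gt_eqF.
apply: ler_pM => //.
- by rewrite divr_ge0 ?sqr_ge0 ?(ltW l0).
- by rewrite !mulr_ge0 ?invr_ge0 ?(ltW k0).
- by apply: ler_pM => //; rewrite ?mulr_ge0 ?invr_ge0 ?(ltW k0).
Qed.

Theorem corollary6p3 (R : realType) (d : nat) (a0 nu : R) (N : nat -> nat)
    (K : R -> Rvec R d -> R) (agg : aggregation)
    (SS : forall n, {set {set 'I_n}})
    (ptilde : forall n, {set 'I_n} -> n.-tuple (Rvec R d) -> Rvec R d -> R)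
    (d_gt0 : (0 < d)%N) (a0_gt0 : 0 < a0)
    (N_ge2 : forall n, (2 <= N n)%N)
    (N_cvg : N n @[n --> \oo] --> \oo)
    (nu_gt0 : 0 < nu)
    (N_log : (limn_esup (fun n => ((N n)%:R / (ln n%:R) `^ nu : R)%:E)
              < +oo)%E)
    (K_pinsker : forall b, 0 < b -> is_pinsker_kernel b (K b))
    (SS_neq0 : forall n, SS n != finset.set0)
    (SS_size : forall n S, S \in SS n -> #|S| = @train_size R n)
    (ptilde_agg : forall n S (X : n.-tuple (Rvec R d)), S \in SS n ->
       is_aggregate agg X (finset.setC S)
         (kernel_family X (a0 := a0) (N := N n) K S) (ptilde n S X))
    (beta Q : R) (beta_gt : d%:R / 2 < beta) (Q_gt0 : 0 < Q) :
  exists2 o1 : nat -> R, o1 n @[n --> \oo] --> 0 &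
    \forall n \near \oo,
      (ereal_sup [set risk (averaged_aggregate (SS n) (ptilde n)) p
                 | p in Sobolev_class beta Q]
       <= (pinsker_constant d beta Q
           * n%:R `^ (- (2 * beta / (2 * beta + d%:R)))
           * (1 + o1 n))%:E)%E.
Proof.
have b0 : 0 < beta by exact: (beta_gt0 beta_gt).
have dR : 0 < d%:R :> R by rewrite ltr0n.
have C0 := pinsker_constant_gt0 d_gt0 b0 Q_gt0.
set C := pinsker_constant d beta Q in C0 *.
have [B hB] := limn_esup_bounded N_log.
have L0 := pdf_bound_ge0 d beta (ltW Q_gt0).
set L := pdf_bound d beta Q in L0.
pose G : R := 4 / (d%:R * a0) + 2.
(* Division by [C] factors the constant out of the remainder; the logarithm has exponent [nu] from
   [N n] and 4 from [remainder_le]. *)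
exists (excess_rate d a0 beta (9 * B * G * L / C) (nu + 4) N).
  by apply: cvg_excess_rate => //; rewrite addr_ge0// ltW.
have gap0 : 0 < beta - d%:R / 2 by rewrite subr_gt0.
have hgap := near_sqrt_gap N_cvg gap0.
near=> n.
have l4 : 4 <= ln (n%:R : R) by near: n; exact: near_ln_ge.
have la : a0 <= ln (n%:R : R) by near: n; exact: near_ln_ge.
have n4 : 4 <= (n%:R : R) by near: n; exact: nbhs_infty_ger.
have hNB : (N n)%:R / (ln n%:R) `^ nu <= B by near: n; exact: hB.
have gapn : (beta - d%:R / 2) * Num.sqrt (N n)%:R + 1 < (N n)%:R by near: n; exact: hgap.
have /andP[H1 H2] : h_min d n <= optimal_bandwidth d beta Q n < 1.
  by near: n; exact: near_optimal_bandwidth.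
set l := ln (n%:R : R) in l4 la hNB.
have l0 : 0 < l by exact: lt_le_trans l4.
have l1 : 1 < l by apply: lt_le_trans l4; rewrite ltr1n.
have n0 : 0 < (n%:R : R) by exact: lt_le_trans n4.
have n0' : (0 < n)%N by rewrite -(ltr0n R).
have hN : (N n)%:R <= B * l `^ nu.
  by rewrite -ler_pdivrMr// powR_gt0.
have [k /andP[kb kd]] : exists k : 'I_(N n),
    beta <= pinsker_exponent d (N n) k <= beta + (Num.sqrt (N n)%:R)^-1.
  by apply: pinsker_exponent_choice => //; exact: leq_trans (N_ge2 n).
have [j [jH Hj]] := h_geom_choice a0_gt0 l0 H1 H2.
have [m1 m2] := train_size_bounds l1.
set m := @train_size R n in m1 m2; set mu := 1 - l^-1 - n%:R^-1 in m1.
have li : l^-1 <= 4^-1 by rewrite lef_pV2 ?posrE.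
have ni : (n%:R : R)^-1 <= 4^-1 by rewrite lef_pV2 ?posrE.
have li0 : 0 < l^-1 by rewrite invr_gt0.
have ni0 : 0 < (n%:R : R)^-1 by rewrite invr_gt0.
(* [l] and [n] were taken at least 4 to make this fraction at least one half. *)
have mu0 : 0 < mu by rewrite /mu; move: (l^-1) (n%:R^-1) li ni => x y *; lra.
have mu1 : mu <= 1 by rewrite /mu; move: (l^-1) (n%:R^-1) li0 ni0 => x y *; lra.
have m0 : (0 < m)%N by rewrite -(ltr0n R); apply: lt_le_trans m1; exact: mulr_gt0.
have mn : (m < n)%N.
  by rewrite -(ltr_nat R); apply: le_lt_trans m2 _; rewrite gtr_pMr// gtrBl.
have lm : n%:R / l <= (n - m)%:R :> R.
  rewrite natrB ?(ltnW mn)//; move: m2; rewrite mulrBr mulr1.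
  by rewrite lerBrDl -lerBrDr.
apply: ub_ereal_sup => _ [p hp <-].
(* The parameter [s = ln n + 2] of the oracle inequality. *)
have s2 : 2 < l + 2 by rewrite ltrDr.
have := @aggregate_risk R d p beta Q d_gt0 beta_gt hp K K_pinsker n (N n) a0
  (fun k => pinsker_exponent_gt0 d_gt0 (N n) k)
  (fun j => bandwidth_gt0 d a0_gt0 l0 j)
  agg (SS n) m (ptilde n) (l + 2) (k, j) (SS_neq0 n) (SS_size n) _
  (fun S X hS => ptilde_agg n S X hS) s2 kb.
rewrite m0 mn => /(_ isT)/le_trans; apply; rewrite lee_fin /=.
set h := bandwidth d n a0 j in jH Hj *.
have h0 : 0 < h by exact: bandwidth_gt0.
have a_gt0 : 0 < a0 / l by rewrite divr_gt0.
have d0 : 0 <= (Num.sqrt (N n)%:R)^-1 :> R by rewrite invr_ge0 sqrtr_ge0.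
have hmain := pinsker_risk_le d_gt0 b0 Q_gt0 h0 jH Hj a_gt0 n0 mu0 mu1 m1 d0 kb kd.
set rho := (X in _ <= X * _) in hmain.
have P0 := pi2d_gt0 (R := R) (d := d).
have e1 : (l + 2 + 2) / (l + 2 - 2) = 1 + 4 * l^-1 by field; rewrite gt_eqF//; lra.
have e2 : l + 2 - 2 = l by ring.
rewrite e1 e2.
have t1 : ((2 * pi) ^+ d)^-1 * (h `^ (2 * beta) * Q + (m%:R * h ^+ d)^-1 * sqnorm (leb R d) (pinsker (pinsker_exponent d (N n) k)))
    <= rho * (C * n%:R `^ (- (2 * beta / (2 * beta + d%:R)))).
  rewrite -(optimum d_gt0 b0 Q_gt0 n0') mulrCA ler_pM2l ?invr_gt0//.
have t2 : (l + 2) ^+ 2 / l * ((N n * grid_size d n a0)%:R * (L / (n - m)%:R)) <=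
    9 * B * G * L * (l `^ nu * l ^+ 4) / n%:R.
  rewrite natrM; apply: remainder_le => //; first exact: ltW.
  - by rewrite ltr0n subn_gt0.
  - apply: grid_size_le => //; [exact: le_lt_trans H1 H2| |exact: ltW].
    exact/ltW/ln_sublinear.
apply: le_trans (lerD (ler_wpM2l _ t1) t2) _.
  by rewrite addr_ge0// mulr_ge0// ltW.
set r := 2 * beta / (2 * beta + d%:R).
have g0 : 0 < 2 * beta + d%:R by rewrite addr_gt0// mulr_gt0.
(* The remainder of order [1 / n] is smaller than the rate by a power of [n], which outweighs its
   logarithms. *)
have e3 : (n%:R : R)^-1 = n%:R `^ (- r) * n%:R `^ (- (d%:R / (2 * beta + d%:R))).
  rewrite -powR_split// -powR_inv1 ?(ltW n0)//; congr (_ `^ _).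
  by rewrite /r; field; rewrite gt_eqF.
have e4 : l `^ (nu + 4) = l `^ nu * l ^+ 4 by rewrite powR_split// -powR_mulrn ?(ltW l0).
have -> : excess_rate d a0 beta (9 * B * G * L / C) (nu + 4) N n =
    rho * (1 + 4 * l^-1) - 1 + 9 * B * G * L / C * (l `^ nu * l ^+ 4 * n%:R `^ (- (d%:R / (2 * beta + d%:R)))).
  by rewrite /excess_rate -e4.
rewrite e3; move: (n%:R `^ (- r)) (n%:R `^ (- _)) (l `^ nu) (rho) => u w z t.
rewrite le_eqVlt; apply/orP; left; apply/eqP.
by field; rewrite !gt_eqF.
Unshelve. all: by end_near. Qed.
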